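(* Let $p\ge q\ge 2$ be integers, $a,b\in\mathbb{C}$, and suppose that the map $F(z,w)=z^p+w^q+a\bar z+b\bar w$, regarded as a map $\mathbb{R}^4\to\mathbb{R}^2$, is an excellent map. Then the number of cusps of $F$ lies in the interval $[(p+1)(q-1),\,(p-1)(q+1)]$. In particular, if $p=q$ then $F$ has exactly $p^2-1$ cusps.
   Context: A smooth map $g:X^4\to Y^2$ is an excellent map if for every $x\in X$ there are local coordinates $(x_1,\dots,x_4)$ centered at $x$ and $(y_1,y_2)$ centered at $g(x)$ in which $g$ takes one of the forms: (1) $(x_1,x_2)$; (2) $(x_1,x_2^2+x_3^2+x_4^2)$ (definite fold); (3) $(x_1,x_2^2+x_3^2-x_4^2)$ (indefinite fold); (4) $(x_1,x_2^2\pm x_3^2+x_1x_4+x_4^3)$ (cusp). *)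

(* Defs.v *)
From Stdlib Require Import Reals Lra Lia Arith List.
Open Scope R_scope.

(** * Euclidean space R^n as real sequences vanishing beyond index n
    (coordinates x_1..x_n of the paper are indices 0..n-1). *)
Definition Rn (n : nat) : Type := {v : nat -> R | forall i, (n <= i)%nat -> v i = 0}.

Definition coord {n : nat} (v : Rn n) (i : nat) : R := proj1_sig v i.

Definition Rn0 (n : nat) : Rn n := exist _ (fun _ => 0) (fun _ _ => eq_refl).

Lemma upd_ok (n : nat) (v : Rn n) (i : nat) (t : R) :
  forall j, (n <= j)%nat ->
    (if (Nat.eqb j i && Nat.ltb i n)%bool then t else proj1_sig v j) = 0.
Proof.
  intros j Hj. destruct (Nat.eqb j i) eqn:E1; destruct (Nat.ltb i n) eqn:E2; simpl;
  try (apply (proj2_sig v); exact Hj).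
  apply Nat.eqb_eq in E1. apply Nat.ltb_lt in E2. lia.
Qed.

(** v with its i-th coordinate replaced by t (no-op if i >= n). *)
Definition upd {n : nat} (v : Rn n) (i : nat) (t : R) : Rn n :=
  exist _ (fun j => if (Nat.eqb j i && Nat.ltb i n)%bool then t else proj1_sig v j)
        (upd_ok n v i t).

Lemma mk2_ok (a b : R) :
  forall i, (2 <= i)%nat -> (match i with 0%nat => a | 1%nat => b | _ => 0 end) = 0.
Proof. intros [|[|i]] H; [lia|lia|reflexivity]. Qed.

Definition mk2 (a b : R) : Rn 2 :=
  exist _ (fun i => match i with 0%nat => a | 1%nat => b | _ => 0 end) (mk2_ok a b).

Definition near {n : nat} (x y : Rn n) (eps : R) : Prop :=
  forall i, (i < n)%nat -> Rabs (coord y i - coord x i) < eps.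

Definition open_set {n : nat} (U : Rn n -> Prop) : Prop :=
  forall x, U x -> exists eps, eps > 0 /\ forall y, near x y eps -> U y.

Definition continuous_on {n : nat} (U : Rn n -> Prop) (f : Rn n -> R) : Prop :=
  forall x, U x -> forall eps, eps > 0 ->
    exists delta, delta > 0 /\ forall y, U y -> near x y delta -> Rabs (f y - f x) < eps.

Definition has_partial {n : nat} (U : Rn n -> Prop) (f : Rn n -> R) (i : nat)
  (g : Rn n -> R) : Prop :=
  forall x, U x -> derivable_pt_lim (fun t => f (upd x i t)) (coord x i) (g x).

Fixpoint Ck (k : nat) {n : nat} (U : Rn n -> Prop) (f : Rn n -> R) : Prop :=
  match k with
  | O => continuous_on U f
  | S k' => continuous_on U f /\
      forall i, (i < n)%nat -> exists g, has_partial U f i g /\ Ck k' U g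
  end.

Definition smooth_on {n : nat} (U : Rn n -> Prop) (f : Rn n -> R) : Prop :=
  forall k, Ck k U f.

Definition smooth_map_on {n m : nat} (U : Rn n -> Prop) (f : Rn n -> Rn m) : Prop :=
  forall j, (j < m)%nat -> smooth_on U (fun x => coord (f x) j).

Definition chart_at {n : nat} (x : Rn n) (U : Rn n -> Prop) (phi : Rn n -> Rn n)
  (V : Rn n -> Prop) (psi : Rn n -> Rn n) : Prop :=
  open_set U /\ open_set V /\ U x /\ phi x = Rn0 n /\
  (forall u, U u -> V (phi u)) /\ (forall v, V v -> U (psi v)) /\
  (forall u, U u -> psi (phi u) = u) /\ (forall v, V v -> phi (psi v) = v) /\
  smooth_map_on U phi /\ smooth_map_on V psi.

Definition local_form (g : Rn 4 -> Rn 2) (x : Rn 4) (nf : Rn 4 -> Rn 2) : Prop :=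
  exists U phi V psi U' phi' V' psi' W,
    chart_at x U phi V psi /\ chart_at (g x) U' phi' V' psi' /\
    open_set W /\ W (Rn0 4) /\ (forall u, W u -> V u) /\
    (forall u, W u -> U' (g (psi u))) /\
    (forall u, W u -> phi' (g (psi u)) = nf u).

Definition x1 (u : Rn 4) := coord u 0.
Definition x2 (u : Rn 4) := coord u 1.
Definition x3 (u : Rn 4) := coord u 2.
Definition x4 (u : Rn 4) := coord u 3.

Definition nf_regular (u : Rn 4) : Rn 2 := mk2 (x1 u) (x2 u).
Definition nf_def_fold (u : Rn 4) : Rn 2 :=
  mk2 (x1 u) (x2 u ^ 2 + x3 u ^ 2 + x4 u ^ 2).
Definition nf_indef_fold (u : Rn 4) : Rn 2 :=
  mk2 (x1 u) (x2 u ^ 2 + x3 u ^ 2 - x4 u ^ 2).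
Definition nf_cusp (s : bool) (u : Rn 4) : Rn 2 :=
  mk2 (x1 u) (x2 u ^ 2 + (if s then x3 u ^ 2 else - x3 u ^ 2)
              + x1 u * x4 u + x4 u ^ 3).

Definition is_cusp (g : Rn 4 -> Rn 2) (x : Rn 4) : Prop :=
  exists s, local_form g x (nf_cusp s).

Definition excellent (g : Rn 4 -> Rn 2) : Prop :=
  smooth_map_on (fun _ => True) g /\
  forall x, local_form g x nf_regular \/ local_form g x nf_def_fold \/
            local_form g x nf_indef_fold \/ is_cusp g x.

Definition Cx : Type := (R * R)%type.
Definition Cadd (z w : Cx) : Cx := (fst z + fst w, snd z + snd w).
Definition Cmul (z w : Cx) : Cx :=
  (fst z * fst w - snd z * snd w, fst z * snd w + snd z * fst w).
Fixpoint Cpow (z : Cx) (k : nat) : Cx :=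
  match k with O => (1, 0) | S k' => Cmul z (Cpow z k') end.
Definition Cconj (z : Cx) : Cx := (fst z, - snd z).

Definition Fmap (p q : nat) (a b : Cx) (x : Rn 4) : Rn 2 :=
  let z := (coord x 0, coord x 1) in
  let w := (coord x 2, coord x 3) in
  let r := Cadd (Cadd (Cpow z p) (Cpow w q)) (Cadd (Cmul a (Cconj z)) (Cmul b (Cconj w))) in
  mk2 (fst r) (snd r).

(* Main.v *)
From Stdlib Require Import Reals Lra Lia Arith List Classical.
From Stdlib Require Import FunctionalExtensionality ProofIrrelevance.
Require Import Defs.
From Coquelicot Require Import Complex.
Open Scope R_scope.

(** The point (z, w) is singular iff [p z^(p-1) = - u conj a] and
    [q w^(q-1) = - u conj b] for some [u] with [|u| = 1]; then [Re (al * F)] is critical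
    for [conj al = u al]. Its Hessian is [Re (al (F_zz dz^2 + F_ww dw^2))], and the kernel
    of [dF] is the orthogonal complement, for this Hessian, of an explicit vector. Hence
    the Hessian degenerates on the kernel iff that vector is isotropic, i.e. iff
    [G + u conj G = 0] with [G = p (q-1) z^p + q (p-1) w^q]. The 2-jet of F up to changes
    of coordinates tells the normal forms apart by this degeneracy, so the cusps of an
    excellent F are exactly the solutions of these equations.

    The singular set is covered (p-1)-to-one by [z = zt y^(q-1)], [w = w0 y^(p-1)],
    [u = y^((p-1)(q-1))] with [|y| = 1] and [zt] one of the (p-1) solutions for [u = 1].
    On each circle the equation is a polynomial one of degree [(p-1)(q+1)] in y, which
    bounds the number of zeros from above; with [y = e^(ix)] it also reads
    [X cos (c + (p+1)(q-1) x / 2) + Y cos (c' + (p-1)(q+1) x / 2) = 0], and sign changes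
    yield at least [(p+1)(q-1)] zeros. The polynomial can vanish identically only if
    p = q, which is excluded because cusps are isolated. *)

(** The charts in the definition of an excellent map are arbitrary smooth maps, known only through
    iterated partial derivatives. What survives every change of charts is the differential, and the
    quadratic part restricted to its kernel and read modulo its image. Jets are therefore tested
    along curves: a second-order term with nothing below it passes through a differentiable map
    linearly, so second derivatives of the target chart never enter, and those of the source chart
    only contribute elements of the image. The parameter [y] is a common root: along the singular
    set [z] moves like [u^(1/(p-1))] and [w] like [u^(1/(q-1))], and [u = y^((p-1)(q-1))] turns both
    into powers of [y]. The [p - 1] circles compensate the [p - 1] lifts of each point, so bounds
    for one circle are bounds for the whole set. When [a] or [b] vanishes this parametrization
    breaks down; excellence then forces the corresponding exponent to be 2, and one circle with a
    binomial equation remains. *)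

Fixpoint sumn (n : nat) (f : nat -> R) : R :=
  match n with O => 0 | S k => sumn k f + f k end.

Lemma sumn_ext (n : nat) (f g : nat -> R) :
  (forall i, (i < n)%nat -> f i = g i) -> sumn n f = sumn n g.
Proof.
  induction n as [|n IH]; simpl; intros H; [reflexivity|].
  rewrite IH by (intros; apply H; lia). rewrite H by lia. reflexivity.
Qed.

Lemma sumn_le (n : nat) (f g : nat -> R) :
  (forall i, (i < n)%nat -> f i <= g i) -> sumn n f <= sumn n g.
Proof.
  induction n as [|n IH]; simpl; intros H; [lra|].
  apply Rplus_le_compat; [apply IH; intros; apply H; lia | apply H; lia].
Qed.

Lemma sumn_ge0 (n : nat) (f : nat -> R) :
  (forall i, (i < n)%nat -> 0 <= f i) -> 0 <= sumn n f.
Proof.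
  intros H. induction n as [|n IH]; simpl; [lra|].
  apply Rplus_le_le_0_compat; [apply IH; intros; apply H; lia | apply H; lia].
Qed.

Lemma sumn_scal_r (n : nat) (f : nat -> R) (c : R) :
  sumn n (fun i => f i * c) = sumn n f * c.
Proof. induction n as [|n IH]; simpl; [ring|rewrite IH; ring]. Qed.

Lemma sumn_minus_scal (n : nat) (d l g : nat -> R) (s : R) :
  sumn n (fun i => (d i - l i * s) * g i)
  = sumn n (fun i => g i * d i) - sumn n (fun i => g i * l i) * s.
Proof. induction n as [|n IH]; simpl; [ring|rewrite IH; ring]. Qed.

Lemma sumn_minus (n : nat) (f g : nat -> R) :
  sumn n (fun i => f i - g i) = sumn n f - sumn n g.
Proof. induction n as [|n IH]; simpl; [ring|rewrite IH; ring]. Qed.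

(** * Points of Euclidean space and lines through them *)

Lemma Rn_ext (n : nat) (x y : Rn n) :
  (forall i, (i < n)%nat -> coord x i = coord y i) -> x = y.
Proof.
  destruct x as [x hx], y as [y hy]; unfold coord; simpl; intros H.
  assert (E : x = y).
  { apply functional_extensionality; intros i.
    destruct (le_lt_dec n i) as [h|h]; [rewrite hx, hy by exact h; reflexivity|auto]. }
  subst y. f_equal. apply proof_irrelevance.
Qed.

Definition mkRn (n : nat) (f : nat -> R) : Rn n.
Proof.
  exists (fun i => if (i <? n)%nat then f i else 0).
  intros i hi. destruct (Nat.ltb_spec i n); [lia|reflexivity].
Defined.

Lemma coord_mkRn (n : nat) (f : nat -> R) (i : nat) :
  (i < n)%nat -> coord (mkRn n f) i = f i.
Proof.
  intros h. unfold coord, mkRn; simpl. destruct (Nat.ltb_spec i n); [reflexivity|lia].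
Qed.

Lemma coord_upd_same (n : nat) (x : Rn n) (i : nat) (t : R) :
  (i < n)%nat -> coord (upd x i t) i = t.
Proof.
  intros h. unfold coord, upd; simpl. rewrite Nat.eqb_refl.
  destruct (Nat.ltb_spec i n); [reflexivity|lia].
Qed.

Lemma coord_upd_other (n : nat) (x : Rn n) (i j : nat) (t : R) :
  j <> i -> coord (upd x i t) j = coord x j.
Proof.
  intros h. unfold coord, upd; simpl. destruct (Nat.eqb_spec j i); [lia|reflexivity].
Qed.

Definition line {n : nat} (x : Rn n) (v : nat -> R) (t : R) : Rn n :=
  mkRn n (fun i => coord x i + t * v i).

Lemma line_0 (n : nat) (x : Rn n) (v : nat -> R) : line x v 0 = x.
Proof. apply Rn_ext; intros i hi. unfold line; rewrite coord_mkRn by exact hi. ring. Qed.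

(** * Little-o calculus at 0 *)

(** Little-o of [t ^ k] at 0. The inequality is not strict and includes [t = 0], so it forces
    [h 0 = 0]. *)
Definition small (k : nat) (h : R -> R) : Prop :=
  forall eps, eps > 0 -> exists d, d > 0 /\
    forall t, Rabs t < d -> Rabs (h t) <= eps * Rabs t ^ k.

(** For [k = 2] this includes the vanishing of the first-order term. Expansions with nothing below
    order [k] are the ones that a once differentiable map transports linearly. *)
Definition lead (k : nat) (h : R -> R) (l : R) : Prop :=
  small k (fun t => h t - h 0 - l * t ^ k).

Definition exp2 (h : R -> R) (a b : R) : Prop :=
  small 2 (fun t => h t - h 0 - a * t - b * t ^ 2).

Definition locally_bounded (h : R -> R) : Prop :=
  exists B d, d > 0 /\ forall t, Rabs t < d -> Rabs (h t) <= B.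

Lemma small_near (k : nat) (f g : R -> R) (r : R) :
  r > 0 -> (forall t, Rabs t < r -> f t = g t) -> small k f -> small k g.
Proof.
  intros hr E H eps heps. destruct (H eps heps) as [d [hd Hd]].
  exists (Rmin r d). split; [apply Rmin_glb_lt; assumption|].
  intros t ht. rewrite <- E.
  - apply Hd. eapply Rlt_le_trans; [exact ht|apply Rmin_r].
  - eapply Rlt_le_trans; [exact ht|apply Rmin_l].
Qed.

Lemma small_ext (k : nat) (f g : R -> R) :
  (forall t, f t = g t) -> small k f -> small k g.
Proof. intros E. apply small_near with (r := 1); [lra|auto]. Qed.

Lemma small_plus (k : nat) (f g : R -> R) :
  small k f -> small k g -> small k (fun t => f t + g t).
Proof.
  intros Hf Hg eps heps.
  destruct (Hf (eps / 2)) as [d [hd Hd]]; [lra|].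
  destruct (Hg (eps / 2)) as [d' [hd' Hd']]; [lra|].
  exists (Rmin d d'). split; [apply Rmin_glb_lt; assumption|].
  intros t ht.
  assert (h1 : Rabs t < d) by (eapply Rlt_le_trans; [exact ht|apply Rmin_l]).
  assert (h2 : Rabs t < d') by (eapply Rlt_le_trans; [exact ht|apply Rmin_r]).
  specialize (Hd t h1). specialize (Hd' t h2).
  eapply Rle_trans; [apply Rabs_triang|]. lra.
Qed.

Lemma small_mult_bounded (k : nat) (f g : R -> R) :
  small k f -> locally_bounded g -> small k (fun t => f t * g t).
Proof.
  intros Hf [B [d [hd Hd]]] eps heps.
  assert (hB : 0 <= B).
  { specialize (Hd 0). rewrite Rabs_R0 in Hd. specialize (Hd hd).
    pose proof (Rabs_pos (g 0)). lra. }
  destruct (Hf (eps / (B + 1))) as [d' [hd' Hd']].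
  { apply Rdiv_lt_0_compat; lra. }
  exists (Rmin d d'). split; [apply Rmin_glb_lt; assumption|].
  intros t ht.
  assert (h1 : Rabs t < d) by (eapply Rlt_le_trans; [exact ht|apply Rmin_l]).
  assert (h2 : Rabs t < d') by (eapply Rlt_le_trans; [exact ht|apply Rmin_r]).
  specialize (Hd t h1). specialize (Hd' t h2).
  rewrite Rabs_mult.
  apply Rle_trans with (eps / (B + 1) * Rabs t ^ k * (B + 1)).
  - apply Rmult_le_compat; try apply Rabs_pos; lra.
  - right. field. lra.
Qed.

Lemma locally_bounded_const (c : R) : locally_bounded (fun _ => c).
Proof. exists (Rabs c), 1. split; [lra|intros; lra]. Qed.

Lemma locally_bounded_id : locally_bounded (fun t => t).
Proof. exists 1, 1. split; [lra|intros; lra]. Qed.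

Lemma locally_bounded_plus (f g : R -> R) :
  locally_bounded f -> locally_bounded g -> locally_bounded (fun t => f t + g t).
Proof.
  intros [B [d [hd Hd]]] [B' [d' [hd' Hd']]].
  exists (B + B'), (Rmin d d'). split; [apply Rmin_glb_lt; assumption|].
  intros t ht.
  assert (h1 : Rabs t < d) by (eapply Rlt_le_trans; [exact ht|apply Rmin_l]).
  assert (h2 : Rabs t < d') by (eapply Rlt_le_trans; [exact ht|apply Rmin_r]).
  eapply Rle_trans; [apply Rabs_triang|]. specialize (Hd t h1). specialize (Hd' t h2). lra.
Qed.

Lemma locally_bounded_mult (f g : R -> R) :
  locally_bounded f -> locally_bounded g -> locally_bounded (fun t => f t * g t).
Proof.
  intros [B [d [hd Hd]]] [B' [d' [hd' Hd']]].
  exists (B * B'), (Rmin d d'). split; [apply Rmin_glb_lt; assumption|].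
  intros t ht.
  assert (h1 : Rabs t < d) by (eapply Rlt_le_trans; [exact ht|apply Rmin_l]).
  assert (h2 : Rabs t < d') by (eapply Rlt_le_trans; [exact ht|apply Rmin_r]).
  rewrite Rabs_mult. apply Rmult_le_compat; try apply Rabs_pos; auto.
Qed.

Lemma small_bounded (k : nat) (f : R -> R) : small k f -> locally_bounded f.
Proof.
  intros H. destruct (H 1) as [d [hd Hd]]; [lra|].
  exists 1, (Rmin d 1). split; [apply Rmin_glb_lt; lra|].
  intros t ht.
  assert (h1 : Rabs t < d) by (eapply Rlt_le_trans; [exact ht|apply Rmin_l]).
  assert (h2 : Rabs t < 1) by (eapply Rlt_le_trans; [exact ht|apply Rmin_r]).
  specialize (Hd t h1). rewrite Rmult_1_l in Hd.
  eapply Rle_trans; [exact Hd|].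
  rewrite <- (pow1 k). apply pow_incr. split; [apply Rabs_pos|lra].
Qed.

Lemma small_scal (k : nat) (f : R -> R) (c : R) : small k f -> small k (fun t => f t * c).
Proof. intros H. apply small_mult_bounded; [exact H|apply locally_bounded_const]. Qed.

Lemma small_zero (k : nat) : small k (fun _ => 0).
Proof.
  intros eps heps. exists 1. split; [lra|]. intros t _. rewrite Rabs_R0.
  apply Rmult_le_pos; [lra|apply pow_le, Rabs_pos].
Qed.

Lemma small_pow (k : nat) : small k (fun t => t ^ S k).
Proof.
  intros eps heps. exists eps. split; [exact heps|]. intros t ht.
  rewrite <- RPow_abs. simpl. apply Rmult_le_compat_r; [apply pow_le, Rabs_pos|lra].
Qed.

Lemma small_sumn (k n : nat) (f : nat -> R -> R) :
  (forall i, (i < n)%nat -> small k (f i)) -> small k (fun t => sumn n (fun i => f i t)).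
Proof.
  induction n as [|n IH]; intros H; simpl; [apply small_zero|].
  apply small_plus; [apply IH; intros; apply H; lia|apply H; lia].
Qed.

Lemma small_monomial_eq0 (k : nat) (c : R) : small k (fun t => c * t ^ k) -> c = 0.
Proof.
  intros H. destruct (Req_dec c 0) as [h|h]; [exact h|exfalso].
  destruct (H (Rabs c / 2)) as [d [hd Hd]].
  { pose proof (Rabs_pos_lt c h). lra. }
  specialize (Hd (d / 2)). rewrite (Rabs_pos_eq (d / 2)) in Hd by lra.
  specialize (Hd ltac:(lra)). rewrite Rabs_mult in Hd.
  assert (hp : 0 < (d / 2) ^ k) by (apply pow_lt; lra).
  rewrite (Rabs_pos_eq ((d / 2) ^ k)) in Hd by lra.
  pose proof (Rabs_pos_lt c h). nra.
Qed.

Lemma lead_unique (k : nat) (h : R -> R) (l l' : R) : lead k h l -> lead k h l' -> l = l'.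
Proof.
  intros H H'. apply Rminus_diag_uniq. apply (small_monomial_eq0 k).
  apply small_ext with (f := fun t => (h t - h 0 - l' * t ^ k) + (h t - h 0 - l * t ^ k) * (-1)).
  { intros t. ring. }
  apply small_plus; [exact H'|apply small_scal; exact H].
Qed.

Lemma lead_near (k : nat) (f g : R -> R) (l r : R) :
  r > 0 -> (forall t, Rabs t < r -> f t = g t) -> lead k f l -> lead k g l.
Proof.
  intros hr E. apply small_near with (r := r); [exact hr|].
  intros t ht. rewrite !E; [reflexivity| rewrite Rabs_R0; lra |exact ht].
Qed.

Lemma exp2_near (f g : R -> R) (a b r : R) :
  r > 0 -> (forall t, Rabs t < r -> f t = g t) -> exp2 f a b -> exp2 g a b.
Proof.
  intros hr E. apply small_near with (r := r); [exact hr|].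
  intros t ht. rewrite !E; [reflexivity| rewrite Rabs_R0; lra |exact ht].
Qed.

Lemma exp2_ext (f g : R -> R) (a b a' b' : R) :
  (forall t, f t = g t) -> a = a' -> b = b' -> exp2 f a b -> exp2 g a' b'.
Proof. intros E <- <-. apply exp2_near with (r := 1); [lra|auto]. Qed.

Lemma exp2_lead1 (h : R -> R) (a b : R) : exp2 h a b -> lead 1 h a.
Proof.
  intros H eps heps.
  destruct (H 1) as [d [hd Hd]]; [lra|].
  exists (Rmin d (eps / (1 + Rabs b))). pose proof (Rabs_pos b) as hb.
  split; [apply Rmin_glb_lt; [assumption|apply Rdiv_lt_0_compat; lra]|].
  intros t ht.
  assert (h1 : Rabs t < d) by (eapply Rlt_le_trans; [exact ht|apply Rmin_l]).
  assert (h2 : Rabs t < eps / (1 + Rabs b)) by (eapply Rlt_le_trans; [exact ht|apply Rmin_r]).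
  specialize (Hd t h1).
  replace (h t - h 0 - a * t ^ 1) with ((h t - h 0 - a * t - b * t ^ 2) + b * t ^ 2) by ring.
  eapply Rle_trans; [apply Rabs_triang|].
  rewrite Rabs_mult, <- RPow_abs.
  assert (h3 : Rabs t * (1 + Rabs b) <= eps).
  { apply Rlt_le. apply Rmult_lt_compat_r with (r := 1 + Rabs b) in h2; [|lra].
    replace (eps / (1 + Rabs b) * (1 + Rabs b)) with eps in h2 by (field; lra). exact h2. }
  pose proof (Rabs_pos t). nra.
Qed.

Lemma exp2_lead2 (h : R -> R) (b : R) : exp2 h 0 b -> lead 2 h b.
Proof. intros H. apply small_ext with (2 := H). intros t. ring. Qed.

Lemma exp2_const (c : R) : exp2 (fun _ => c) 0 0.
Proof. apply small_ext with (2 := small_zero 2). intros t. ring. Qed.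

Lemma exp2_plus (f g : R -> R) (a b a' b' : R) :
  exp2 f a b -> exp2 g a' b' -> exp2 (fun t => f t + g t) (a + a') (b + b').
Proof.
  intros H H'. apply small_ext with (2 := small_plus _ _ _ H H'). intros t. ring.
Qed.

Lemma exp2_scal (f : R -> R) (a b c : R) :
  exp2 f a b -> exp2 (fun t => c * f t) (c * a) (c * b).
Proof. intros H. apply small_ext with (2 := small_scal _ _ c H). intros t. ring. Qed.

Lemma exp2_mult (f g : R -> R) (a b a' b' : R) :
  exp2 f a b -> exp2 g a' b' ->
  exp2 (fun t => f t * g t) (a * g 0 + f 0 * a') (b * g 0 + a * a' + f 0 * b').
Proof.
  intros H H'.
  set (rf := fun t => f t - f 0 - a * t - b * t ^ 2).
  set (rg := fun t => g t - g 0 - a' * t - b' * t ^ 2).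
  assert (hg : locally_bounded g).
  { assert (h : locally_bounded (fun t => rg t + (g 0 + (a' * t + b' * (t * t))))).
    { apply locally_bounded_plus; [apply (small_bounded 2); exact H'|].
      repeat first [apply locally_bounded_plus | apply locally_bounded_mult
        | apply locally_bounded_const | apply locally_bounded_id]. }
    destruct h as [B [d [hd Hd]]]. exists B, d. split; [exact hd|].
    intros t ht. specialize (Hd t ht). unfold rg in Hd.
    replace (g t - g 0 - a' * t - b' * t ^ 2 + (g 0 + (a' * t + b' * (t * t))))
      with (g t) in Hd by ring. exact Hd. }
  (* The remainder of the product: the remainder of each factor times a bounded function, plus the
     terms of order three and four in the product of the two quadratic polynomials. *)
  apply small_ext with (f := fun t => rf t * g t
     + (rg t * (f 0 + (a * t + b * (t * t))) + t ^ 3 * (a * b' + b * a' + b * b' * t))).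
  { intros t. unfold rf, rg. ring. }
  apply small_plus; [apply small_mult_bounded; [exact H|exact hg]|].
  apply small_plus; apply small_mult_bounded; try exact H'; try apply small_pow;
  repeat first [apply locally_bounded_plus | apply locally_bounded_mult
        | apply locally_bounded_const | apply locally_bounded_id].
Qed.

Lemma lead1_derivable (h : R -> R) (l : R) : lead 1 h l -> derivable_pt_lim h 0 l.
Proof.
  intros H eps heps. destruct (H (eps / 2)) as [d [hd Hd]]; [lra|].
  exists (mkposreal d hd). simpl. intros t ht0 ht. specialize (Hd t ht).
  rewrite Rplus_0_l.
  replace ((h t - h 0) / t - l) with ((h t - h 0 - l * t ^ 1) / t) by (field; exact ht0).
  unfold Rdiv. rewrite Rabs_mult, Rabs_inv.
  pose proof (Rabs_pos_lt t ht0) as hp.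
  apply Rle_lt_trans with (eps / 2); [|lra].
  apply Rmult_le_reg_r with (Rabs t); [exact hp|].
  rewrite Rmult_assoc, Rinv_l by lra. rewrite (pow_1 (Rabs t)) in Hd. lra.
Qed.

(** * First-order expansion of C1 functions *)

Definition frechet {n : nat} (f : Rn n -> R) (x : Rn n) (g : nat -> R) : Prop :=
  forall eps, eps > 0 -> exists d, d > 0 /\ forall y, near x y d ->
    Rabs (f y - f x - sumn n (fun i => g i * (coord y i - coord x i)))
      <= eps * sumn n (fun i => Rabs (coord y i - coord x i)).

(** The mean value theorem with an arbitrary comparison slope [c]: a partial derivative at the base
    point gives differentiability, and [c = 0] bounds a Taylor remainder. *)
Lemma mvt_bound (h h' : R -> R) (s t c e : R) :
  (forall r, Rmin s t <= r <= Rmax s t -> derivable_pt_lim h r (h' r)) ->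
  (forall r, Rmin s t <= r <= Rmax s t -> Rabs (h' r - c) <= e) ->
  Rabs (h t - h s - c * (t - s)) <= e * Rabs (t - s).
Proof.
  assert (main : forall s t, s < t ->
    (forall r, s <= r <= t -> derivable_pt_lim h r (h' r)) ->
    (forall r, s <= r <= t -> Rabs (h' r - c) <= e) ->
    Rabs (h t - h s - c * (t - s)) <= e * Rabs (t - s)).
  { clear s t. intros s t hst Hd Hb.
    destruct (MVT_cor2 h h' s t hst Hd) as [r [E hr]].
    rewrite E. replace (h' r * (t - s) - c * (t - s)) with ((h' r - c) * (t - s)) by ring.
    rewrite Rabs_mult. apply Rmult_le_compat_r; [apply Rabs_pos|apply Hb; lra]. }
  destruct (Rtotal_order s t) as [hst|[hst|hst]]; intros Hd Hb.
  - rewrite Rmin_left, Rmax_right in Hd, Hb by lra. apply main; assumption.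
  - subst t. replace (h s - h s - c * (s - s)) with 0 by ring.
    replace (s - s) with 0 by ring. rewrite Rabs_R0, Rmult_0_r. lra.
  - rewrite Rmin_right, Rmax_left in Hd, Hb by lra.
    specialize (main t s hst Hd Hb).
    rewrite Rabs_minus_sym with (x := t).
    replace (h t - h s - c * (t - s)) with (- (h s - h t - c * (s - t))) by ring.
    rewrite Rabs_Ropp. exact main.
Qed.

(** Moving from [x] to [y] one coordinate at a time, each step is a one-variable mean value
    estimate; near [x] all partial derivatives are within [eps] of their values at [x]. *)
Lemma C1_frechet (n : nat) (U : Rn n -> Prop) (f : Rn n -> R) (g : nat -> Rn n -> R) (x : Rn n) :
  open_set U -> U x ->
  (forall i, (i < n)%nat -> has_partial U f i (g i)) ->
  (forall i, (i < n)%nat -> continuous_on U (g i)) ->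
  frechet f x (fun i => g i x).
Proof.
  intros hU hx Hg Hc eps heps.
  destruct (hU x hx) as [d0 [hd0 Hd0]].
  assert (Hd : exists d, d > 0 /\ d <= d0 /\ forall i y, (i < n)%nat -> near x y d ->
            Rabs (g i y - g i x) <= eps).
  { assert (K : forall m, (m <= n)%nat -> exists d, d > 0 /\ d <= d0 /\
       forall i y, (i < m)%nat -> near x y d -> Rabs (g i y - g i x) <= eps).
    { induction m as [|m IH]; intros hm.
      - exists d0. split; [exact hd0|]. split; [lra|]. intros; lia.
      - destruct IH as [d [hd [hdd Hd]]]; [lia|].
        destruct (Hc m ltac:(lia) x hx eps heps) as [d' [hd' Hd']].
        exists (Rmin d d'). split; [apply Rmin_glb_lt; assumption|].
        split; [eapply Rle_trans; [apply Rmin_l|exact hdd]|].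
        intros i y hi hy.
        assert (N1 : near x y d) by (intros j hj; eapply Rlt_le_trans; [apply hy, hj|apply Rmin_l]).
        assert (N2 : near x y d') by (intros j hj; eapply Rlt_le_trans; [apply hy, hj|apply Rmin_r]).
        destruct (Nat.eq_dec i m) as [->|h]; [|apply Hd; [lia|exact N1]].
        apply Rlt_le, Hd'; [|exact N2]. apply Hd0. intros j hj.
        eapply Rlt_le_trans; [apply N1, hj|exact hdd]. }
    apply K; lia. }
  destruct Hd as [d [hd [hdd Hd]]].
  exists d. split; [exact hd|]. intros y hy.
  (* Hybrid point: coordinates below [k] come from [y], the remaining ones from [x]. *)
  set (hyb := fun k => mkRn n (fun i => if (i <? k)%nat then coord y i else coord x i)).
  assert (Hh : forall m, (m <= n)%nat ->
    Rabs (f (hyb m) - f x - sumn m (fun i => g i x * (coord y i - coord x i)))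
      <= eps * sumn m (fun i => Rabs (coord y i - coord x i))).
  { induction m as [|m IH]; intros hm; simpl.
    - replace (hyb 0%nat) with x.
      + replace (f x - f x - 0) with 0 by ring. rewrite Rabs_R0; lra.
      + apply Rn_ext; intros i hi. unfold hyb; rewrite coord_mkRn by exact hi. reflexivity.
    - specialize (IH ltac:(lia)).
      assert (E0 : upd (hyb m) m (coord x m) = hyb m).
      { apply Rn_ext; intros i hi. destruct (Nat.eq_dec i m) as [->|h].
        - rewrite coord_upd_same by exact hi. unfold hyb; rewrite coord_mkRn by exact hi.
          rewrite Nat.ltb_irrefl; reflexivity.
        - rewrite coord_upd_other by exact h. reflexivity. }
      assert (E1 : upd (hyb m) m (coord y m) = hyb (S m)).
      { apply Rn_ext; intros i hi. destruct (Nat.eq_dec i m) as [->|h].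
        - rewrite coord_upd_same by exact hi. unfold hyb; rewrite coord_mkRn by exact hi.
          destruct (Nat.ltb_spec m (S m)); [reflexivity|lia].
        - rewrite coord_upd_other by exact h. unfold hyb; rewrite !coord_mkRn by exact hi.
          destruct (Nat.ltb_spec i m), (Nat.ltb_spec i (S m)); try lia; reflexivity. }
      assert (N : forall r, Rmin (coord x m) (coord y m) <= r <= Rmax (coord x m) (coord y m) ->
                near x (upd (hyb m) m r) d).
      { intros r hr i hi. destruct (Nat.eq_dec i m) as [->|h].
        - rewrite coord_upd_same by exact hi. specialize (hy m hi).
          revert hr hy. unfold Rmin, Rmax, Rabs.
          destruct (Rle_dec (coord x m) (coord y m));
          destruct (Rcase_abs (coord y m - coord x m)), (Rcase_abs (r - coord x m)); lra.
        - rewrite coord_upd_other by exact h. unfold hyb; rewrite coord_mkRn by exact hi.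
          destruct (Nat.ltb_spec i m); [apply hy, hi|].
          replace (coord x i - coord x i) with 0 by ring. rewrite Rabs_R0; exact hd. }
      pose proof (mvt_bound (fun r => f (upd (hyb m) m r)) (fun r => g m (upd (hyb m) m r))
        (coord x m) (coord y m) (g m x) eps) as MV.
      cbv beta in MV. rewrite E0, E1 in MV.
      assert (B : Rabs (f (hyb (S m)) - f (hyb m) - g m x * (coord y m - coord x m))
                   <= eps * Rabs (coord y m - coord x m)).
      { apply MV.
        - intros r hr. pose proof (Hg m ltac:(lia) (upd (hyb m) m r)) as HP.
          rewrite coord_upd_same in HP by lia.
          assert (HU : U (upd (hyb m) m r)).
          { apply Hd0. intros i hi. eapply Rlt_le_trans; [apply (N r hr), hi|exact hdd]. }
          specialize (HP HU).
          replace (fun t : R => f (upd (hyb m) m t))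
            with (fun t : R => f (upd (upd (hyb m) m r) m t)); [exact HP|].
          apply functional_extensionality; intros t. f_equal.
          apply Rn_ext; intros i hi. destruct (Nat.eq_dec i m) as [->|h].
          + rewrite !coord_upd_same by exact hi; reflexivity.
          + rewrite !coord_upd_other by exact h; reflexivity.
        - intros r hr. apply Hd; [lia|apply N, hr]. }
      match goal with |- Rabs ?X <= _ => replace X with
        ((f (hyb m) - f x - sumn m (fun i => g i x * (coord y i - coord x i)))
         + (f (hyb (S m)) - f (hyb m) - g m x * (coord y m - coord x m))) by ring end.
      eapply Rle_trans; [apply Rabs_triang|]. lra. }
  specialize (Hh n (le_n n)).
  replace (hyb n) with y in Hh; [exact Hh|].
  apply Rn_ext; intros i hi. unfold hyb; rewrite coord_mkRn by exact hi.
  destruct (Nat.ltb_spec i n); [reflexivity|lia].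
Qed.

Lemma lead_bound (k : nat) (h : R -> R) (l : R) : lead k h l ->
  exists d, d > 0 /\ forall t, Rabs t < d -> Rabs (h t - h 0) <= (Rabs l + 1) * Rabs t ^ k.
Proof.
  intros H. destruct (H 1) as [d [hd Hd]]; [lra|].
  exists d. split; [exact hd|]. intros t ht. specialize (Hd t ht).
  replace (h t - h 0) with ((h t - h 0 - l * t ^ k) + l * t ^ k) by ring.
  eapply Rle_trans; [apply Rabs_triang|]. rewrite Rabs_mult, <- RPow_abs. lra.
Qed.

Lemma curve_bound (n k : nat) (c : R -> Rn n) (l : nat -> R) :
  (forall i, (i < n)%nat -> lead k (fun t => coord (c t) i) (l i)) ->
  exists d, d > 0 /\ forall t i, (i < n)%nat -> Rabs t < d ->
    Rabs (coord (c t) i - coord (c 0) i) <= (Rabs (l i) + 1) * Rabs t ^ k.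
Proof.
  intros H.
  assert (K : forall m, (m <= n)%nat -> exists d, d > 0 /\ forall t i, (i < m)%nat -> Rabs t < d ->
    Rabs (coord (c t) i - coord (c 0) i) <= (Rabs (l i) + 1) * Rabs t ^ k).
  { induction m as [|m IH]; intros hm; [exists 1; split; [lra|intros; lia]|].
    destruct IH as [d [hd Hd]]; [lia|].
    destruct (lead_bound _ _ _ (H m ltac:(lia))) as [d' [hd' Hd']].
    exists (Rmin d d'). split; [apply Rmin_glb_lt; assumption|].
    intros t i hi ht.
    assert (h1 : Rabs t < d) by (eapply Rlt_le_trans; [exact ht|apply Rmin_l]).
    assert (h2 : Rabs t < d') by (eapply Rlt_le_trans; [exact ht|apply Rmin_r]).
    destruct (Nat.eq_dec i m) as [->|h]; [apply Hd', h2|apply Hd; [lia|exact h1]]. }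
  apply K; lia.
Qed.

Lemma curve_near (n k : nat) (c : R -> Rn n) (l : nat -> R) (r : R) :
  (1 <= k)%nat -> r > 0 ->
  (forall i, (i < n)%nat -> lead k (fun t => coord (c t) i) (l i)) ->
  exists d, d > 0 /\ forall t, Rabs t < d -> near (c 0) (c t) r.
Proof.
  intros hk hr H. destruct (curve_bound _ _ _ _ H) as [d [hd Hd]].
  set (B := sumn n (fun i => Rabs (l i) + 1) + 1).
  assert (hB : forall i, (i < n)%nat -> Rabs (l i) + 1 <= B).
  { intros i hi. unfold B. clear -hi. induction n as [|n IH]; [lia|]. simpl.
    pose proof (Rabs_pos (l n)).
    assert (0 <= sumn n (fun i => Rabs (l i) + 1)).
    { apply sumn_ge0; intros j _. pose proof (Rabs_pos (l j)); lra. }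
    destruct (Nat.eq_dec i n) as [->|h]; [lra|].
    specialize (IH ltac:(lia)). lra. }
  assert (hB0 : 0 < B).
  { unfold B. assert (0 <= sumn n (fun i => Rabs (l i) + 1)); [|lra].
    apply sumn_ge0; intros j _. pose proof (Rabs_pos (l j)); lra. }
  assert (hrB : 0 < r / B) by (apply Rdiv_lt_0_compat; lra).
  exists (Rmin d (Rmin 1 (r / B))). split.
  { repeat apply Rmin_glb_lt; lra. }
  intros t ht i hi.
  assert (h1 : Rabs t < d) by (eapply Rlt_le_trans; [exact ht|apply Rmin_l]).
  assert (h0 : Rabs t < Rmin 1 (r / B)) by (eapply Rlt_le_trans; [exact ht|apply Rmin_r]).
  assert (h2 : Rabs t < 1) by (eapply Rlt_le_trans; [exact h0|apply Rmin_l]).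
  assert (h3 : Rabs t < r / B) by (eapply Rlt_le_trans; [exact h0|apply Rmin_r]).
  eapply Rle_lt_trans; [apply (Hd t i hi h1)|].
  assert (h4 : Rabs t ^ k <= Rabs t).
  { destruct k as [|k]; [lia|]. simpl. pose proof (Rabs_pos t).
    assert (Rabs t ^ k <= 1) by (rewrite <- (pow1 k); apply pow_incr; lra). nra. }
  pose proof (Rabs_pos t). pose proof (Rabs_pos (l i)). specialize (hB i hi).
  assert (h5 : Rabs t * B < r).
  { apply Rmult_lt_compat_r with (r := B) in h3; [|lra].
    replace (r / B * B) with r in h3 by (field; lra). exact h3. }
  nra.
Qed.

(** The displacement of the curve is [O(t^k)], so the Frechet remainder is [o(t^k)]; what is left is
    the linear part applied to the remainders of the coordinates. *)
Lemma frechet_chain (n k : nat) (f : Rn n -> R) (c : R -> Rn n) (g l : nat -> R) :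
  (1 <= k)%nat -> frechet f (c 0) g ->
  (forall i, (i < n)%nat -> lead k (fun t => coord (c t) i) (l i)) ->
  lead k (fun t => f (c t)) (sumn n (fun i => g i * l i)).
Proof.
  intros hk Hf Hc.
  set (rem := fun t => f (c t) - f (c 0)
     - sumn n (fun i => g i * (coord (c t) i - coord (c 0) i))).
  apply small_ext with (f := fun t => rem t
     + sumn n (fun i => (coord (c t) i - coord (c 0) i - l i * t ^ k) * g i)).
  { intros t. unfold rem.
    replace (sumn n (fun i => (coord (c t) i - coord (c 0) i - l i * t ^ k) * g i))
      with (sumn n (fun i => g i * (coord (c t) i - coord (c 0) i))
            - sumn n (fun i => g i * l i) * t ^ k); [ring|].
    rewrite sumn_minus_scal. reflexivity. }
  apply small_plus.
  - intros eps heps.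
    destruct (curve_bound _ _ _ _ Hc) as [d [hd Hd]].
    set (B := sumn n (fun i => Rabs (l i) + 1) + 1).
    assert (hB : 0 <= sumn n (fun i => Rabs (l i) + 1)).
    { apply sumn_ge0; intros j _. pose proof (Rabs_pos (l j)); lra. }
    destruct (Hf (eps / B)) as [d' [hd' Hd']].
    { apply Rdiv_lt_0_compat; unfold B; lra. }
    destruct (curve_near _ _ _ _ d' hk hd' Hc) as [d2 [hd2 Hd2]].
    exists (Rmin d d2). split; [apply Rmin_glb_lt; assumption|]. intros t ht.
    assert (h1 : Rabs t < d) by (eapply Rlt_le_trans; [exact ht|apply Rmin_l]).
    assert (h2 : Rabs t < d2) by (eapply Rlt_le_trans; [exact ht|apply Rmin_r]).
    eapply Rle_trans; [apply Hd', Hd2, h2|].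
    apply Rle_trans with (eps / B * (B * Rabs t ^ k)).
    + apply Rmult_le_compat_l; [apply Rlt_le, Rdiv_lt_0_compat; unfold B; lra|].
      apply Rle_trans with (sumn n (fun i => (Rabs (l i) + 1) * Rabs t ^ k)).
      * apply sumn_le. intros i hi. apply Hd; assumption.
      * rewrite sumn_scal_r. apply Rmult_le_compat_r; [apply pow_le, Rabs_pos|unfold B; lra].
    + right. field. unfold B; lra.
  - apply (small_sumn k n (fun i t => (coord (c t) i - coord (c 0) i - l i * t ^ k) * g i)).
    intros i hi. apply small_scal. apply Hc, hi.
Qed.

(** * Second-order expansion of C2 functions along lines *)

Lemma line_lead (n : nat) (x : Rn n) (v : nat -> R) (i : nat) :
  (i < n)%nat -> lead 1 (fun t => coord (line x v t) i) (v i).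
Proof.
  intros hi. apply small_ext with (2 := small_zero 1). intros t.
  unfold line; rewrite !coord_mkRn by exact hi. ring.
Qed.

Lemma line_exp2 (n : nat) (x : Rn n) (v : nat -> R) (i : nat) :
  (i < n)%nat -> exp2 (fun t => coord (line x v t) i) (v i) 0.
Proof.
  intros hi. apply small_ext with (2 := small_zero 2). intros t.
  unfold line; rewrite !coord_mkRn by exact hi. ring.
Qed.

Lemma line_near (n : nat) (x : Rn n) (v : nat -> R) (r : R) :
  r > 0 -> exists d, d > 0 /\ forall t, Rabs t < d -> near x (line x v t) r.
Proof.
  intros hr. destruct (curve_near n 1 (line x v) v r (le_n 1) hr) as [d [hd Hd]].
  { intros i hi. apply line_lead, hi. }
  exists d. split; [exact hd|]. intros t ht. specialize (Hd t ht). rewrite line_0 in Hd. exact Hd.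
Qed.

Lemma line_line (n : nat) (x : Rn n) (v : nat -> R) (s t : R) :
  line (line x v s) v t = line x v (s + t).
Proof.
  apply Rn_ext; intros i hi. unfold line. rewrite !coord_mkRn by exact hi. ring.
Qed.

Lemma Ck_partials (k n : nat) (U : Rn n -> Prop) (f : Rn n -> R) :
  Ck (S k) U f -> exists g : nat -> Rn n -> R, forall i, (i < n)%nat ->
    has_partial U f i (g i) /\ Ck k U (g i).
Proof.
  intros [_ H].
  assert (K : forall m, (m <= n)%nat -> exists g : nat -> Rn n -> R, forall i, (i < m)%nat ->
    has_partial U f i (g i) /\ Ck k U (g i)).
  { induction m as [|m IH]; intros hm; [exists (fun _ _ => 0); intros; lia|].
    destruct IH as [g Hg]; [lia|]. destruct (H m ltac:(lia)) as [g' Hg'].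
    exists (fun i => if (i =? m)%nat then g' else g i).
    intros i hi. destruct (Nat.eqb_spec i m) as [->|h]; [exact Hg'|apply Hg; lia]. }
  apply K; lia.
Qed.

Lemma Ck_continuous (k n : nat) (U : Rn n -> Prop) (f : Rn n -> R) :
  Ck k U f -> continuous_on U f.
Proof. destruct k; [exact (fun h => h)|intros [h _]; exact h]. Qed.

(** Along the line the derivative is the sum of the [g_i v_i], which has a first-order expansion
    because each [g_i] is again C1; integrating it gives the second-order one. The same [g] serves
    as differential and for every direction. *)
Lemma C2_line (n : nat) (U : Rn n -> Prop) (f : Rn n -> R) (x : Rn n) :
  open_set U -> U x -> Ck 2 U f ->
  exists g, frechet f x g /\
    forall v, exists b, exp2 (fun t => f (line x v t)) (sumn n (fun i => g i * v i)) b.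
Proof.
  intros hU hx Hf.
  destruct (Ck_partials _ _ _ _ Hf) as [g Hg].
  assert (Fr : forall y, U y -> frechet f y (fun i => g i y)).
  { intros y hy. apply C1_frechet with (U := U); auto.
    - intros i hi; apply Hg, hi.
    - intros i hi; apply (Ck_continuous 1), Hg, hi. }
  exists (fun i => g i x). split; [apply Fr, hx|]. intros v.
  assert (Hm : exists m : nat -> R, forall i, (i < n)%nat ->
     lead 1 (fun t => g i (line x v t)) (m i)).
  { assert (K : forall k, (k <= n)%nat -> exists m : nat -> R, forall i, (i < k)%nat ->
     lead 1 (fun t => g i (line x v t)) (m i)).
    { induction k as [|k IH]; intros hk; [exists (fun _ => 0); intros; lia|].
      destruct IH as [m Hm]; [lia|].
      destruct (Ck_partials _ _ _ _ (proj2 (Hg k ltac:(lia)))) as [gg Hgg].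
      exists (fun i => if (i =? k)%nat then sumn n (fun j => gg j x * v j) else m i).
      intros i hi. destruct (Nat.eqb_spec i k) as [->|h]; [|apply Hm; lia].
      apply (frechet_chain n 1 (g k) (line x v) (fun j => gg j x) v (le_n 1)).
      - rewrite line_0. apply C1_frechet with (U := U); auto; intros j hj; apply Hgg, hj.
      - intros j hj; apply line_lead, hj. }
    apply K; lia. }
  destruct Hm as [m Hm].
  set (h := fun t => f (line x v t)).
  set (h' := fun t => sumn n (fun i => g i (line x v t) * v i)).
  set (b := sumn n (fun i => m i * v i)).
  destruct (hU x hx) as [r [hr Hr]]. destruct (line_near n x v r hr) as [d [hd Hd]].
  assert (D : forall t, Rabs t < d -> derivable_pt_lim h t (h' t)).
  { intros t ht.
    assert (K : derivable_pt_lim (fun s => f (line (line x v t) v s)) 0 (h' t)).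
    { apply lead1_derivable.
      apply (frechet_chain n 1 f (line (line x v t) v) (fun i => g i (line x v t)) v (le_n 1)).
      - rewrite line_0. apply Fr, Hr, Hd, ht.
      - intros j hj; apply line_lead, hj. }
    intros eps heps. destruct (K eps heps) as [del Hdel]. exists del.
    intros s hs0 hs. specialize (Hdel s hs0 hs). rewrite !line_line in Hdel.
    rewrite Rplus_0_l, Rplus_0_r in Hdel. exact Hdel. }
  assert (L : lead 1 h' b).
  { apply small_ext with (f := fun t => sumn n (fun i =>
       (g i (line x v t) - g i (line x v 0) - m i * t ^ 1) * v i)).
    { intros t. unfold h', b.
      rewrite (sumn_minus_scal n (fun i => g i (line x v t) - g i (line x v 0)) m v (t ^ 1)).
      rewrite <- sumn_minus. f_equal; [|f_equal]; apply sumn_ext; intros; ring. }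
    apply (small_sumn 1 n (fun i t => (g i (line x v t) - g i (line x v 0) - m i * t ^ 1) * v i)).
    intros i hi. apply small_scal, Hm, hi. }
  (* [b] is the derivative of [h'] at 0, hence the factor one half. *)
  exists (b / 2).
  replace (sumn n (fun i => g i x * v i)) with (h' 0)
    by (unfold h'; rewrite line_0; reflexivity).
  intros eps heps. destruct (L eps heps) as [d' [hd' Hd']].
  exists (Rmin d d'). split; [apply Rmin_glb_lt; assumption|]. intros t ht.
  assert (h1 : Rabs t < d) by (eapply Rlt_le_trans; [exact ht|apply Rmin_l]).
  assert (h2 : Rabs t < d') by (eapply Rlt_le_trans; [exact ht|apply Rmin_r]).
  assert (hs : forall s, Rmin 0 t <= s <= Rmax 0 t -> Rabs s <= Rabs t).
  { intros s. unfold Rmin, Rmax, Rabs. destruct (Rle_dec 0 t), (Rcase_abs s), (Rcase_abs t); lra. }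
  (* The mean value bound with slope 0 for [h] minus its candidate polynomial: the derivative of
     this difference is at most [eps * |t|] between 0 and [t]. *)
  pose proof (mvt_bound (fun s => h s - h' 0 * s - b / 2 * s ^ 2)
    (fun s => h' s - h' 0 * 1 - b / 2 * (2 * s)) 0 t 0 (eps * Rabs t)) as MV.
  cbv beta in MV.
  match type of MV with _ -> _ -> Rabs ?X <= ?Y =>
    replace X with (h t - h 0 - h' 0 * t - b / 2 * t ^ 2) in MV by ring;
    replace Y with (eps * Rabs t ^ 2) in MV
      by (rewrite Rminus_0_r; ring) end.
  apply MV.
  - intros s Hs. apply hs in Hs.
    apply derivable_pt_lim_minus with (f1 := fun s => h s - h' 0 * s) (f2 := fun s => b / 2 * s ^ 2).
    + apply derivable_pt_lim_minus with (f1 := h) (f2 := fun s => h' 0 * s).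
      * apply D; lra.
      * apply derivable_pt_lim_scal, derivable_pt_lim_id.
    + apply derivable_pt_lim_scal with (f := fun s => s ^ 2).
      replace (2 * s) with (INR 2 * s ^ pred 2) by (simpl; ring).
      apply derivable_pt_lim_pow.
  - intros s Hs. apply hs in Hs. specialize (Hd' s ltac:(lra)).
    replace (h' s - h' 0 * 1 - b / 2 * (2 * s) - 0) with (h' s - h' 0 - b * s ^ 1) by field.
    eapply Rle_trans; [exact Hd'|]. rewrite pow_1. apply Rmult_le_compat_l; lra.
Qed.

(** * Second-order jets under changes of coordinates *)

Definition mulv (n : nat) (L : nat -> nat -> R) (v : nat -> R) (i : nat) : R :=
  sumn n (fun j => L i j * v j).

Lemma mulv_ext (n : nat) (L : nat -> nat -> R) (v w : nat -> R) (i : nat) :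
  (forall j, (j < n)%nat -> v j = w j) -> mulv n L v i = mulv n L w i.
Proof. intros H. apply sumn_ext. intros j hj. rewrite H by exact hj. reflexivity. Qed.

Lemma finite_choice {A : Type} (n : nat) (P : nat -> A -> Prop) (dflt : A) :
  (forall i, (i < n)%nat -> exists y, P i y) ->
  exists f : nat -> A, forall i, (i < n)%nat -> P i (f i).
Proof.
  induction n as [|n IH]; intros H; [exists (fun _ => dflt); intros; lia|].
  destruct IH as [f Hf]; [intros; apply H; lia|]. destruct (H n ltac:(lia)) as [y Hy].
  exists (fun i => if (i =? n)%nat then y else f i). intros i hi.
  destruct (Nat.eqb_spec i n) as [->|h]; [exact Hy|apply Hf; lia].
Qed.

Definition frechet_map {n m : nat} (f : Rn n -> Rn m) (x : Rn n) (L : nat -> nat -> R) : Prop :=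
  forall i, (i < m)%nat -> frechet (fun y => coord (f y) i) x (L i).

Lemma smooth_map_frechet (n m : nat) (U : Rn n -> Prop) (f : Rn n -> Rn m) (x : Rn n) :
  open_set U -> U x -> smooth_map_on U f ->
  exists L, frechet_map f x L /\
    forall v, exists c : nat -> R, forall i, (i < m)%nat ->
      exp2 (fun t => coord (f (line x v t)) i) (mulv n L v i) (c i).
Proof.
  intros hU hx Hf.
  destruct (finite_choice m (fun i g => frechet (fun y => coord (f y) i) x g /\
    forall v, exists b, exp2 (fun t => coord (f (line x v t)) i) (sumn n (fun i => g i * v i)) b)
    (fun _ => 0)) as [L HL].
  { intros i hi. apply (C2_line n U (fun y => coord (f y) i)); auto. apply (Hf i hi 2%nat). }
  exists L. split; [intros i hi; apply HL, hi|]. intros v.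
  apply (finite_choice m (fun i b => exp2 (fun t => coord (f (line x v t)) i) (mulv n L v i) b) 0).
  intros i hi. apply HL, hi.
Qed.

Lemma frechet_map_chain (n m k : nat) (f : Rn n -> Rn m) (c : R -> Rn n) L (l : nat -> R) :
  (1 <= k)%nat -> frechet_map f (c 0) L ->
  (forall i, (i < n)%nat -> lead k (fun t => coord (c t) i) (l i)) ->
  forall i, (i < m)%nat -> lead k (fun t => coord (f (c t)) i) (mulv n L l i).
Proof.
  intros hk Hf Hc i hi.
  apply (frechet_chain n k (fun y => coord (f y) i)); auto.
Qed.

(** The chain rule gives [B A v] as velocity of [g (f (line x v t))], which near [t = 0] is the line
    itself, with velocity [v]. *)
Lemma frechet_inverse (n : nat) (U : Rn n -> Prop) (f g : Rn n -> Rn n) (x : Rn n) A B :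
  open_set U -> U x -> (forall y, U y -> g (f y) = y) ->
  frechet_map f x A -> frechet_map g (f x) B ->
  forall v i, (i < n)%nat -> mulv n B (mulv n A v) i = v i.
Proof.
  intros hU hx Hgf HA HB v i hi.
  destruct (hU x hx) as [r [hr Hr]]. destruct (line_near n x v r hr) as [d [hd Hd]].
  apply (lead_unique 1 (fun t => coord (line x v t) i)); [|apply line_lead, hi].
  apply lead_near with (r := d) (f := fun t => coord (g (f (line x v t))) i); [exact hd| |].
  { intros t ht. rewrite Hgf; [reflexivity|apply Hr, Hd, ht]. }
  apply (frechet_map_chain n n 1 g (fun t => f (line x v t))); auto.
  { rewrite line_0. exact HB. }
  apply (frechet_map_chain n n 1 f (line x v)); auto.
  - rewrite line_0. exact HA.
  - intros j hj. apply line_lead, hj.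
Qed.

(* [d] and [Q] are the linear and quadratic parts of [h] at [u], expressed
   through its composition with arbitrary curves of second order. *)
Definition jet2 {n m : nat} (h : Rn n -> Rn m) (u : Rn n) (d Q : nat -> (nat -> R) -> R) : Prop :=
  forall (c : R -> Rn n) (v w : nat -> R), c 0 = u ->
    (forall i, (i < n)%nat -> exp2 (fun t => coord (c t) i) (v i) (w i)) ->
    forall j, (j < m)%nat -> exp2 (fun t => coord (h (c t)) j) (d j v) (Q j v + d j w).

(** [chart_at] without its base point: the charts at a cusp are used again at singular points close
    to it. *)
Definition coordinate_change {n : nat} (U : Rn n -> Prop) (phi : Rn n -> Rn n)
  (V : Rn n -> Prop) (psi : Rn n -> Rn n) : Prop :=
  open_set U /\ open_set V /\
  (forall u, U u -> V (phi u)) /\ (forall v, V v -> U (psi v)) /\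
  (forall u, U u -> psi (phi u) = u) /\ (forall v, V v -> phi (psi v) = v) /\
  smooth_map_on U phi /\ smooth_map_on V psi.

(** Near [x] the map is [nf] between [phi] and [psi']. A line with velocity [v] goes under [phi] to
    a curve with some second-order term [c]. If [v] is in the kernel, [nf] takes this to a curve
    with no first-order term, on whose quadratic term [psi'] acts by its differential [D]. So the
    second derivatives of [phi] contribute only [dn k c], an element of the image of the
    differential of [nf]. *)
Lemma jet2_transfer (n m : nat) (g nf : Rn n -> Rn m) U phi V psi U' phi' V' psi'
  (W : Rn n -> Prop) (u0 : Rn n) dg Qg dn Qn :
  coordinate_change U phi V psi -> coordinate_change U' phi' V' psi' ->
  open_set W -> W u0 -> (forall u, W u -> V u) ->
  (forall u, W u -> U' (g (psi u))) -> (forall u, W u -> phi' (g (psi u)) = nf u) ->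
  jet2 g (psi u0) dg Qg -> jet2 nf u0 dn Qn ->
  (forall j, (j < m)%nat -> dg j (fun _ => 0) = 0) ->
  exists L M D E,
    (forall v i, (i < n)%nat -> mulv n M (mulv n L v) i = v i) /\
    (forall v i, (i < n)%nat -> mulv n L (mulv n M v) i = v i) /\
    (forall v i, (i < m)%nat -> mulv m E (mulv m D v) i = v i) /\
    (forall v i, (i < m)%nat -> mulv m D (mulv m E v) i = v i) /\
    (forall v j, (j < m)%nat -> dg j v = mulv m D (fun k => dn k (mulv n L v)) j) /\
    (forall v, (forall j, (j < m)%nat -> dg j v = 0) -> exists c, forall j, (j < m)%nat ->
       Qg j v = mulv m D (fun k => Qn k (mulv n L v) + dn k c) j).
Proof.
  intros [oU [oV [hUV [hVU [hpf [hfp [sphi spsi]]]]]]].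
  intros [oU' [oV' [hUV' [hVU' [hpf' [hfp' [sphi' spsi']]]]]]].
  intros oW hW hWV hWU' hnf Jg Jn dg0.
  set (x := psi u0).
  assert (hx : U x) by (apply hVU, hWV, hW).
  assert (ex : phi x = u0) by (apply hfp, hWV, hW).
  assert (hgx : U' (g x)) by (apply hWU', hW).
  assert (egx : phi' (g x) = nf u0) by (apply hnf, hW).
  assert (hn : V' (nf u0)) by (rewrite <- egx; apply hUV', hgx).
  assert (en : psi' (nf u0) = g x) by (rewrite <- egx; apply hpf', hgx).
  destruct (smooth_map_frechet n n U phi x oU hx sphi) as [L [FL EL]].
  destruct (smooth_map_frechet n n V psi u0 oV (hWV _ hW) spsi) as [M [FM _]].
  destruct (smooth_map_frechet m m V' psi' (nf u0) oV' hn spsi') as [D [FD _]].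
  destruct (smooth_map_frechet m m U' phi' (g x) oU' hgx sphi') as [E [FE _]].
  assert (ED : forall v i, (i < m)%nat -> mulv m E (mulv m D v) i = v i).
  { apply frechet_inverse with (U := V') (f := psi') (g := phi') (x := nf u0); auto.
    rewrite en; exact FE. }
  assert (near_W : forall v, exists d, d > 0 /\ forall t, Rabs t < d ->
      g (line x v t) = psi' (nf (phi (line x v t)))).
  { intros v. destruct (EL v) as [c Hc].
    destruct (oW u0 hW) as [r [hr Hr]]. destruct (oU x hx) as [r' [hr' Hr']].
    destruct (curve_near n 1 (fun t => phi (line x v t)) (mulv n L v) r (le_n 1) hr) as [d [hd Hd]].
    { intros i hi. eapply exp2_lead1, Hc, hi. }
    destruct (line_near n x v r' hr') as [d' [hd' Hd']].
    exists (Rmin d d'). split; [apply Rmin_glb_lt; assumption|]. intros t ht.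
    assert (h1 : Rabs t < d) by (eapply Rlt_le_trans; [exact ht|apply Rmin_l]).
    assert (h2 : Rabs t < d') by (eapply Rlt_le_trans; [exact ht|apply Rmin_r]).
    specialize (Hd t h1). cbv beta in Hd. rewrite line_0, ex in Hd.
    specialize (Hr _ Hd). specialize (Hr' _ (Hd' t h2)).
    rewrite <- (hnf _ Hr). rewrite (hpf _ Hr').
    rewrite hpf'; [reflexivity|]. rewrite <- (hpf _ Hr'). apply hWU', Hr. }
  assert (F1 : forall v j, (j < m)%nat -> dg j v = mulv m D (fun k => dn k (mulv n L v)) j).
  { intros v j hj. destruct (EL v) as [c Hc]. destruct (near_W v) as [d [hd Hd]].
    apply (lead_unique 1 (fun t => coord (g (line x v t)) j)).
    - eapply exp2_lead1. apply (Jg (line x v) v (fun _ => 0)); auto; [apply line_0|].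
      intros i hi; apply line_exp2, hi.
    - apply lead_near with (r := d) (f := fun t => coord (psi' (nf (phi (line x v t)))) j);
        [exact hd|intros t ht; rewrite (Hd t ht); reflexivity|].
      apply (frechet_map_chain m m 1 psi' (fun t => nf (phi (line x v t)))); auto.
      { rewrite line_0, ex. exact FD. }
      intros k hk. eapply exp2_lead1.
      apply (Jn (fun t => phi (line x v t)) (mulv n L v) c); auto.
      rewrite line_0. exact ex. }
  exists L, M, D, E. repeat split; auto.
  - apply frechet_inverse with (U := U) (f := phi) (g := psi) (x := x); auto.
    rewrite ex; exact FM.
  - apply frechet_inverse with (U := V) (f := psi) (g := phi) (x := u0); auto.
  - apply frechet_inverse with (U := U') (f := phi') (g := psi') (x := g x); auto.
    rewrite egx; exact FD.
  - intros v hv. destruct (EL v) as [c Hc]. destruct (near_W v) as [d [hd Hd]].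
    exists c. intros j hj.
    (* [E] inverts [D], so [L] sends the kernel of the differential of [g] into that of [nf]. *)
    assert (K : forall k, (k < m)%nat -> dn k (mulv n L v) = 0).
    { intros k hk. rewrite <- (ED (fun k => dn k (mulv n L v)) k hk).
      rewrite (mulv_ext m E _ (fun _ => 0)).
      - unfold mulv. rewrite sumn_scal_r. ring.
      - intros i hi. rewrite <- F1 by exact hi. apply hv, hi. }
    apply (lead_unique 2 (fun t => coord (g (line x v t)) j)).
    + apply exp2_lead2. replace 0 with (dg j v) by (apply hv, hj).
      replace (Qg j v) with (Qg j v + dg j (fun _ => 0)) by (rewrite dg0 by exact hj; ring).
      apply (Jg (line x v) v (fun _ => 0)); auto; [apply line_0|].
      intros i hi; apply line_exp2, hi.
    + apply lead_near with (r := d) (f := fun t => coord (psi' (nf (phi (line x v t)))) j);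
        [exact hd|intros t ht; rewrite (Hd t ht); reflexivity|].
      apply (frechet_map_chain m m 2 psi' (fun t => nf (phi (line x v t)))); auto.
      { rewrite line_0, ex. exact FD. }
      intros k hk. apply exp2_lead2. rewrite <- (K k hk).
      apply (Jn (fun t => phi (line x v t)) (mulv n L v) c); auto.
      rewrite line_0. exact ex.
Qed.

(** * The jets of the normal forms and of [Fmap] *)

(** The singular normal forms have a differential of rank one with kernel [v_0 = 0]; the parameter
    is the slope of its image, 0 at the origin and [t] at [cusp_curve t]. *)
Definition nf_lin (t : R) (j : nat) (v : nat -> R) : R :=
  match j with O => v 0%nat | _ => t * v 0%nat end.

Definition nf_quad (e1 e2 e3 k : R) (j : nat) (v : nat -> R) : R :=
  match j with
  | O => 0
  | _ => e1 * v 1%nat ^ 2 + e2 * v 2%nat ^ 2 + e3 * v 3%nat ^ 2 + k * (v 0%nat * v 3%nat)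
  end.

Lemma exp2_sqr (f : R -> R) (a b : R) :
  exp2 f a b -> exp2 (fun t => f t ^ 2) (2 * f 0 * a) (a ^ 2 + 2 * f 0 * b).
Proof.
  intros H. apply exp2_ext with (4 := exp2_mult _ _ _ _ _ _ H H); [intros t|..]; ring.
Qed.

Lemma exp2_cube (f : R -> R) (a b : R) :
  exp2 f a b -> exp2 (fun t => f t ^ 3) (3 * f 0 ^ 2 * a) (3 * f 0 * a ^ 2 + 3 * f 0 ^ 2 * b).
Proof.
  intros H. apply exp2_ext with (4 := exp2_mult _ _ _ _ _ _ H (exp2_sqr _ _ _ H));
    [intros t|..]; ring.
Qed.

Lemma jet2_fold (s : R) (nf : Rn 4 -> Rn 2) :
  (forall u, nf u = mk2 (x1 u) (x2 u ^ 2 + x3 u ^ 2 + s * x4 u ^ 2)) ->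
  jet2 nf (Rn0 4) (nf_lin 0) (nf_quad 1 1 s 0).
Proof.
  intros E c v w h0 H [|[|j]] hj; [| |lia].
  - apply exp2_ext with (4 := H 0%nat ltac:(lia)); [intros t; rewrite E; reflexivity|reflexivity|].
    simpl; ring.
  - assert (h1 : coord (c 0) 1 = 0) by (rewrite h0; reflexivity).
    assert (h2 : coord (c 0) 2 = 0) by (rewrite h0; reflexivity).
    assert (h3 : coord (c 0) 3 = 0) by (rewrite h0; reflexivity).
    pose proof (exp2_sqr _ _ _ (H 1%nat ltac:(lia))) as H1.
    pose proof (exp2_sqr _ _ _ (H 2%nat ltac:(lia))) as H2.
    pose proof (exp2_scal _ _ _ s (exp2_sqr _ _ _ (H 3%nat ltac:(lia)))) as H3.
    apply exp2_ext with (4 := exp2_plus _ _ _ _ _ _ (exp2_plus _ _ _ _ _ _ H1 H2) H3).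
    + intros t. rewrite E. reflexivity.
    + rewrite h1, h2, h3; simpl; ring.
    + rewrite h1, h2, h3; simpl; ring.
Qed.

(* The points of the singular set [x2 = x3 = 0, x1 + 3 x4 ^ 2 = 0] of the cusp. *)
Definition cusp_curve (t : R) : Rn 4 :=
  mkRn 4 (fun i => match i with 0%nat => - 3 * t ^ 2 | 3%nat => t | _ => 0 end).

(** The first-order terms [-3 t^2 v_3] from [x1 x4] and [3 t^2 v_3] from [x4^3] cancel. The cube
    leaves [3 t v_3^2], so the form degenerates on the kernel exactly for [t = 0]; this tells the
    cusp from the folds around it. *)
Lemma jet2_cusp (b : bool) (t : R) :
  jet2 (nf_cusp b) (cusp_curve t) (nf_lin t) (nf_quad 1 (if b then 1 else -1) (3 * t) 1).
Proof.
  intros c v w h0 H [|[|j]] hj; [| |lia].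
  - apply exp2_ext with (4 := H 0%nat ltac:(lia)); [intros s; reflexivity|reflexivity|].
    simpl; ring.
  - assert (h : coord (c 0) 0 = - 3 * t ^ 2) by (rewrite h0; reflexivity).
    assert (h1 : coord (c 0) 1 = 0) by (rewrite h0; reflexivity).
    assert (h2 : coord (c 0) 2 = 0) by (rewrite h0; reflexivity).
    assert (h3 : coord (c 0) 3 = t) by (rewrite h0; reflexivity).
    pose proof (exp2_sqr _ _ _ (H 1%nat ltac:(lia))) as H1.
    pose proof (exp2_scal _ _ _ (if b then 1 else -1) (exp2_sqr _ _ _ (H 2%nat ltac:(lia)))) as H2.
    pose proof (exp2_cube _ _ _ (H 3%nat ltac:(lia))) as H3.
    pose proof (exp2_mult _ _ _ _ _ _ (H 0%nat ltac:(lia)) (H 3%nat ltac:(lia))) as H4.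
    apply exp2_ext with (4 := exp2_plus _ _ _ _ _ _ (exp2_plus _ _ _ _ _ _
      (exp2_plus _ _ _ _ _ _ H1 H2) H4) H3).
    + intros s. unfold nf_cusp, x1, x2, x3, x4. unfold coord at 6. simpl. destruct b; ring.
    + rewrite h, h1, h2, h3; simpl; ring.
    + rewrite h, h1, h2, h3; simpl; ring.
Qed.

Lemma jet2_regular :
  jet2 nf_regular (Rn0 4) (fun j v => v j) (fun _ _ => 0).
Proof.
  intros c v w h0 H [|[|j]] hj; [| |lia].
  - apply exp2_ext with (4 := H 0%nat ltac:(lia)); [intros s; reflexivity|reflexivity|ring].
  - apply exp2_ext with (4 := H 1%nat ltac:(lia)); [intros s; reflexivity|reflexivity|ring].
Qed.

Definition exp2C (h : R -> C) (a b : C) : Prop :=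
  exp2 (fun t => fst (h t)) (fst a) (fst b) /\ exp2 (fun t => snd (h t)) (snd a) (snd b).

Lemma exp2C_ext (f g : R -> C) (a b a' b' : C) :
  (forall t, f t = g t) -> a = a' -> b = b' -> exp2C f a b -> exp2C g a' b'.
Proof.
  intros E <- <- [H1 H2]. split.
  - apply exp2_ext with (4 := H1); auto. intros t; rewrite E; auto.
  - apply exp2_ext with (4 := H2); auto. intros t; rewrite E; auto.
Qed.

Lemma exp2C_const (c : C) : exp2C (fun _ => c) 0 0.
Proof. split; apply exp2_const. Qed.

Lemma exp2C_plus (f g : R -> C) (a b a' b' : C) :
  exp2C f a b -> exp2C g a' b' -> exp2C (fun t => f t + g t)%C (a + a')%C (b + b')%C.
Proof. intros [H1 H2] [H3 H4]. split; apply exp2_plus; assumption. Qed.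

Lemma exp2C_mult (f g : R -> C) (a b a' b' : C) :
  exp2C f a b -> exp2C g a' b' ->
  exp2C (fun t => f t * g t)%C (a * g 0 + f 0 * a')%C (b * g 0 + a * a' + f 0 * b')%C.
Proof.
  intros [H1 H2] [H3 H4]. split.
  - apply exp2_ext with (4 := exp2_plus _ _ _ _ _ _ (exp2_mult _ _ _ _ _ _ H1 H3)
      (exp2_scal _ _ _ (-1) (exp2_mult _ _ _ _ _ _ H2 H4))); [intros t|..]; simpl; ring.
  - apply exp2_ext with (4 := exp2_plus _ _ _ _ _ _ (exp2_mult _ _ _ _ _ _ H1 H4)
      (exp2_mult _ _ _ _ _ _ H2 H3)); [intros t|..]; simpl; ring.
Qed.

Lemma exp2C_conj (f : R -> C) (a b : C) :
  exp2C f a b -> exp2C (fun t => Cconj (f t)) (Cconj a) (Cconj b).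
Proof.
  intros [H1 H2]. split; [exact H1|].
  apply exp2_ext with (4 := exp2_scal _ _ _ (-1) H2); [intros t|..]; simpl; ring.
Qed.

(** Truncated subtraction is harmless here and in [ddpow]: wherever it takes effect, the factor
    [INR p] or [INR (p - 1)] is 0. *)
Definition dpow (p : nat) (z : C) : C := (INR p * z ^ (p - 1))%C.
Definition ddpow (p : nat) (z : C) : C := (INR p * INR (p - 1) * z ^ (p - 2))%C.

Lemma exp2C_pow (p : nat) (f : R -> C) (a b : C) :
  exp2C f a b ->
  exp2C (fun t => f t ^ p)%C (dpow p (f 0) * a)%C
    ((/ 2) * (ddpow p (f 0) * a ^ 2) + dpow p (f 0) * b)%C.
Proof.
  intros H. induction p as [|p IH].
  - apply exp2C_ext with (4 := exp2C_const 1); [reflexivity|..]; unfold dpow, ddpow; simpl; ring.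
  - apply exp2C_ext with (4 := exp2C_mult _ _ _ _ _ _ H IH); [reflexivity|..];
    unfold dpow, ddpow; destruct p as [|[|p]];
      repeat rewrite Nat.sub_succ; rewrite ?Nat.sub_0_r; simpl Nat.sub;
      rewrite ?S_INR, ?RtoC_plus; simpl INR; rewrite ?Cpow_S; change (Cpow (f 0) 0) with (RtoC 1); try ring; field.
Qed.

Definition vz (v : nat -> R) : C := (v 0%nat, v 1%nat).
Definition vw (v : nat -> R) : C := (v 2%nat, v 3%nat).
Definition zof (x : Rn 4) : C := (coord x 0, coord x 1).
Definition wof (x : Rn 4) : C := (coord x 2, coord x 3).

Definition dF (p q : nat) (a b z w : C) (v : nat -> R) : C :=
  (dpow p z * vz v + dpow q w * vw v + (a * Cconj (vz v) + b * Cconj (vw v)))%C.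

(** The terms in the conjugates are linear and leave no quadratic part, so the Hessian is the real
    part of a complex quadratic form; this makes the degeneracy condition explicit. *)
Definition QF (p q : nat) (z w : C) (v : nat -> R) : C :=
  ((/ 2) * (ddpow p z * vz v ^ 2) + (/ 2) * (ddpow q w * vw v ^ 2))%C.

Definition cproj (c : C) (j : nat) : R := match j with O => fst c | _ => snd c end.

Lemma Defs_Cpow (z : C) (n : nat) : Defs.Cpow z n = (z ^ n)%C.
Proof. induction n as [|n IH]; [reflexivity|]. simpl. rewrite IH. reflexivity. Qed.

Lemma Fmap_jet2 (p q : nat) (a b : C) (x : Rn 4) :
  jet2 (Fmap p q a b) x
    (fun j v => cproj (dF p q a b (zof x) (wof x) v) j)
    (fun j v => cproj (QF p q (zof x) (wof x) v) j).
Proof.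
  intros c v w h0 H.
  assert (Hz : exp2C (fun t => zof (c t)) (vz v) (vz w)) by (split; apply H; lia).
  assert (Hw : exp2C (fun t => wof (c t)) (vw v) (vw w)) by (split; apply H; lia).
  pose proof (exp2C_pow p _ _ _ Hz) as H1. pose proof (exp2C_pow q _ _ _ Hw) as H2.
  pose proof (exp2C_mult _ _ _ _ _ _ (exp2C_const a) (exp2C_conj _ _ _ Hz)) as H3.
  pose proof (exp2C_mult _ _ _ _ _ _ (exp2C_const b) (exp2C_conj _ _ _ Hw)) as H4.
  pose proof (exp2C_plus _ _ _ _ _ _ (exp2C_plus _ _ _ _ _ _ H1 H2)
                (exp2C_plus _ _ _ _ _ _ H3 H4)) as H5.
  cbv beta in H5. rewrite h0 in H5.
  apply exp2C_ext with (a' := dF p q a b (zof x) (wof x) v)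
    (b' := (QF p q (zof x) (wof x) v + dF p q a b (zof x) (wof x) w)%C)
    (g := fun t => (zof (c t) ^ p + wof (c t) ^ q
                    + (a * Cconj (zof (c t)) + b * Cconj (wof (c t))))%C) in H5;
    [|reflexivity|unfold dF; ring|unfold dF, QF; ring].
  destruct H5 as [H5 H6].
  assert (E : forall t, Fmap p q a b (c t) = mk2
    (fst (zof (c t) ^ p + wof (c t) ^ q + (a * Cconj (zof (c t)) + b * Cconj (wof (c t))))%C)
    (snd (zof (c t) ^ p + wof (c t) ^ q + (a * Cconj (zof (c t)) + b * Cconj (wof (c t))))%C)).
  { intros t. unfold Fmap. cbv zeta. rewrite !Defs_Cpow. reflexivity. }
  intros [|[|j]] hj; [| |lia].
  - apply exp2_ext with (4 := H5); [intros t; rewrite E|..]; reflexivity.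
  - apply exp2_ext with (4 := H6); [intros t; rewrite E|..]; reflexivity.
Qed.

(* At a singular point of rank one, [Re (al * _)] annihilates the image of the
   differential, and [L] maps its kernel onto [v_0 = 0], where the intrinsic
   Hessian becomes [e1 v_1^2 + e2 v_2^2 + e3 v_3^2]. *)
Definition singular_type (p q : nat) (a b z w : C) (e1 e2 e3 : R) : Prop :=
  exists (al : C) (L M : nat -> nat -> R),
    al <> 0 /\
    (forall v i, (i < 4)%nat -> mulv 4 M (mulv 4 L v) i = v i) /\
    (forall v i, (i < 4)%nat -> mulv 4 L (mulv 4 M v) i = v i) /\
    (forall v, Re (al * dF p q a b z w v) = 0) /\
    (forall v, dF p q a b z w v = 0 <-> mulv 4 L v 0 = 0) /\
    (forall v, dF p q a b z w v = 0 -> Re (al * QF p q z w v)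
       = e1 * mulv 4 L v 1 ^ 2 + e2 * mulv 4 L v 2 ^ 2 + e3 * mulv 4 L v 3 ^ 2).

(** * From normal forms to the type of a singular point *)

Lemma chart_coordinate_change (n : nat) (x : Rn n) U phi V psi :
  chart_at x U phi V psi -> coordinate_change U phi V psi.
Proof. unfold chart_at, coordinate_change. tauto. Qed.

Lemma dF_0 (p q : nat) (a b z w : C) : dF p q a b z w (fun _ => 0) = 0.
Proof.
  unfold dF, vz, vw. change (0, 0) with (RtoC 0).
  replace (Cconj 0) with (RtoC 0); [ring|]. unfold Cconj, RtoC; simpl. f_equal; ring.
Qed.

(** At a regular point the differential is onto, being the first two coordinates between the
    invertible [L] and [D]. Testing the covector on preimages of the two unit vectors shows that
    both parts of [al] vanish. *)
Lemma regular_not_singular (p q : nat) (a b al : C) (x : Rn 4) :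
  local_form (Fmap p q a b) x nf_regular -> al <> 0 ->
  ~ (forall v, Re (al * dF p q a b (zof x) (wof x) v) = 0).
Proof.
  intros [U [phi [V [psi [U' [phi' [V' [psi' [W [HU [HU' [oW [hW [hWV [hWU' hnf]]]]]]]]]]]]]]] hal Hal.
  assert (ex : psi (Rn0 4) = x).
  { destruct HU as [_ [_ [hx [e [_ [_ [h _]]]]]]]. rewrite <- e. apply h, hx. }
  destruct (jet2_transfer 4 2 (Fmap p q a b) nf_regular U phi V psi U' phi' V' psi' W (Rn0 4)
    (fun j v => cproj (dF p q a b (zof x) (wof x) v) j)
    (fun j v => cproj (QF p q (zof x) (wof x) v) j)
    (fun j v => v j) (fun _ _ => 0)) as [L [M [D [E [HML [HLM [HED [HDE [H1 _]]]]]]]]]; auto.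
  - eapply chart_coordinate_change; eauto.
  - eapply chart_coordinate_change; eauto.
  - rewrite ex. apply Fmap_jet2.
  - apply jet2_regular.
  - intros j hj. rewrite dF_0. destruct j; reflexivity.
  - apply hal.
    assert (K : forall y, fst al * mulv 2 D y 0 - snd al * mulv 2 D y 1 = 0).
    { intros y. specialize (Hal (mulv 4 M y)).
      assert (E0 : forall j, (j < 2)%nat ->
        cproj (dF p q a b (zof x) (wof x) (mulv 4 M y)) j = mulv 2 D y j).
      { intros j hj. rewrite (H1 (mulv 4 M y) j hj). apply mulv_ext.
        intros k hk. apply HLM; lia. }
      rewrite <- (E0 0%nat), <- (E0 1%nat) by lia. exact Hal. }
    pose proof (K (mulv 2 E (fun i => match i with O => 1 | _ => 0 end))) as K0.
    pose proof (K (mulv 2 E (fun i => match i with O => 0 | _ => 1 end))) as K1.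
    rewrite !HDE in K0, K1 by lia. destruct al as [l0 l1]. simpl in K0, K1.
    apply injective_projections; simpl; lra.
Qed.

(** The covector [y_1 - t y_0] annihilates the image of [nf_lin t]; composed with [E], the inverse
    of [D], it annihilates the image of [dF]. On the kernel [v_0 = 0], so the cross term with
    coefficient [k] drops out, and the covector removes the unknown second-order term of the
    chart. *)
Lemma nf_singular_type (p q : nat) (a b : C) (nf : Rn 4 -> Rn 2)
  U phi V psi U' phi' V' psi' (W : Rn 4 -> Prop) (u0 : Rn 4) (t e1 e2 e3 k : R) :
  coordinate_change U phi V psi -> coordinate_change U' phi' V' psi' ->
  open_set W -> W u0 -> (forall u, W u -> V u) ->
  (forall u, W u -> U' (Fmap p q a b (psi u))) ->
  (forall u, W u -> phi' (Fmap p q a b (psi u)) = nf u) ->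
  jet2 nf u0 (nf_lin t) (nf_quad e1 e2 e3 k) ->
  singular_type p q a b (zof (psi u0)) (wof (psi u0)) e1 e2 e3.
Proof.
  intros HU HU' oW hW hWV hWU' hnf Jn.
  set (z := zof (psi u0)). set (w := wof (psi u0)).
  destruct (jet2_transfer 4 2 (Fmap p q a b) nf U phi V psi U' phi' V' psi' W u0
    (fun j v => cproj (dF p q a b z w v) j) (fun j v => cproj (QF p q z w v) j)
    (nf_lin t) (nf_quad e1 e2 e3 k))
    as [L [M [D [E [HML [HLM [HED [HDE [H1 H2]]]]]]]]]; auto.
  { apply Fmap_jet2. }
  { intros j hj. rewrite dF_0. destruct j; reflexivity. }
  set (l0 := E 1%nat 0%nat - t * E 0%nat 0%nat). set (l1 := E 1%nat 1%nat - t * E 0%nat 1%nat).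
  assert (Hl : forall y, l0 * mulv 2 D y 0 + l1 * mulv 2 D y 1 = y 1%nat - t * y 0%nat).
  { intros y. rewrite <- (HED y 0%nat), <- (HED y 1%nat) by lia.
    assert (mE : forall Y i, mulv 2 E Y i = 0 + E i 0%nat * Y 0%nat + E i 1%nat * Y 1%nat)
      by reflexivity.
    rewrite !mE. unfold l0, l1. ring. }
  assert (HRe : forall c, Re (Cmult (l0, - l1)%R c) = l0 * cproj c 0 + l1 * cproj c 1).
  { intros [c0 c1]. simpl. ring. }
  (* [Re (al * c)] has to be the real pairing of [c] with [(l0, l1)], hence the conjugate. *)
  exists (l0, - l1), L, M. split; [|split; [exact HML|split; [exact HLM|split; [|split]]]].
  - intros Hn. injection Hn as n0 n1.
    pose proof (Hl (fun i => match i with O => 0 | _ => 1 end)) as K. cbv beta iota in K.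
    replace l1 with 0 in K by lra. rewrite n0 in K. lra.
  - intros v. rewrite HRe, (H1 v 0%nat), (H1 v 1%nat) by lia. rewrite Hl. simpl. ring.
  - intros v. split; intros hv.
    + change (mulv 4 L v 0) with (nf_lin t 0 (mulv 4 L v)).
      rewrite <- (HED (fun k => nf_lin t k (mulv 4 L v)) 0%nat) by lia.
      rewrite (mulv_ext 2 E _ (fun _ => 0)).
      * unfold mulv. rewrite sumn_scal_r. ring.
      * intros i hi. rewrite <- H1 by exact hi. rewrite hv. destruct i; reflexivity.
    + assert (K : forall j, (j < 2)%nat -> cproj (dF p q a b z w v) j = 0).
      { intros j hj. rewrite H1 by exact hj. rewrite (mulv_ext 2 D _ (fun _ => 0)).
        - unfold mulv. rewrite sumn_scal_r. ring.
        - intros i hi. destruct i; simpl; rewrite hv; ring. }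
      apply injective_projections; [apply (K 0%nat)|apply (K 1%nat)]; lia.
  - intros v hv. destruct (H2 v) as [c Hc].
    { intros j hj. rewrite hv. destruct j; reflexivity. }
    rewrite HRe, (Hc 0%nat), (Hc 1%nat) by lia. rewrite Hl.
    assert (hL : mulv 4 L v 0 = 0).
    { change (mulv 4 L v 0) with (nf_lin t 0 (mulv 4 L v)).
      rewrite <- (HED (fun k => nf_lin t k (mulv 4 L v)) 0%nat) by lia.
      rewrite (mulv_ext 2 E _ (fun _ => 0)).
      - unfold mulv. rewrite sumn_scal_r. ring.
      - intros i hi. rewrite <- H1 by exact hi. rewrite hv. destruct i; reflexivity. }
    unfold nf_quad, nf_lin. rewrite hL. ring.
Qed.

Lemma chart_base (n : nat) (x : Rn n) U phi V psi :
  chart_at x U phi V psi -> psi (Rn0 n) = x.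
Proof. intros [_ [_ [hx [e [_ [_ [h _]]]]]]]. rewrite <- e. apply h, hx. Qed.

Lemma fold_singular_type (p q : nat) (a b : C) (x : Rn 4) (s : R) (nf : Rn 4 -> Rn 2) :
  (forall u, nf u = mk2 (x1 u) (x2 u ^ 2 + x3 u ^ 2 + s * x4 u ^ 2)) ->
  local_form (Fmap p q a b) x nf ->
  singular_type p q a b (zof x) (wof x) 1 1 s.
Proof.
  intros E [U [phi [V [psi [U' [phi' [V' [psi' [W [HU [HU' [oW [hW [hWV [hWU' hnf]]]]]]]]]]]]]]].
  rewrite <- (chart_base _ _ _ _ _ _ HU).
  eapply nf_singular_type with (U := U) (V := V) (U' := U') (V' := V') (W := W) (t := 0) (k := 0);
    eauto using chart_coordinate_change.
  apply jet2_fold, E.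
Qed.

Lemma def_fold_type (p q : nat) (a b : C) (x : Rn 4) :
  local_form (Fmap p q a b) x nf_def_fold -> singular_type p q a b (zof x) (wof x) 1 1 1.
Proof.
  apply fold_singular_type. intros u. unfold nf_def_fold. f_equal. ring.
Qed.

Lemma indef_fold_type (p q : nat) (a b : C) (x : Rn 4) :
  local_form (Fmap p q a b) x nf_indef_fold -> singular_type p q a b (zof x) (wof x) 1 1 (-1).
Proof.
  apply fold_singular_type. intros u. unfold nf_indef_fold. f_equal. ring.
Qed.

Lemma cusp_curve_0 : cusp_curve 0 = Rn0 4.
Proof.
  apply Rn_ext. intros i hi. unfold cusp_curve. rewrite coord_mkRn by exact hi.
  destruct i as [|[|[|[|i]]]]; unfold Rn0, coord; simpl; try ring.
Qed.

Lemma cusp_type (p q : nat) (a b : C) (x : Rn 4) :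
  is_cusp (Fmap p q a b) x -> exists e2, e2 <> 0 /\
  singular_type p q a b (zof x) (wof x) 1 e2 0.
Proof.
  intros [s [U [phi [V [psi [U' [phi' [V' [psi' [W [HU [HU' [oW [hW [hWV [hWU' hnf]]]]]]]]]]]]]]]].
  exists (if s then 1 else -1). split; [destruct s; lra|].
  rewrite <- (chart_base _ _ _ _ _ _ HU).
  eapply nf_singular_type with (U := U) (V := V) (U' := U') (V' := V') (W := W) (t := 0) (k := 1);
    eauto using chart_coordinate_change.
  rewrite <- cusp_curve_0. replace 0 with (3 * 0) at 3 by ring. apply jet2_cusp.
Qed.

(** The points [cusp_curve t] with small [t > 0] lie in the same charts and have [e3 = 3 t];
    continuity of [psi] brings their images close to [x]. *)
Lemma folds_near_cusp (p q : nat) (a b : C) (x : Rn 4) (eps : R) :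
  is_cusp (Fmap p q a b) x -> eps > 0 ->
  exists y e2 e3, near x y eps /\ e2 <> 0 /\ e3 <> 0 /\
  singular_type p q a b (zof y) (wof y) 1 e2 e3.
Proof.
  intros [s [U [phi [V [psi [U' [phi' [V' [psi' [W [HU [HU' [oW [hW [hWV [hWU' hnf]]]]]]]]]]]]]]]] heps.
  assert (Hpsi : exists d, d > 0 /\ forall u, V u -> near (Rn0 4) u d -> near x (psi u) eps).
  { assert (K : forall m, (m <= 4)%nat -> exists d, d > 0 /\ forall u, V u -> near (Rn0 4) u d ->
      forall i, (i < m)%nat -> Rabs (coord (psi u) i - coord x i) < eps).
    { induction m as [|m IH]; intros hm; [exists 1; split; [lra|intros; lia]|].
      destruct IH as [d [hd Hd]]; [lia|].
      assert (Hc : continuous_on V (fun u => coord (psi u) m)).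
      { destruct HU as [_ [_ [_ [_ [_ [_ [_ [_ [_ h]]]]]]]]]. apply (h m ltac:(lia) 0%nat). }
      destruct (Hc (Rn0 4) (hWV _ hW) eps heps) as [d' [hd' Hd']].
      exists (Rmin d d'). split; [apply Rmin_glb_lt; assumption|].
      intros u hu hn i hi.
      assert (N1 : near (Rn0 4) u d) by (intros j hj; eapply Rlt_le_trans; [apply hn, hj|apply Rmin_l]).
      assert (N2 : near (Rn0 4) u d') by (intros j hj; eapply Rlt_le_trans; [apply hn, hj|apply Rmin_r]).
      destruct (Nat.eq_dec i m) as [->|h]; [|apply Hd; auto; lia].
      rewrite <- (chart_base _ _ _ _ _ _ HU). apply Hd'; assumption. }
    apply K; lia. }
  destruct Hpsi as [d [hd Hd]]. destruct (oW _ hW) as [r [hr Hr]].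
  (* The cap 1 and the choice [t = m / 4] give [3 t ^ 2 < m], so the curve point stays within all
     the radii. *)
  set (m := Rmin 1 (Rmin d r)).
  assert (hm : 0 < m) by (repeat apply Rmin_glb_lt; lra).
  assert (m1 : m <= 1) by apply Rmin_l.
  assert (md : m <= d) by (eapply Rle_trans; [apply Rmin_r|apply Rmin_l]).
  assert (mr : m <= r) by (eapply Rle_trans; [apply Rmin_r|apply Rmin_r]).
  set (t := m / 4).
  assert (N : near (Rn0 4) (cusp_curve t) m).
  { intros i hi. unfold cusp_curve. rewrite coord_mkRn by exact hi.
    unfold Rn0, coord at 1, t; simpl proj1_sig. rewrite Rminus_0_r.
    destruct i as [|[|[|i]]].
    - replace (-3 * (m / 4) ^ 2) with (- (3 * (m / 4) ^ 2)) by ring.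
      rewrite Rabs_Ropp, Rabs_pos_eq by nra. nra.
    - rewrite Rabs_R0; exact hm.
    - rewrite Rabs_R0; exact hm.
    - destruct i; [|lia]. rewrite Rabs_pos_eq; lra. }
  assert (hWt : W (cusp_curve t)).
  { apply Hr. intros i hi. eapply Rlt_le_trans; [apply N, hi|exact mr]. }
  exists (psi (cusp_curve t)), (if s then 1 else -1), (3 * t).
  split; [|split; [destruct s; lra|split; [unfold t; lra|]]].
  - apply Hd; [apply hWV, hWt|]. intros i hi. eapply Rlt_le_trans; [apply N, hi|exact md].
  - eapply nf_singular_type with (U := U) (V := V) (U' := U') (V' := V') (W := W) (t := t) (k := 1);
      eauto using chart_coordinate_change.
    apply jet2_cusp.
Qed.

(** * Roots of complex polynomials *)

(** Polynomial functions of degree at most [n] in Horner form; functions instead of coefficient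
    lists suffice for dividing by [y - r]. *)
Fixpoint poly_fun (n : nat) (f : C -> C) : Prop :=
  match n with
  | O => exists c, forall y, f y = c
  | S k => exists c g, poly_fun k g /\ forall y, f y = (c + y * g y)%C
  end.

Lemma poly_fun_S (n : nat) : forall f, poly_fun n f -> poly_fun (S n) f.
Proof.
  induction n as [|n IH]; intros f.
  - intros [c H]. exists c, (fun _ => RtoC 0). split; [exists 0; reflexivity|].
    intros y. rewrite H. ring.
  - intros [c [g [Hg H]]]. exists c, g. split; [apply IH, Hg|exact H].
Qed.

Lemma poly_fun_plus (n : nat) : forall f g, poly_fun n f -> poly_fun n g ->
  poly_fun n (fun y => f y + g y)%C.
Proof.
  induction n as [|n IH]; intros f g.
  - intros [c H] [c' H']. exists (c + c')%C. intros y. rewrite H, H'. reflexivity.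
  - intros [c [h [Hh H]]] [c' [h' [Hh' H']]].
    exists (c + c')%C, (fun y => h y + h' y)%C. split; [apply IH; assumption|].
    intros y. rewrite H, H'. ring.
Qed.

Lemma poly_fun_scal (n : nat) (s : C) : forall f, poly_fun n f -> poly_fun n (fun y => s * f y)%C.
Proof.
  induction n as [|n IH]; intros f.
  - intros [c H]. exists (s * c)%C. intros y. rewrite H. reflexivity.
  - intros [c [h [Hh H]]]. exists (s * c)%C, (fun y => s * h y)%C.
    split; [apply IH; assumption|]. intros y. rewrite H. ring.
Qed.

Lemma poly_fun_monomial (n k : nat) (s : C) : (k <= n)%nat -> poly_fun n (fun y => s * y ^ k)%C.
Proof.
  revert k. induction n as [|n IH]; intros k hk.
  - exists s. intros y. replace k with 0%nat by lia. simpl. ring.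
  - destruct k as [|k].
    + apply poly_fun_S, IH. lia.
    + exists 0, (fun y => s * y ^ k)%C. split; [apply IH; lia|]. intros y. rewrite Cpow_S. ring.
Qed.

Lemma poly_fun_factor (n : nat) (r : C) : forall f, poly_fun (S n) f ->
  exists h, poly_fun n h /\ forall y, f y = (f r + (y - r) * h y)%C.
Proof.
  induction n as [|n IH]; intros f [c [g [Hg H]]].
  - destruct Hg as [d Hd]. exists (fun _ => d). split; [exists d; reflexivity|].
    intros y. rewrite !H, !Hd. ring.
  - destruct (IH g Hg) as [h [Hh E]]. exists (fun y => g y + r * h y)%C. split.
    + apply poly_fun_plus; [exact Hg|]. apply poly_fun_S, poly_fun_scal, Hh.
    + intros y. rewrite !H. rewrite (E y). ring.
Qed.

Lemma Cmult_integral (x y : C) : (x * y)%C = 0 -> x = 0 \/ y = 0.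
Proof.
  intros H. apply (f_equal Cmod) in H. rewrite Cmod_mult, Cmod_0 in H.
  apply Rmult_integral in H. destruct H as [H|H]; apply Cmod_eq_0 in H; auto.
Qed.

(** Each root splits off a linear factor; the witness [y0] stands for the polynomial not being
    identically zero. *)
Lemma poly_fun_roots (n : nat) : forall (f : C -> C) (l : list C) (y0 : C),
  poly_fun n f -> f y0 <> 0 -> NoDup l -> (forall y, In y l -> f y = 0) ->
  (length l <= n)%nat.
Proof.
  induction n as [|n IH]; intros f l y0 Hf h0 Hl H.
  - destruct l as [|r l]; [simpl; lia|]. exfalso. destruct Hf as [c Hc].
    apply h0. rewrite Hc, <- (Hc r). apply H. left; reflexivity.
  - destruct l as [|r l]; [simpl; lia|].
    destruct (poly_fun_factor n r f Hf) as [h [Hh E]].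
    assert (fr : f r = 0) by (apply H; left; reflexivity).
    inversion Hl as [|r' l' hr Hl']; subst. simpl. apply le_n_S. apply (IH h l y0); auto.
    + intros K. apply h0. rewrite E, fr, K. ring.
    + intros y hy. assert (fy : f y = 0) by (apply H; right; exact hy).
      rewrite E, fr, Cplus_0_l in fy. apply Cmult_integral in fy.
      destruct fy as [fy|fy]; [|exact fy]. exfalso. apply hr.
      replace r with y; [exact hy|]. apply Ceq_minus, fy.
Qed.

(** Classically, a list of solutions that misses one can be extended; the bound rules out length
    [n + 1], so the extension stops at a complete list. *)
Lemma finite_complete {A : Type} (P : A -> Prop) (n : nat) :
  (forall l, NoDup l -> (forall x, In x l -> P x) -> (length l <= n)%nat) ->
  exists l, NoDup l /\ forall x, In x l <-> P x.
Proof.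
  intros H.
  assert (K : forall k, (exists l, NoDup l /\ forall x, In x l <-> P x) \/
     exists l, NoDup l /\ (forall x, In x l -> P x) /\ length l = k).
  { induction k as [|k [IH|[l [Hl [HP Hk]]]]]; [|left; exact IH|].
    - right. exists nil. split; [constructor|]. split; [intros x []|reflexivity].
    - destruct (classic (exists x, P x /\ ~ In x l)) as [[x [hx hn]]|hn].
      + right. exists (x :: l). split; [constructor; assumption|].
        split; [intros y [<-|hy]; auto|simpl; lia].
      + left. exists l. split; [exact Hl|]. intros x. split; [apply HP|].
        intros hx. apply NNPP. intros h. apply hn. exists x. auto. }
  destruct (K (S n)) as [h|[l [Hl [HP Hk]]]]; [exact h|].
  specialize (H l Hl HP). lia.
Qed.

Lemma NoDup_map_in {A B : Type} (f : A -> B) (l : list A) :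
  NoDup l -> (forall x y, In x l -> In y l -> f x = f y -> x = y) -> NoDup (map f l).
Proof.
  intros Hl. induction Hl as [|x l hx Hl IH]; intros H; simpl; constructor.
  - intros h. apply in_map_iff in h. destruct h as [y [e hy]].
    assert (y = x) by (apply H; [right; exact hy|left; reflexivity|exact e]). subst. contradiction.
  - apply IH. intros y z hy hz. apply H; right; assumption.
Qed.

(** * The unit circle *)

Definition ei (x : R) : C := (cos x, sin x).

Lemma ei_plus (x y : R) : ei (x + y) = (ei x * ei y)%C.
Proof. unfold ei, Cmult; simpl. rewrite cos_plus, sin_plus. f_equal; ring. Qed.

Lemma ei_0 : ei 0 = 1.
Proof. unfold ei. rewrite cos_0, sin_0. reflexivity. Qed.

Lemma ei_pow (x : R) (n : nat) : (ei x ^ n)%C = ei (INR n * x).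
Proof.
  induction n as [|n IH]; [simpl; rewrite Rmult_0_l, ei_0; reflexivity|].
  rewrite Cpow_S, IH, <- ei_plus, S_INR. f_equal. ring.
Qed.

Lemma Cmod_ei (x : R) : Cmod (ei x) = 1.
Proof.
  unfold Cmod, ei. replace (_ + _) with 1; [apply sqrt_1|].
  simpl. pose proof (sin2_cos2 x). unfold Rsqr in *. lra.
Qed.

Lemma Cconj_ei (x : R) : Cconj (ei x) = ei (- x).
Proof. unfold Cconj, ei; simpl. rewrite cos_neg, sin_neg. reflexivity. Qed.

Lemma ei_2PI (k : nat) : ei (2 * PI * INR k) = 1.
Proof.
  replace (2 * PI * INR k) with (0 + 2 * INR k * PI) by ring.
  unfold ei. rewrite cos_period, sin_period, cos_0, sin_0. reflexivity.
Qed.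

Lemma ei_inj (x0 x y : R) : x0 <= x < x0 + 2 * PI -> x0 <= y < x0 + 2 * PI ->
  ei x = ei y -> x = y.
Proof.
  assert (main : forall x y, x < y < x + 2 * PI -> ei x = ei y -> False).
  { clear. intros x y h E. injection E as Ec Es.
    assert (K : cos (y - x) = 1).
    { rewrite cos_minus, Ec, Es. pose proof (sin2_cos2 y). unfold Rsqr in *. lra. }
    replace (y - x) with (2 * ((y - x) / 2)) in K by field.
    rewrite cos_2a_sin in K.
    assert (0 < sin ((y - x) / 2)) by (apply sin_gt_0; lra). nra. }
  intros hx hy E. destruct (Rtotal_order x y) as [h|[h|h]]; [|exact h|]; exfalso.
  - apply (main x y); [lra|exact E].
  - apply (main y x); [lra|auto].
Qed.

Lemma unit_polar (c : C) : Cmod c = 1 -> exists x, c = ei x.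
Proof.
  intros H. destruct c as [x y].
  assert (E : x ^ 2 + y ^ 2 = 1).
  { pose proof (Cmod2_alt (x, y)) as K. rewrite H in K. simpl in K. simpl. lra. }
  assert (hx : -1 <= x <= 1) by nra.
  assert (hs : sin (acos x) ^ 2 = y ^ 2).
  { pose proof (sin2_cos2 (acos x)) as K. rewrite cos_acos in K by exact hx. unfold Rsqr in K. lra. }
  assert (hp : 0 <= sin (acos x)).
  { pose proof (acos_bound x). apply sin_ge_0; lra. }
  destruct (Rle_dec 0 y) as [hy|hy].
  - exists (acos x). unfold ei. rewrite cos_acos by exact hx. f_equal. nra.
  - exists (- acos x). unfold ei. rewrite cos_neg, sin_neg, cos_acos by exact hx. f_equal. nra.
Qed.

Lemma polar (c : C) : exists x, c = (Cmod c * ei x)%C.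
Proof.
  destruct (Ceq_dec c 0) as [->|h].
  - exists 0. rewrite Cmod_0. ring.
  - assert (h' : Cmod c <> 0) by (intros e; apply h, Cmod_eq_0, e).
    assert (h'' : RtoC (Cmod c) <> 0) by (intros e; apply RtoC_inj in e; contradiction).
    destruct (unit_polar (c / Cmod c)%C) as [x Hx].
    + rewrite Cmod_div, Cmod_R, Rabs_pos_eq; [field; exact h'|apply Cmod_ge_0|exact h''].
    + exists x. rewrite <- Hx. field. exact h''.
Qed.

Lemma pos_root (n : nat) (c : R) : (0 < n)%nat -> 0 < c -> exists r, 0 < r /\ r ^ n = c.
Proof.
  intros hn hc. exists (Rpower c (/ INR n)). split; [apply exp_pos|].
  rewrite <- Rpower_pow by apply exp_pos. rewrite Rpower_mult, Rinv_l, Rpower_1; auto.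
  apply not_0_INR; lia.
Qed.

(** The [n] explicit roots are distinct by [ei_inj]; one more would give the polynomial [y ^ n - c]
    too many roots. *)
Lemma pow_roots (n : nat) (c : C) : (0 < n)%nat -> c <> 0 ->
  exists l, NoDup l /\ length l = n /\ forall y, In y l <-> (y ^ n)%C = c.
Proof.
  intros hn hc. destruct (polar c) as [x Hx].
  assert (hm : 0 < Cmod c) by (apply Cmod_gt_0, hc).
  destruct (pos_root n (Cmod c) hn hm) as [r [hr Hr]].
  assert (hr' : RtoC r <> 0) by (intros e; apply RtoC_inj in e; lra).
  assert (hN : 0 < INR n) by (apply lt_0_INR, hn).
  set (y := fun k : nat => (r * ei ((x + 2 * PI * INR k) / INR n))%C).
  set (l := map y (seq 0 n)).
  assert (Hroot : forall k, (y k ^ n)%C = c).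
  { intros k. unfold y. rewrite Cpow_mult_l, ei_pow, <- RtoC_pow, Hr.
    replace (INR n * ((x + 2 * PI * INR k) / INR n)) with (x + 2 * PI * INR k) by (field; lra).
    rewrite ei_plus, ei_2PI. rewrite Hx at 2. ring. }
  assert (Hnd : NoDup l).
  { apply NoDup_map_in; [apply seq_NoDup|].
    intros i j hi hj E. apply in_seq in hi, hj. unfold y in E.
    assert (E' : ei ((x + 2 * PI * INR i) / INR n) = ei ((x + 2 * PI * INR j) / INR n)).
    { replace (ei ((x + 2 * PI * INR i) / INR n))
        with (/ r * (r * ei ((x + 2 * PI * INR i) / INR n)))%C by (field; exact hr').
      rewrite E. field. exact hr'. }
    assert (B : forall k, (k < n)%nat ->
       x / INR n <= (x + 2 * PI * INR k) / INR n < x / INR n + 2 * PI).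
    { intros k hk. assert (hk' : INR k < INR n) by (apply lt_INR, hk).
      pose proof (pos_INR k). pose proof PI_RGT_0.
      assert (hdiv : 0 <= INR k / INR n < 1).
      { split; [apply Rmult_le_pos; [lra|apply Rlt_le, Rinv_0_lt_compat; lra]|].
        apply Rmult_lt_reg_r with (INR n); [lra|]. unfold Rdiv.
        rewrite Rmult_assoc, Rinv_l by lra. lra. }
      replace ((x + 2 * PI * INR k) / INR n) with (x / INR n + 2 * PI * (INR k / INR n))
        by (field; lra). nra. }
    apply (ei_inj (x / INR n)) in E'; try (apply B; lia).
    assert (E2 : INR i = INR j); [|apply INR_eq, E2].
    pose proof PI_RGT_0. apply Rmult_eq_reg_l with (2 * PI); [|lra].
    apply Rplus_eq_reg_l with x. apply Rmult_eq_reg_r with (/ INR n); [exact E'|].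
    apply Rinv_neq_0_compat; lra. }
  assert (Hlen : length l = n) by (unfold l; rewrite length_map, length_seq; reflexivity).
  exists l. split; [exact Hnd|]. split; [exact Hlen|]. intros v. split.
  - intros hv. apply in_map_iff in hv. destruct hv as [k [<- _]]. apply Hroot.
  - intros hv. apply NNPP. intros hnin.
    assert (B : (length (v :: l) <= n)%nat); [|simpl in B; lia].
    apply (poly_fun_roots n (fun t => 1 * t ^ n + (- c) * t ^ 0)%C (v :: l) 0).
    + apply poly_fun_plus; apply poly_fun_monomial; lia.
    + destruct n as [|m]; [lia|]. rewrite Cpow_S. simpl (_ ^ 0)%C. intros K.
      apply hc. replace c with (- (1 * (0 * 0 ^ m) + - c * 1))%C by ring. rewrite K. ring.
    + constructor; assumption.
    + intros t ht. simpl (_ ^ 0)%C. assert (K : (t ^ n)%C = c).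
      { destruct ht as [<-|ht]; [exact hv|]. apply in_map_iff in ht.
        destruct ht as [k [<- _]]. apply Hroot. }
      rewrite K. ring.
Qed.

(** * Degeneracy of the intrinsic Hessian *)

Definition basis_vec (k i : nat) : R := if (i =? k)%nat then 1 else 0.

Lemma mulv_comb (n : nat) (L : nat -> nat -> R) (s : R) (v w : nat -> R) (i : nat) :
  mulv n L (fun j => v j + s * w j) i = mulv n L v i + s * mulv n L w i.
Proof. unfold mulv. induction n as [|n IH]; simpl; [ring|rewrite IH; ring]. Qed.

Lemma mulv_zero (n : nat) (L : nat -> nat -> R) (v : nat -> R) (i : nat) :
  (forall j, (j < n)%nat -> v j = 0) -> mulv n L v i = 0.
Proof.
  intros H. rewrite (mulv_ext n L v (fun _ => 0)) by exact H.
  unfold mulv. rewrite sumn_scal_r. ring.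
Qed.

(** The Hessian of [Re (al * F)] as a bilinear form on all of R^4. For nonzero [al] it is
    nondegenerate there as soon as both second derivatives are nonzero. *)
Definition polarF (p q : nat) (z w al : C) (v v' : nat -> R) : R :=
  Re (al * (ddpow p z * (vz v * vz v') + ddpow q w * (vw v * vw v'))).

Lemma QF_polar (p q : nat) (z w al : C) (v v' : nat -> R) :
  Re (al * QF p q z w (fun j => v j + 1 * v' j))
  = Re (al * QF p q z w v) + polarF p q z w al v v' + Re (al * QF p q z w v').
Proof.
  unfold polarF. rewrite <- !re_plus. f_equal. unfold QF.
  replace (vz (fun j => v j + 1 * v' j)) with (vz v + vz v')%C
    by (unfold vz; apply injective_projections; simpl; ring).
  replace (vw (fun j => v j + 1 * v' j)) with (vw v + vw v')%C
    by (unfold vw; apply injective_projections; simpl; ring).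
  field.
Qed.

Lemma dF_comb (p q : nat) (a b z w : C) (s : R) (v v' : nat -> R) :
  dF p q a b z w (fun j => v j + s * v' j)
  = (dF p q a b z w v + s * dF p q a b z w v')%C.
Proof.
  unfold dF.
  replace (vz (fun j => v j + s * v' j)) with (vz v + s * vz v')%C
    by (unfold vz; apply injective_projections; simpl; ring).
  replace (vw (fun j => v j + s * v' j)) with (vw v + s * vw v')%C
    by (unfold vw; apply injective_projections; simpl; ring).
  rewrite !Cplus_conj, !Cmult_conj.
  replace (Cconj s) with (RtoC s) by (unfold Cconj, RtoC; simpl; f_equal; ring).
  ring.
Qed.

Lemma polarF_comb_r (p q : nat) (z w al : C) (s : R) (n v v' : nat -> R) :
  polarF p q z w al n (fun j => v j + s * v' j)
  = polarF p q z w al n v + s * polarF p q z w al n v'.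
Proof.
  unfold polarF. rewrite <- re_scal_l, <- re_plus. f_equal.
  replace (vz (fun j => v j + s * v' j)) with (vz v + s * vz v')%C
    by (unfold vz; apply injective_projections; simpl; ring).
  replace (vw (fun j => v j + s * v' j)) with (vw v + s * vw v')%C
    by (unfold vw; apply injective_projections; simpl; ring).
  ring.
Qed.

Lemma polarF_sym (p q : nat) (z w al : C) (v v' : nat -> R) :
  polarF p q z w al v v' = polarF p q z w al v' v.
Proof. unfold polarF. f_equal. ring. Qed.

Section Singular.
Context (p q : nat) (a b z w al : C).

Definition covector_eqs : Prop :=
  (al * dpow p z = - Cconj (al * a) /\ al * dpow q w = - Cconj (al * b))%C.

(** [Re (c v + d conj v) = Re ((c + conj d) v)] vanishes for all [v] only if [c = - conj d]; the
    basis vectors give the real and imaginary parts. *)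
Lemma covector_eqs_iff :
  (forall v, Re (al * dF p q a b z w v) = 0) <-> covector_eqs.
Proof.
  unfold covector_eqs. split.
  - intros H.
    pose proof (H (basis_vec 0)) as H0. pose proof (H (basis_vec 1)) as H1.
    pose proof (H (basis_vec 2)) as H2. pose proof (H (basis_vec 3)) as H3.
    unfold dF, vz, vw, basis_vec in *. simpl in *.
    split; apply injective_projections; simpl; lra.
  - intros [H1 H2] v. unfold dF.
    replace (al * (dpow p z * vz v + dpow q w * vw v + (a * Cconj (vz v) + b * Cconj (vw v))))%C
      with ((al * dpow p z) * vz v + (al * dpow q w) * vw v
            + ((al * a) * Cconj (vz v) + (al * b) * Cconj (vw v)))%C by ring.
    rewrite H1, H2. destruct (al * a)%C, (al * b)%C, (vz v), (vw v); simpl. ring.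
Qed.

Context (al0 : al <> 0).
Context (Hal : covector_eqs).

(** By the covector equations [al * dF v] is [X - conj X = 2 i Im X], where [X] is the
    complex-linear part of [al * dF v]. *)
Lemma dF_eq0_iff (v : nat -> R) :
  dF p q a b z w v = 0 <-> Im ((al * dpow p z) * vz v + (al * dpow q w) * vw v) = 0.
Proof.
  assert (E : (al * dF p q a b z w v)%C
    = (2 * Ci * Im ((al * dpow p z) * vz v + (al * dpow q w) * vw v))%C).
  { rewrite <- im_alt'. destruct Hal as [H1 H2]. unfold dF.
    replace (al * (dpow p z * vz v + dpow q w * vw v + (a * Cconj (vz v) + b * Cconj (vw v))))%C
      with ((al * dpow p z) * vz v + (al * dpow q w) * vw v
            + ((al * a) * Cconj (vz v) + (al * b) * Cconj (vw v)))%C by ring.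
    rewrite H1, H2. generalize (al * a)%C (al * b)%C. intros c d.
    rewrite Cplus_conj, !Cmult_conj, !Copp_conj, !Cconj_conj. ring. }
  split; intros H.
  - rewrite H, Cmult_0_r in E. apply (f_equal Im) in E.
    revert E. generalize (Im (al * dpow p z * vz v + al * dpow q w * vw v)).
    intros r E. simpl in E. lra.
  - rewrite H in E. rewrite Cmult_0_r in E. apply Cmult_integral in E. tauto.
Qed.

Context (e1 e2 e3 : R) (L M : nat -> nat -> R).
Context (he1 : e1 <> 0).
Context (he2 : e2 <> 0).
Context (HML : forall v i, (i < 4)%nat -> mulv 4 M (mulv 4 L v) i = v i).
Context (HLM : forall v i, (i < 4)%nat -> mulv 4 L (mulv 4 M v) i = v i).
Context (Hker : forall v, dF p q a b z w v = 0 <-> mulv 4 L v 0 = 0).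
Context (Hquad : forall v, dF p q a b z w v = 0 -> Re (al * QF p q z w v)
  = e1 * mulv 4 L v 1 ^ 2 + e2 * mulv 4 L v 2 ^ 2 + e3 * mulv 4 L v 3 ^ 2).

Lemma kernel_comb (s : R) (v v' : nat -> R) :
  dF p q a b z w v = 0 -> dF p q a b z w v' = 0 ->
  dF p q a b z w (fun j => v j + s * v' j) = 0.
Proof. intros H H'. rewrite dF_comb, H, H'. ring. Qed.

Lemma polarF_diagonal (v v' : nat -> R) :
  dF p q a b z w v = 0 -> dF p q a b z w v' = 0 ->
  polarF p q z w al v v' = 2 * (e1 * (mulv 4 L v 1 * mulv 4 L v' 1)
    + e2 * (mulv 4 L v 2 * mulv 4 L v' 2) + e3 * (mulv 4 L v 3 * mulv 4 L v' 3)).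
Proof.
  intros H H'. pose proof (QF_polar p q z w al v v') as E.
  rewrite (Hquad _ H), (Hquad _ H'), (Hquad _ (kernel_comb 1 _ _ H H')) in E.
  rewrite !mulv_comb in E. lra.
Qed.

Lemma kernel_basis (k : nat) : (0 < k < 4)%nat -> dF p q a b z w (mulv 4 M (basis_vec k)) = 0.
Proof.
  intros hk. apply Hker. rewrite HLM by lia. unfold basis_vec.
  destruct (Nat.eqb_spec 0 k); [lia|reflexivity].
Qed.

(** In the coordinates given by [L] the form on the kernel is diagonal with entries [2 e1], [2 e2],
    [2 e3]; pairing with [M e_k] isolates one coordinate at a time. *)
Lemma null_vector_coords (n : nat -> R) :
  dF p q a b z w n = 0 ->
  (forall v, dF p q a b z w v = 0 -> polarF p q z w al n v = 0) ->
  mulv 4 L n 0 = 0 /\ mulv 4 L n 1 = 0 /\ mulv 4 L n 2 = 0 /\ e3 * mulv 4 L n 3 = 0.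
Proof.
  intros Hn H. split; [apply Hker, Hn|].
  pose proof (fun k hk => H _ (kernel_basis k hk)) as K.
  assert (K1 := K 1%nat ltac:(lia)). assert (K2 := K 2%nat ltac:(lia)).
  assert (K3 := K 3%nat ltac:(lia)). clear K.
  rewrite polarF_diagonal in K1, K2, K3 by (auto; apply kernel_basis; lia).
  rewrite !HLM in K1, K2, K3 by lia. unfold basis_vec in K1, K2, K3. simpl in K1, K2, K3.
  repeat split.
  - apply (Rmult_eq_reg_l e1); [lra|exact he1].
  - apply (Rmult_eq_reg_l e2); [lra|exact he2].
  - lra.
Qed.

Lemma L_inj (n : nat -> R) :
  (forall i, (i < 4)%nat -> mulv 4 L n i = 0) -> forall i, (i < 4)%nat -> n i = 0.
Proof. intros H i hi. rewrite <- (HML n i hi). apply mulv_zero, H. Qed.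

(* The Hessian has nullity at most one. *)
Lemma no_null_plane (v v' : nat -> R) (i j : nat) :
  (i < 4)%nat -> (j < 4)%nat -> v i = 1 -> v' i = 0 -> v' j = 1 -> v j = 0 ->
  (forall s, (forall u, polarF p q z w al (fun k => v k + s * v' k) u = 0)
     /\ dF p q a b z w (fun k => v k + s * v' k) = 0) ->
  (forall u, polarF p q z w al v' u = 0) -> dF p q a b z w v' = 0 -> False.
Proof.
  intros hi hj vi v'i v'j vj H H1 H2.
  destruct (null_vector_coords v' H2 (fun u _ => H1 u)) as [c0 [c1 [c2 _]]].
  assert (c3 : mulv 4 L v' 3 <> 0).
  { intros c3. assert (K : v' j = 0); [|lra]. apply L_inj; [|exact hj].
    intros [|[|[|[|k]]]] hk; auto; lia. }
  (* Cancels the last coordinate of [v + s v'], the only one in which a null vector can differ from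
     0. *)
  set (s := - mulv 4 L v 3 / mulv 4 L v' 3).
  destruct (H s) as [Hs Hs'].
  destruct (null_vector_coords _ Hs' (fun u _ => Hs u)) as [d0 [d1 [d2 _]]].
  assert (K : v i + s * v' i = 0); [|rewrite vi, v'i in K; lra].
  apply (L_inj (fun k => v k + s * v' k)); [|exact hi].
  intros [|[|[|[|k]]]] hk; auto; [|lia].
  rewrite mulv_comb. unfold s. field. exact c3.
Qed.

Lemma ddpow_0 (n : nat) (c : C) : (2 <= n)%nat -> ddpow n c = 0 -> (3 <= n)%nat /\ c = 0.
Proof.
  intros hn H. unfold ddpow in H. apply Cmult_integral in H. destruct H as [H|H].
  { exfalso. apply Cmult_integral in H.
    destruct H as [H|H]; apply RtoC_inj in H; apply INR_eq with (m := 0%nat) in H; lia. }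
  destruct (Nat.eq_dec n 2) as [->|h].
  { simpl in H. apply RtoC_inj in H. lra. }
  split; [lia|]. destruct (Ceq_dec c 0) as [e|e]; [exact e|].
  exfalso. exact (Cpow_nz c _ e H).
Qed.

Lemma dpow_0 (n : nat) : (2 <= n)%nat -> dpow n 0 = 0.
Proof.
  intros hn. unfold dpow. destruct n as [|[|n]]; [lia|lia|]. simpl Nat.sub.
  rewrite Cpow_S. ring.
Qed.

(** The second derivative of a power can vanish only at 0, where the first vanishes too. Then a
    whole coordinate plane lies in the kernel and is null for the Hessian, against [e1] and [e2]
    nonzero. *)
Lemma ddpow_neq0 : (2 <= p)%nat -> (2 <= q)%nat -> ddpow p z <> 0 /\ ddpow q w <> 0.
Proof.
  intros hp hq. split; intros H.
  - assert (hz := ddpow_0 p z hp H). destruct hz as [_ hz].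
    assert (D : (al * dpow p z)%C = 0) by (rewrite hz, dpow_0 by exact hp; ring).
    apply (no_null_plane (basis_vec 0) (basis_vec 1) 0 1); try reflexivity; try lia.
    + intros s. split.
      * intros u. unfold polarF. rewrite H.
        replace (vw (fun k => basis_vec 0 k + s * basis_vec 1 k)) with (RtoC 0)
          by (unfold vw, basis_vec; simpl; apply injective_projections; simpl; ring).
        rewrite !Cmult_0_l, Cmult_0_r, Cplus_0_l, Cmult_0_r. reflexivity.
      * apply dF_eq0_iff. rewrite D.
        replace (vw (fun k => basis_vec 0 k + s * basis_vec 1 k)) with (RtoC 0)
          by (unfold vw, basis_vec; simpl; apply injective_projections; simpl; ring).
        rewrite !Cmult_0_l, Cmult_0_r, Cplus_0_l. reflexivity.
    + intros u. unfold polarF. rewrite H.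
      replace (vw (basis_vec 1)) with (RtoC 0) by reflexivity.
      rewrite !Cmult_0_l, Cmult_0_r, Cplus_0_l, Cmult_0_r. reflexivity.
    + apply dF_eq0_iff. rewrite D. replace (vw (basis_vec 1)) with (RtoC 0) by reflexivity.
      rewrite !Cmult_0_l, Cmult_0_r, Cplus_0_l. reflexivity.
  - assert (hw := ddpow_0 q w hq H). destruct hw as [_ hw].
    assert (D : (al * dpow q w)%C = 0) by (rewrite hw, dpow_0 by exact hq; ring).
    apply (no_null_plane (basis_vec 2) (basis_vec 3) 2 3); try reflexivity; try lia.
    + intros s. split.
      * intros u. unfold polarF. rewrite H.
        replace (vz (fun k => basis_vec 2 k + s * basis_vec 3 k)) with (RtoC 0)
          by (unfold vz, basis_vec; simpl; apply injective_projections; simpl; ring).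
        rewrite !Cmult_0_l, Cmult_0_r, Cplus_0_l, Cmult_0_r. reflexivity.
      * apply dF_eq0_iff. rewrite D.
        replace (vz (fun k => basis_vec 2 k + s * basis_vec 3 k)) with (RtoC 0)
          by (unfold vz, basis_vec; simpl; apply injective_projections; simpl; ring).
        rewrite !Cmult_0_l, Cmult_0_r, Cplus_0_l. reflexivity.
    + intros u. unfold polarF. rewrite H.
      replace (vz (basis_vec 3)) with (RtoC 0) by reflexivity.
      rewrite !Cmult_0_l, Cmult_0_r, Cplus_0_l, Cmult_0_r. reflexivity.
    + apply dF_eq0_iff. rewrite D. replace (vz (basis_vec 3)) with (RtoC 0) by reflexivity.
      rewrite !Cmult_0_l, Cmult_0_r, Cplus_0_l. reflexivity.
Qed.

Definition vec4 (c d : C) (i : nat) : R :=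
  match i with 0%nat => fst c | 1%nat => snd c | 2%nat => fst d | _ => snd d end.

Lemma vz_vec4 (c d : C) : vz (vec4 c d) = c.
Proof. destruct c; reflexivity. Qed.

Lemma vw_vec4 (c d : C) : vw (vec4 c d) = d.
Proof. destruct d; reflexivity. Qed.

(* The gradient of [Im (A * vz v + B * vw v)] for the symmetric form [polarF]. *)
Definition kernel_normal : nat -> R :=
  vec4 (- Ci * (al * dpow p z) / (al * ddpow p z))%C (- Ci * (al * dpow q w) / (al * ddpow q w))%C.

(** Its real part is, up to sign, the value of the Hessian on [kernel_normal]: combine
    [polarF_normal] with [normal_degeneracy]. *)
Definition degeneracy : C :=
  ((al * dpow p z) ^ 2 / (al * ddpow p z) + (al * dpow q w) ^ 2 / (al * ddpow q w))%C.

Lemma polarF_normal (v : nat -> R) : ddpow p z <> 0 -> ddpow q w <> 0 ->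
  polarF p q z w al kernel_normal v = Im ((al * dpow p z) * vz v + (al * dpow q w) * vw v).
Proof.
  intros c1 c2. unfold polarF, kernel_normal. rewrite vz_vec4, vw_vec4.
  replace (Im ((al * dpow p z) * vz v + (al * dpow q w) * vw v))
    with (Re ((- Ci) * ((al * dpow p z) * vz v + (al * dpow q w) * vw v))).
  - f_equal. field. auto.
  - generalize ((al * dpow p z) * vz v + (al * dpow q w) * vw v)%C. intros [x y]; simpl; ring.
Qed.

Lemma normal_degeneracy : ddpow p z <> 0 -> ddpow q w <> 0 ->
  Im ((al * dpow p z) * vz kernel_normal + (al * dpow q w) * vw kernel_normal)
  = - Re degeneracy.
Proof.
  intros c1 c2. unfold kernel_normal, degeneracy. rewrite vz_vec4, vw_vec4.
  set (g := ((al * dpow p z) ^ 2 / (al * ddpow p z) + (al * dpow q w) ^ 2 / (al * ddpow q w))%C).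
  replace (_ + _)%C with (- Ci * g)%C by (unfold g; field; auto).
  destruct g; simpl; ring.
Qed.

Lemma kernel_proper : ~ (forall v, dF p q a b z w v = 0).
Proof.
  intros H. specialize (H (mulv 4 M (basis_vec 0))). apply Hker in H.
  rewrite HLM in H by lia. unfold basis_vec in H; simpl in H. lra.
Qed.

(** An isotropic normal lies in the kernel and is orthogonal to it, so it is null for the
    nondegenerate restricted form and vanishes; then [dF] would be identically zero. *)
Lemma nondegenerate_fold : (2 <= p)%nat -> (2 <= q)%nat -> e3 <> 0 -> Re degeneracy <> 0.
Proof.
  intros hp hq he3 H. destruct (ddpow_neq0 hp hq) as [c1 c2].
  assert (K : dF p q a b z w kernel_normal = 0).
  { apply dF_eq0_iff. rewrite normal_degeneracy by assumption. lra. }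
  destruct (null_vector_coords kernel_normal K) as [n0 [n1 [n2 n3]]].
  { intros v hv. rewrite polarF_normal by assumption. apply dF_eq0_iff, hv. }
  assert (N : forall i, (i < 4)%nat -> kernel_normal i = 0).
  { apply L_inj. intros [|[|[|[|i]]]] hi; auto; [|lia].
    apply (Rmult_eq_reg_l e3); [lra|exact he3]. }
  apply kernel_proper. intros v. apply dF_eq0_iff. rewrite <- polarF_normal by assumption.
  unfold polarF.
  replace (vz kernel_normal) with (RtoC 0)
    by (unfold vz; rewrite !N by lia; reflexivity).
  replace (vw kernel_normal) with (RtoC 0)
    by (unfold vw; rewrite !N by lia; reflexivity).
  rewrite !Cmult_0_l, !Cmult_0_r, Cplus_0_r, Cmult_0_r. reflexivity.
Qed.

(** Here [M e_3] is null on the kernel. If the normal were not isotropic, it would span everything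
    together with the kernel, and [M e_3] would be orthogonal to all vectors, which nondegeneracy of
    the Hessian on R^4 excludes. *)
Lemma degenerate_cusp : (2 <= p)%nat -> (2 <= q)%nat -> e3 = 0 -> Re degeneracy = 0.
Proof.
  intros hp hq he3. destruct (ddpow_neq0 hp hq) as [c1 c2].
  destruct (Req_dec (Re degeneracy) 0) as [H|H]; [exact H|exfalso].
  set (n := mulv 4 M (basis_vec 3)).
  assert (Kn : dF p q a b z w n = 0) by (apply kernel_basis; lia).
  assert (N0 : forall v, dF p q a b z w v = 0 -> polarF p q z w al n v = 0).
  { intros v hv. rewrite polarF_diagonal by assumption. unfold n. rewrite !HLM by lia.
    rewrite he3. unfold basis_vec. simpl. ring. }
  assert (N : forall v, polarF p q z w al n v = 0).
  { intros v.
    set (l := Im ((al * dpow p z) * vz v + (al * dpow q w) * vw v)).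
    (* Projection to the kernel along the normal, on which the defining functional takes the value
       [- Re degeneracy]. *)
    set (s := l / Re degeneracy).
    assert (K : dF p q a b z w (fun j => v j + s * kernel_normal j) = 0).
    { apply dF_eq0_iff. rewrite <- polarF_normal by assumption.
      rewrite polarF_comb_r, !polarF_normal, normal_degeneracy by assumption.
      fold l. unfold s. field. exact H. }
    apply N0 in K. rewrite polarF_comb_r in K.
    rewrite (polarF_sym p q z w al n kernel_normal), polarF_normal in K by assumption.
    apply dF_eq0_iff in Kn. rewrite Kn in K. lra. }
  assert (Z : vz n = 0 /\ vw n = 0).
  (* Testing against these conjugates turns the pairing into [|X|^2 + |Y|^2]. *)
  { specialize (N (vec4 (Cconj (al * (ddpow p z * vz n))) (Cconj (al * (ddpow q w * vw n))))).
    unfold polarF in N. rewrite vz_vec4, vw_vec4 in N.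
    set (X := (al * (ddpow p z * vz n))%C) in *. set (Y := (al * (ddpow q w * vw n))%C) in *.
    replace (al * (ddpow p z * (vz n * Cconj X) + ddpow q w * (vw n * Cconj Y)))%C
      with (X * Cconj X + Y * Cconj Y)%C in N by (unfold X, Y; ring).
    assert (hXY : X = 0 /\ Y = 0).
    { destruct X as [x x'], Y as [y y']. simpl in N.
      assert (x = 0) by nra. assert (x' = 0) by nra.
      assert (y = 0) by nra. assert (y' = 0) by nra. subst. split; reflexivity. }
    destruct hXY as [hX hY]. unfold X, Y in hX, hY.
    apply Cmult_integral in hX, hY. destruct hX as [hX|hX]; [tauto|].
    destruct hY as [hY|hY]; [tauto|]. apply Cmult_integral in hX, hY. tauto. }
  assert (T : mulv 4 L n 3 = 0).
  { destruct Z as [Zz Zw]. unfold vz, vw in *. injection Zz as z0 z1. injection Zw as w0 w1.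
    apply mulv_zero. intros [|[|[|[|i]]]] hi; auto; lia. }
  unfold n in T. rewrite HLM in T by lia. unfold basis_vec in T; simpl in T. lra.
Qed.

End Singular.

(** * The cusp equations *)

(** Here [u] stands for [conj al / al], which is insensitive to real rescaling of [al]. *)
Definition singular_at (p q : nat) (a b z w u : C) : Prop :=
  Cmod u = 1 /\ dpow p z = (- (u * Cconj a))%C /\ dpow q w = (- (u * Cconj b))%C.

(** This is [degeneracy] times [(p - 1) (q - 1) / al]: since [dpow^2 / ddpow] equals
    [p z^p / (p - 1)], and likewise for [w], the denominators disappear. *)
Definition cuspG (p q : nat) (z w : C) : C :=
  (INR p * INR (q - 1) * z ^ p + INR q * INR (p - 1) * w ^ q)%C.

Definition cusp_eqs (p q : nat) (a b z w : C) : Prop :=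
  exists u, singular_at p q a b z w u /\ (cuspG p q z w + u * Cconj (cuspG p q z w))%C = 0.

Lemma Cmod1_conj (u : C) : Cmod u = 1 -> (u * Cconj u)%C = 1.
Proof. intros H. rewrite <- Cmod2_conj, H. f_equal. ring. Qed.

(** [1 + conj u] works unless it vanishes, that is for [u = -1], where [i] does. *)
Lemma covector_of_unit (u : C) : Cmod u = 1 -> exists al : C, al <> 0 /\ Cconj al = (u * al)%C.
Proof.
  intros H. pose proof (Cmod1_conj u H) as E.
  destruct (Ceq_dec (1 + Cconj u)%C 0) as [h|h].
  - exists Ci. split; [exact Ci_nz|].
    assert (h' : u = (- (1))%C).
    { rewrite <- (Cconj_conj u). replace (Cconj u) with (- (1))%C.
      - unfold Cconj, Copp, RtoC; simpl; f_equal; ring.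
      - replace (Cconj u) with ((1 + Cconj u) - 1)%C by ring. rewrite h. ring. }
    rewrite h'. unfold Cconj, Ci, Cmult, Copp, RtoC; simpl; f_equal; ring.
  - exists (1 + Cconj u)%C. split; [exact h|].
    rewrite Cplus_conj, Cconj_conj, Cmult_plus_distr_l, E.
    replace (Cconj 1) with (RtoC 1) by (unfold Cconj, RtoC; simpl; f_equal; ring). ring.
Qed.

Lemma unit_of_covector (al : C) : al <> 0 -> exists u : C, Cmod u = 1 /\ Cconj al = (u * al)%C.
Proof.
  intros h. exists (Cconj al / al)%C. split.
  - rewrite Cmod_div by exact h. rewrite Cmod_conj. field.
    intros h'. apply h, Cmod_eq_0, h'.
  - field. exact h.
Qed.

Lemma covector_eqs_unit (p q : nat) (a b z w al u : C) :
  al <> 0 -> Cmod u = 1 -> Cconj al = (u * al)%C ->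
  covector_eqs p q a b z w al <-> singular_at p q a b z w u.
Proof.
  intros h hu E. unfold covector_eqs, singular_at. rewrite !Cmult_conj, E. split.
  - intros [H1 H2]. split; [exact hu|]. split.
    + replace (dpow p z) with (/ al * (al * dpow p z))%C by (field; exact h).
      rewrite H1. field; exact h.
    + replace (dpow q w) with (/ al * (al * dpow q w))%C by (field; exact h).
      rewrite H2. field; exact h.
  - intros [_ [H1 H2]]. rewrite H1, H2. split; ring.
Qed.

Lemma dpow_sqr_ddpow (p : nat) (z : C) : (2 <= p)%nat ->
  (INR (p - 1) * dpow p z ^ 2)%C = (INR p * z ^ p * ddpow p z)%C.
Proof.
  intros hp. destruct p as [|[|p]]; [lia|lia|]. unfold dpow, ddpow.
  replace (S (S p) - 1)%nat with (S p) by lia. replace (S (S p) - 2)%nat with p by lia.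
  rewrite !Cpow_S. simpl (_ ^ 0)%C. ring.
Qed.

Lemma INR_C_neq0 (n : nat) : (0 < n)%nat -> RtoC (INR n) <> 0.
Proof. intros h H. apply RtoC_inj in H. apply INR_eq with (m := 0%nat) in H. lia. Qed.

Lemma degeneracy_cuspG (p q : nat) (z w al : C) :
  (2 <= p)%nat -> (2 <= q)%nat -> al <> 0 -> ddpow p z <> 0 -> ddpow q w <> 0 ->
  (RtoC (INR (p - 1) * INR (q - 1)) * degeneracy p q z w al)%C = (al * cuspG p q z w)%C.
Proof.
  intros hp hq h c1 c2. unfold degeneracy, cuspG.
  replace (INR p * INR (q - 1) * z ^ p)%C with (INR (q - 1) * (INR p * z ^ p * ddpow p z) / ddpow p z)%C
    by (field; exact c1).
  replace (INR q * INR (p - 1) * w ^ q)%C with (INR (p - 1) * (INR q * w ^ q * ddpow q w) / ddpow q w)%C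
    by (field; exact c2).
  rewrite <- !dpow_sqr_ddpow by assumption. rewrite RtoC_mult. field. auto.
Qed.

(** [2 Re (al g) = al g + conj al conj g = al (g + u conj g)]. *)
Lemma Re_mult_eq0 (al u g : C) : al <> 0 -> Cconj al = (u * al)%C ->
  Re (al * g) = 0 <-> (g + u * Cconj g)%C = 0.
Proof.
  intros h E.
  assert (K : RtoC (2 * Re (al * g)) = (al * (g + u * Cconj g))%C).
  { rewrite RtoC_mult, re_alt, Cmult_conj, E. field. }
  split; intros H.
  - rewrite H, Rmult_0_r in K. symmetry in K. apply Cmult_integral in K. tauto.
  - rewrite H, Cmult_0_r in K. apply RtoC_inj in K. lra.
Qed.

Lemma degeneracy_iff (p q : nat) (z w al u : C) :
  (2 <= p)%nat -> (2 <= q)%nat -> al <> 0 -> ddpow p z <> 0 -> ddpow q w <> 0 ->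
  Cconj al = (u * al)%C ->
  Re (degeneracy p q z w al) = 0 <-> (cuspG p q z w + u * Cconj (cuspG p q z w))%C = 0.
Proof.
  intros hp hq h c1 c2 E.
  rewrite <- (Re_mult_eq0 al u _ h E), <- degeneracy_cuspG by assumption.
  rewrite re_scal_l.
  assert (hn : INR (p - 1) * INR (q - 1) <> 0).
  { apply Rmult_integral_contrapositive_currified; apply not_0_INR; lia. }
  split; intros H; [rewrite H; ring|].
  apply Rmult_integral in H. tauto.
Qed.

Lemma singular_type_fold (p q : nat) (a b z w : C) (e1 e2 e3 : R) :
  (2 <= p)%nat -> (2 <= q)%nat -> e1 <> 0 -> e2 <> 0 -> e3 <> 0 ->
  singular_type p q a b z w e1 e2 e3 ->
  exists u, singular_at p q a b z w u /\ (cuspG p q z w + u * Cconj (cuspG p q z w))%C <> 0.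
Proof.
  intros hp hq he1 he2 he3 [al [L [M [al0 [HML [HLM [H1 [H2 H3]]]]]]]].
  apply covector_eqs_iff in H1. destruct (unit_of_covector al al0) as [u [hu E]].
  destruct (ddpow_neq0 p q a b z w al al0 H1 e1 e2 e3 L M he1 he2 HML HLM H2 H3 hp hq) as [c1 c2].
  exists u. split; [apply (covector_eqs_unit p q a b z w al u); assumption|].
  rewrite <- (degeneracy_iff p q z w al u) by assumption.
  apply (nondegenerate_fold p q a b z w al al0 H1 e1 e2 e3 L M); assumption.
Qed.

Lemma singular_type_cusp (p q : nat) (a b z w : C) (e1 e2 : R) :
  (2 <= p)%nat -> (2 <= q)%nat -> e1 <> 0 -> e2 <> 0 ->
  singular_type p q a b z w e1 e2 0 -> cusp_eqs p q a b z w.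
Proof.
  intros hp hq he1 he2 [al [L [M [al0 [HML [HLM [H1 [H2 H3]]]]]]]].
  apply covector_eqs_iff in H1. destruct (unit_of_covector al al0) as [u [hu E]].
  destruct (ddpow_neq0 p q a b z w al al0 H1 e1 e2 0 L M he1 he2 HML HLM H2 H3 hp hq) as [c1 c2].
  exists u. split; [apply (covector_eqs_unit p q a b z w al u); assumption|].
  rewrite <- (degeneracy_iff p q z w al u) by assumption.
  apply (degenerate_cusp p q a b z w al al0 H1 e1 e2 0 L M); auto.
Qed.

Lemma singular_type_neq0 (p q : nat) (a b z w : C) (e1 e2 e3 : R) :
  (2 <= p)%nat -> (2 <= q)%nat -> e1 <> 0 -> e2 <> 0 ->
  singular_type p q a b z w e1 e2 e3 ->
  (a <> 0 \/ b <> 0) /\ ddpow p z <> 0 /\ ddpow q w <> 0.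
Proof.
  intros hp hq he1 he2 [al [L [M [al0 [HML [HLM [H1 [H2 H3]]]]]]]].
  apply covector_eqs_iff in H1. split.
  - destruct (Ceq_dec a 0) as [->|]; [|auto]. destruct (Ceq_dec b 0) as [->|]; [|auto].
    exfalso. apply (kernel_proper p q 0 0 z w L M HLM H2).
    intros v. apply (dF_eq0_iff p q 0 0 z w al al0 H1). destruct H1 as [K1 K2].
    assert (Z : (- Cconj (al * 0))%C = 0) by (rewrite Cmult_0_r; unfold Cconj, Copp, RtoC; simpl; f_equal; ring).
    rewrite K1, K2, Z, !Cmult_0_l, Cplus_0_l. reflexivity.
  - apply (ddpow_neq0 p q a b z w al al0 H1 e1 e2 e3 L M); assumption.
Qed.

(** * Cusps of an excellent map as solutions of the equations *)

Section Excellent.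
Context (p q : nat) (a b : C) (hp : (2 <= p)%nat) (hq : (2 <= q)%nat).
Context (exc : excellent (Fmap p q a b)).

Lemma excellent_cases (x : Rn 4) :
  local_form (Fmap p q a b) x nf_regular \/
  exists e2 e3, e2 <> 0 /\ singular_type p q a b (zof x) (wof x) 1 e2 e3 /\
    (is_cusp (Fmap p q a b) x \/ e3 <> 0).
Proof.
  destruct exc as [_ H]. destruct (H x) as [h|[h|[h|h]]]; [left; exact h|right..].
  - exists 1, 1. repeat split; try lra. apply def_fold_type, h.
  - exists 1, (-1). repeat split; try lra. apply indef_fold_type, h.
  - destruct (cusp_type p q a b x h) as [e2 [he2 h2]]. exists e2, 0. auto.
Qed.

Lemma singular_at_type (x : Rn 4) (u : C) :
  singular_at p q a b (zof x) (wof x) u ->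
  exists e2 e3, e2 <> 0 /\ singular_type p q a b (zof x) (wof x) 1 e2 e3 /\
    (is_cusp (Fmap p q a b) x \/ e3 <> 0).
Proof.
  intros H. destruct (excellent_cases x) as [h|h]; [exfalso|exact h].
  destruct (covector_of_unit u (proj1 H)) as [al [h0 E]].
  apply (regular_not_singular p q a b al x h h0). apply covector_eqs_iff.
  apply (covector_eqs_unit p q a b _ _ al u); auto. apply H.
Qed.

(** With [a = b = 0] the differential would vanish at the origin, while at a singular point of an
    excellent map it has rank one. *)
Lemma excellent_coeffs : a <> 0 \/ b <> 0.
Proof.
  destruct (Ceq_dec a 0) as [ha|ha]; [|auto]. destruct (Ceq_dec b 0) as [hb|hb]; [|auto].
  assert (S0 : singular_at p q a b (zof (Rn0 4)) (wof (Rn0 4)) 1).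
  { split; [apply Cmod_1|]. change (zof (Rn0 4)) with (RtoC 0). change (wof (Rn0 4)) with (RtoC 0).
    rewrite !dpow_0 by assumption. rewrite ha, hb.
    assert (Z : Cconj 0 = 0) by (unfold Cconj, RtoC; simpl; f_equal; ring).
    rewrite Z. split; ring. }
  destruct (singular_at_type _ _ S0) as [e2 [e3 [he2 [Ht _]]]].
  apply (singular_type_neq0 p q a b _ _ 1 e2 e3 hp hq ltac:(lra) he2 Ht).
Qed.

Lemma singular_at_ddpow (x : Rn 4) (u : C) :
  singular_at p q a b (zof x) (wof x) u -> ddpow p (zof x) <> 0 /\ ddpow q (wof x) <> 0.
Proof.
  intros S0. destruct (singular_at_type _ _ S0) as [e2 [e3 [he2 [Ht _]]]].
  apply (singular_type_neq0 p q a b _ _ 1 e2 e3 hp hq ltac:(lra) he2 Ht).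
Qed.

(** One of [a], [b] is nonzero and its equation determines [u]. So the [u] supplied by a fold type
    can be compared with the one in the cusp equations. *)
Lemma singular_at_unique (z w u u' : C) :
  singular_at p q a b z w u -> singular_at p q a b z w u' -> u = u'.
Proof.
  intros [_ [H1 H2]] [_ [H1' H2']].
  assert (K : forall c : C, c <> 0 -> (- (u * Cconj c) = - (u' * Cconj c))%C -> u = u').
  { intros c hc H. assert (hc' : Cconj c <> 0).
    { intros h. apply hc. rewrite <- (Cconj_conj c), h. unfold Cconj, RtoC; simpl; f_equal; ring. }
    replace u with (- - (u * Cconj c) / Cconj c)%C by (field; exact hc').
    rewrite H. field. exact hc'. }
  destruct excellent_coeffs as [h|h]; [apply (K a h)|apply (K b h)]; congruence.
Qed.

Lemma is_cusp_iff (x : Rn 4) :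
  is_cusp (Fmap p q a b) x <-> cusp_eqs p q a b (zof x) (wof x).
Proof.
  split.
  - intros h. destruct (cusp_type p q a b x h) as [e2 [he2 Ht]].
    apply (singular_type_cusp p q a b _ _ 1 e2); auto; lra.
  - intros [u [S0 H]]. destruct (singular_at_type _ _ S0) as [e2 [e3 [he2 [Ht [h|he3]]]]]; [exact h|].
    exfalso. destruct (singular_type_fold p q a b _ _ 1 e2 e3 hp hq ltac:(lra) he2 he3 Ht) as [u' [S' H']].
    rewrite <- (singular_at_unique _ _ _ _ S0 S') in H'. contradiction.
Qed.

End Excellent.

(** * Constraints on the coefficients, and isolation of cusps *)

Definition mkpt (z w : C) : Rn 4 := mkRn 4 (vec4 z w).

Lemma zof_mkpt (z w : C) : zof (mkpt z w) = z.
Proof. unfold zof, mkpt. rewrite !coord_mkRn by lia. destruct z; reflexivity. Qed.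

Lemma wof_mkpt (z w : C) : wof (mkpt z w) = w.
Proof. unfold wof, mkpt. rewrite !coord_mkRn by lia. destruct w; reflexivity. Qed.

Lemma mkpt_zof_wof (x : Rn 4) : mkpt (zof x) (wof x) = x.
Proof.
  apply Rn_ext. intros i hi. unfold mkpt. rewrite coord_mkRn by exact hi.
  destruct i as [|[|[|[|i]]]]; try reflexivity; lia.
Qed.

Lemma Cconj_0 : Cconj 0 = 0.
Proof. unfold Cconj, RtoC; simpl; f_equal; ring. Qed.

Lemma Cconj_neq0 (c : C) : c <> 0 -> Cconj c <> 0.
Proof. intros hc h. apply hc. rewrite <- (Cconj_conj c), h. apply Cconj_0. Qed.

Lemma Copp_neq0 (c : C) : c <> 0 -> (- c)%C <> 0.
Proof. intros hc h. apply hc. replace c with (- - c)%C by ring. rewrite h. ring. Qed.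

Lemma dpow_roots (p : nat) (c : C) : (2 <= p)%nat -> c <> 0 ->
  exists l, NoDup l /\ length l = (p - 1)%nat /\ forall y, In y l <-> dpow p y = c.
Proof.
  intros hp hc. pose proof (INR_C_neq0 p ltac:(lia)) as hI.
  destruct (pow_roots (p - 1) (c / INR p)%C) as [l [Hl [Hn H]]]; [lia| |].
  - intros h. apply hc. replace c with (INR p * (c / INR p))%C by (field; exact hI).
    rewrite h. ring.
  - exists l. split; [exact Hl|]. split; [exact Hn|]. intros y. rewrite H. unfold dpow. split.
    + intros ->. field. exact hI.
    + intros <-. field. exact hI.
Qed.

Lemma dpow_neq0_arg (p : nat) (z : C) : (2 <= p)%nat -> dpow p z <> 0 -> z <> 0.
Proof. intros hp h e. apply h. rewrite e. apply dpow_0, hp. Qed.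

(** Applied to roots of unity, this turns closeness to 1 into equality with 1. *)
Lemma finite_isolated (l : list C) (c : C) :
  exists d, 0 < d /\ forall y, In y l -> Cmod (y - c) < d -> y = c.
Proof.
  induction l as [|x l [d [hd H]]]; [exists 1; split; [lra|intros y []]|].
  destruct (Ceq_dec x c) as [h|h].
  - exists d. split; [exact hd|]. intros y [<-|hy] hlt; [exact h|apply H; assumption].
  - assert (hx : 0 < Cmod (x - c)) by (apply Cmod_gt_0, Cminus_eq_contra, h).
    exists (Rmin d (Cmod (x - c))). split; [apply Rmin_glb_lt; assumption|].
    intros y [<-|hy] hlt.
    + exfalso. pose proof (Rmin_r d (Cmod (x - c))). lra.
    + apply H; [exact hy|]. eapply Rlt_le_trans; [exact hlt|apply Rmin_l].
Qed.

Lemma pow_inj_pos (n : nat) (x y : R) : (0 < n)%nat -> 0 <= x -> 0 <= y -> x ^ n = y ^ n -> x = y.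
Proof.
  intros hn.
  assert (main : forall x y, 0 <= x -> x < y -> x ^ n < y ^ n).
  { clear -hn. intros x y hx h. induction n as [|n IH]; [lia|].
    destruct n as [|n]; [simpl; lra|]. specialize (IH ltac:(lia)).
    change (x * x ^ S n < y * y ^ S n). assert (0 <= x ^ S n) by (apply pow_le, hx). nra. }
  intros hx hy E. destruct (Rtotal_order x y) as [h|[h|h]]; [|exact h|].
  - specialize (main x y hx h). lra.
  - specialize (main y x hy h). lra.
Qed.

Lemma Cmod_le_sum (c : C) : Cmod c <= Rabs (fst c) + Rabs (snd c).
Proof.
  replace c with (fst c + Ci * snd c)%C at 1
    by (apply injective_projections; simpl; ring).
  eapply Rle_trans; [apply Cmod_triangle|]. rewrite Cmod_mult, Cmod_Ci, !Cmod_R. lra.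
Qed.

Section ExcellentCoeffs.
Context (p q : nat) (a b : C) (hp : (2 <= p)%nat) (hq : (2 <= q)%nat).
Context (exc : excellent (Fmap p q a b)).

(** For [q >= 3] the points [(z, 0)] with [dpow p z = - conj a] would be singular with a vanishing
    second derivative of [w ^ q], which [singular_at_ddpow] excludes. *)
Lemma excellent_b0 : b = 0 -> q = 2%nat.
Proof.
  intros hb. destruct (Nat.eq_dec q 2) as [h|h]; [exact h|exfalso].
  assert (ha : a <> 0) by (destruct (excellent_coeffs p q a b hp hq exc); [assumption|contradiction]).
  destruct (dpow_roots p (- Cconj a)%C hp) as [l [_ [Hn H]]]; [apply Copp_neq0, Cconj_neq0, ha|].
  destruct l as [|z l]; [simpl in Hn; lia|].
  destruct (singular_at_ddpow p q a b hp hq exc (mkpt z 0) 1) as [_ K].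
  - rewrite zof_mkpt, wof_mkpt. split; [apply Cmod_1|].
    rewrite (proj1 (H z)) by (left; reflexivity). rewrite hb, Cconj_0, dpow_0 by exact hq.
    split; ring.
  - apply K. rewrite wof_mkpt. unfold ddpow. destruct q as [|[|[|n]]]; try lia.
    replace (S (S (S n)) - 2)%nat with (S n) by lia. rewrite Cpow_S. ring.
Qed.

Lemma excellent_a0 : a = 0 -> p = 2%nat.
Proof.
  intros ha. destruct (Nat.eq_dec p 2) as [h|h]; [exact h|exfalso].
  assert (hb : b <> 0) by (destruct (excellent_coeffs p q a b hp hq exc); [contradiction|assumption]).
  destruct (dpow_roots q (- Cconj b)%C hq) as [l [_ [Hn H]]]; [apply Copp_neq0, Cconj_neq0, hb|].
  destruct l as [|w l]; [simpl in Hn; lia|].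
  destruct (singular_at_ddpow p q a b hp hq exc (mkpt 0 w) 1) as [K _].
  - rewrite zof_mkpt, wof_mkpt. split; [apply Cmod_1|].
    rewrite (proj1 (H w)) by (left; reflexivity). rewrite ha, Cconj_0, dpow_0 by exact hp.
    split; ring.
  - apply K. rewrite zof_mkpt. unfold ddpow. destruct p as [|[|[|n]]]; try lia.
    replace (S (S (S n)) - 2)%nat with (S n) by lia. rewrite Cpow_S. ring.
Qed.

(* Cusps are isolated: along a component of the singular set on which
   [z^p + w^p = 0], every point would be degenerate. The components are
   separated by the ratio [z / w], whose power [p - 1] is fixed. *)
Lemma excellent_eq_exponents (x : Rn 4) : p = q -> a <> 0 -> b <> 0 ->
  is_cusp (Fmap p q a b) x -> (zof x ^ p + wof x ^ p)%C <> 0.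
Proof.
  intros e ha hb Hc H0.
  destruct (proj1 (is_cusp_iff p q a b hp hq exc x) Hc) as [u [[hu [Hz Hw]] _]].
  set (z := zof x) in *. set (w := wof x) in *.
  assert (hu0 : u <> 0) by (intros h; rewrite h, Cmod_0 in hu; lra).
  assert (hz : z <> 0).
  { apply (dpow_neq0_arg p z hp). rewrite Hz. apply Copp_neq0, Cmult_neq_0; [exact hu0|].
    apply Cconj_neq0, ha. }
  assert (hw : w <> 0).
  { apply (dpow_neq0_arg q w hq). rewrite Hw. apply Copp_neq0, Cmult_neq_0; [exact hu0|].
    apply Cconj_neq0, hb. }
  assert (mz : 0 < Cmod z) by (apply Cmod_gt_0, hz).
  assert (mw : 0 < Cmod w) by (apply Cmod_gt_0, hw).
  destruct (pow_roots (p - 1) 1) as [l [_ [_ Hl]]]; [lia|exact C1_nz|].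
  destruct (finite_isolated l 1) as [d [hd Hd]].
  (* If each real coordinate moves by less than [eps], then [z] and [w] move by less than [2 eps],
     and this value makes [|eta - 1| < d]. *)
  set (eps := d * (Cmod z * Cmod w) / (2 * (Cmod z + Cmod w))).
  assert (heps : eps > 0).
  { apply Rdiv_lt_0_compat; [|lra]. repeat apply Rmult_lt_0_compat; assumption. }
  destruct (folds_near_cusp p q a b x eps Hc heps) as [y [e2 [e3 [Hn [he2 [he3 Ht]]]]]].
  destruct (singular_type_fold p q a b _ _ 1 e2 e3 hp hq ltac:(lra) he2 he3 Ht)
    as [u' [[hu' [Hz' Hw']] Hdeg]].
  set (z' := zof y) in *. set (w' := wof y) in *.
  assert (hu0' : u' <> 0) by (intros h; rewrite h, Cmod_0 in hu'; lra).
  assert (hw' : w' <> 0).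
  { apply (dpow_neq0_arg q w' hq). rewrite Hw'. apply Copp_neq0, Cmult_neq_0; [exact hu0'|].
    apply Cconj_neq0, hb. }
  rewrite <- e in Hw, Hw'. unfold dpow in Hz, Hw, Hz', Hw'.
  pose proof (INR_C_neq0 p ltac:(lia)) as hI.
  assert (hIR : INR p <> 0) by (apply not_0_INR; lia).
  (* On the singular set [p |w|^(p-1) = |b|], so the modulus of [w] is constant. *)
  assert (Ew : Cmod w' = Cmod w).
  { apply (pow_inj_pos (p - 1)); [lia|apply Cmod_ge_0|apply Cmod_ge_0|].
    apply (f_equal Cmod) in Hw, Hw'. rewrite Cmod_opp, !Cmod_mult, Cmod_conj, Cmod_pow in Hw, Hw'.
    rewrite Cmod_R in Hw, Hw'. rewrite hu in Hw. rewrite hu' in Hw'.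
    apply Rmult_eq_reg_l with (Rabs (INR p)); [lra|apply Rabs_no_R0, hIR]. }
  (* The ratio of [z' / w'] to [z / w]; in its [(p - 1)]-th power [u] and [u'] cancel, so it is a
     root of unity. *)
  set (eta := (z' * w / (z * w'))%C).
  assert (Heta : eta = 1).
  { apply Hd.
    - apply Hl. unfold eta, Cdiv. rewrite Cpow_mult_l, Cpow_inv by (apply Cmult_neq_0; assumption).
      rewrite !Cpow_mult_l.
      assert (K1 : (z ^ (p - 1))%C = (- (u * Cconj a) / INR p)%C)
        by (rewrite <- Hz; field; exact hI).
      assert (K2 : (w ^ (p - 1))%C = (- (u * Cconj b) / INR p)%C)
        by (rewrite <- Hw; field; exact hI).
      assert (K3 : (z' ^ (p - 1))%C = (- (u' * Cconj a) / INR p)%C)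
        by (rewrite <- Hz'; field; exact hI).
      assert (K4 : (w' ^ (p - 1))%C = (- (u' * Cconj b) / INR p)%C)
        by (rewrite <- Hw'; field; exact hI).
      rewrite K1, K2, K3, K4. field. repeat split; auto using Cconj_neq0.
    - replace (eta - 1)%C with (((z' - z) * w - z * (w' - w)) / (z * w'))%C
        by (unfold eta; field; auto).
      rewrite Cmod_div by (apply Cmult_neq_0; assumption). rewrite Cmod_mult, Ew.
      assert (B1 : Cmod (z' - z) < 2 * eps).
      { eapply Rle_lt_trans; [apply Cmod_le_sum|].
        pose proof (Hn 0%nat ltac:(lia)). pose proof (Hn 1%nat ltac:(lia)).
        unfold z', z, zof; simpl. unfold Rminus in *. lra. }
      assert (B2 : Cmod (w' - w) < 2 * eps).
      { eapply Rle_lt_trans; [apply Cmod_le_sum|].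
        pose proof (Hn 2%nat ltac:(lia)). pose proof (Hn 3%nat ltac:(lia)).
        unfold w', w, wof; simpl. unfold Rminus in *. lra. }
      assert (B3 : Cmod ((z' - z) * w - z * (w' - w)) < d * (Cmod z * Cmod w)).
      { unfold Cminus at 1. eapply Rle_lt_trans; [apply Cmod_triangle|].
        rewrite Cmod_opp, !Cmod_mult.
        replace (d * (Cmod z * Cmod w)) with (2 * eps * Cmod w + Cmod z * (2 * eps))
          by (unfold eps; field; lra).
        apply Rplus_lt_compat; [apply Rmult_lt_compat_r|apply Rmult_lt_compat_l]; assumption. }
      apply Rmult_lt_reg_r with (Cmod z * Cmod w); [apply Rmult_lt_0_compat; assumption|].
      replace (Cmod ((z' - z) * w - z * (w' - w)) / (Cmod z * Cmod w) * (Cmod z * Cmod w))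
        with (Cmod ((z' - z) * w - z * (w' - w))) by (field; lra). exact B3. }
  assert (Ezw : (z' = z * w' / w)%C).
  { replace z' with (eta * (z * w') / w)%C by (unfold eta; field; auto).
    rewrite Heta. field. exact hw. }
  (* Since [(z', w')] is a multiple of [(z, w)], also [z'^p + w'^p = 0]; for [p = q] this makes
     [cuspG] vanish, against nondegeneracy of the fold. *)
  apply Hdeg. replace (cuspG p q z' w') with (RtoC 0); [rewrite Cconj_0; ring|].
  unfold cuspG. rewrite <- e. rewrite Ezw. unfold Cdiv.
  rewrite Cpow_mult_l, Cpow_inv by exact hw. rewrite Cpow_mult_l.
  assert (K : (z ^ p)%C = (- w ^ p)%C).
  { replace (z ^ p)%C with ((z ^ p + w ^ p) - w ^ p)%C by ring. rewrite H0. ring. }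
  rewrite K. field. apply Cpow_nz, hw.
Qed.

End ExcellentCoeffs.

(** * Zeros of sums of two cosines *)

(** Each sign change yields a zero strictly between consecutive sample points, so the zeros are
    distinct. *)
Lemma alternating_zeros (f : R -> R) (x0 h : R) (n : nat) :
  continuity f -> 0 < h ->
  (forall k, (k < n)%nat -> f (x0 + INR k * h) * f (x0 + INR (S k) * h) < 0) ->
  exists l, NoDup l /\ length l = n /\
    forall x, In x l -> x0 <= x < x0 + INR n * h /\ f x = 0.
Proof.
  intros Hc hh. induction n as [|n IH]; intros H.
  - exists nil. split; [constructor|]. split; [reflexivity|intros x []].
  - destruct IH as [l [Hl [Hn Hz]]]; [intros k hk; apply H; lia|].
    specialize (H n ltac:(lia)). rewrite S_INR in *.
    pose proof (pos_INR n) as hn0.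
    destruct (IVT_cor f (x0 + INR n * h) (x0 + (INR n + 1) * h) Hc) as [x [hx fx]]; [lra|lra|].
    assert (x <> x0 + INR n * h) by (intros e; rewrite <- e, fx in H; lra).
    assert (x <> x0 + (INR n + 1) * h) by (intros e; rewrite <- e, fx in H; lra).
    exists (x :: l). split; [|split; [simpl; lia|]].
    + constructor; [|exact Hl]. intros hin. destruct (Hz x hin) as [[_ h1] _]. lra.
    + intros y [<-|hy]; [split; [nra|exact fx]|].
      destruct (Hz y hy) as [h1 h2]. split; [nra|exact h2].
Qed.

Lemma sin_INR_PI (k : nat) : sin (INR k * PI) = 0.
Proof.
  induction k as [|k IH]; [simpl; rewrite Rmult_0_l; apply sin_0|].
  rewrite S_INR, Rmult_plus_distr_r, Rmult_1_l, neg_sin, IH. ring.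
Qed.

Lemma continuity_cos_affine (Y c s : R) : continuity (fun x => Y * cos (c + s * x)).
Proof.
  apply continuity_scal with (f := fun x => cos (c + s * x)).
  apply (continuity_comp (fun x => c + s * x) cos); [|apply continuity_cos].
  apply derivable_continuous. intros x. apply derivable_pt_plus; [apply derivable_pt_const|].
  apply derivable_pt_mult; [apply derivable_pt_const|apply derivable_pt_id].
Qed.

(** At [x_k = (2 pi k - 2 c) / m] the cosine is [(-1)^k], and a perturbation bounded by [Y < X]
    cannot change the sign. The [m] steps of length [2 pi / m] fill an interval of length [2 pi]. *)
Lemma perturbed_cos_zeros (X Y c : R) (g : R -> R) (m : nat) :
  Y < X -> (0 < m)%nat -> continuity g -> (forall x, Rabs (g x) <= Y) ->
  exists x0 l, NoDup l /\ length l = m /\ forall x, In x l ->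
    x0 <= x < x0 + 2 * PI /\ X * cos (c + INR m / 2 * x) + g x = 0.
Proof.
  intros hXY hm Hg HY.
  assert (hM : 0 < INR m) by (apply lt_0_INR, hm).
  pose proof PI_RGT_0 as hpi.
  exists (- 2 * c / INR m).
  destruct (alternating_zeros (fun x => X * cos (c + INR m / 2 * x) + g x)
    (- 2 * c / INR m) (2 * PI / INR m) m) as [l [Hl [Hn Hz]]].
  - apply continuity_plus with (f1 := fun x => X * cos (c + INR m / 2 * x)); [apply continuity_cos_affine|exact Hg].
  - apply Rdiv_lt_0_compat; lra.
  - intros k _.
    replace (c + INR m / 2 * (-2 * c / INR m + INR k * (2 * PI / INR m)))
      with (INR k * PI) by (field; lra).
    replace (c + INR m / 2 * (-2 * c / INR m + INR (S k) * (2 * PI / INR m)))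
      with (INR k * PI + PI) by (rewrite S_INR; field; lra).
    rewrite neg_cos.
    generalize (-2 * c / INR m + INR k * (2 * PI / INR m)) (-2 * c / INR m + INR (S k) * (2 * PI / INR m)).
    intros s t. 
    assert (hs : - Y <= g s <= Y)
      by (pose proof (HY s) as K; revert K; unfold Rabs; destruct (Rcase_abs (g s)); lra).
    assert (ht : - Y <= g t <= Y)
      by (pose proof (HY t) as K; revert K; unfold Rabs; destruct (Rcase_abs (g t)); lra).
    assert (E : cos (INR k * PI) = 1 \/ cos (INR k * PI) = - 1).
    { pose proof (sin2_cos2 (INR k * PI)) as K. rewrite sin_INR_PI in K. unfold Rsqr in K.
      assert (K' : (cos (INR k * PI) - 1) * (cos (INR k * PI) + 1) = 0) by lra.
      apply Rmult_integral in K'. lra. }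
    destruct E as [E|E]; rewrite E; nra.
  - exists l. split; [exact Hl|]. split; [exact Hn|]. intros x hx.
    destruct (Hz x hx) as [h1 h2]. split; [|exact h2].
    replace (INR m * (2 * PI / INR m)) with (2 * PI) in h1 by (field; lra). exact h1.
Qed.

Lemma Rabs_cos_le (Y t : R) : 0 < Y -> Rabs (Y * cos t) <= Y.
Proof.
  intros hY. pose proof (COS_bound t). rewrite Rabs_mult, (Rabs_pos_eq Y) by lra.
  assert (Rabs (cos t) <= 1) by (apply Rabs_le; lra). nra.
Qed.

(* If [X = Y] the sum is a product of cosines; otherwise the larger term decides
   the sign at its extrema. *)
Lemma two_cos_zeros (X Y c c' : R) (m k : nat) :
  0 < X -> 0 < Y -> (0 < m)%nat ->
  exists x0 l, NoDup l /\ (m <= length l)%nat /\ forall x, In x l ->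
    x0 <= x < x0 + 2 * PI /\
    X * cos (c + INR m / 2 * x) + Y * cos (c' + INR (m + 2 * k) / 2 * x) = 0.
Proof.
  intros hX hY hm. destruct (Rtotal_order X Y) as [h|[h|h]].
  (* The faster cosine dominates and gives even [m + 2 k] zeros. *)
  - destruct (perturbed_cos_zeros Y X c' (fun x => X * cos (c + INR m / 2 * x)) (m + 2 * k))
      as [x0 [l [Hl [Hn Hz]]]]; [exact h|lia|apply continuity_cos_affine|
        intros x; apply Rabs_cos_le, hX|].
    exists x0, l. split; [exact Hl|]. split; [lia|]. intros x hx.
    destruct (Hz x hx) as [h1 h2]. split; [exact h1|]. rewrite Rplus_comm. exact h2.
  (* For [X = Y] the factor of mean frequency [(m + k) / 2] provides the zeros. *)
  - destruct (perturbed_cos_zeros 1 0 ((c + c') / 2) (fun _ => 0) (m + k))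
      as [x0 [l [Hl [Hn Hz]]]]; [lra|lia|apply continuity_const; intros ? ?; reflexivity|
        intros x; rewrite Rabs_R0; lra|].
    exists x0, l. split; [exact Hl|]. split; [lia|]. intros x hx.
    destruct (Hz x hx) as [h1 h2]. split; [exact h1|]. subst Y.
    rewrite <- Rmult_plus_distr_l, form1.
    replace ((c + INR m / 2 * x + (c' + INR (m + 2 * k) / 2 * x)) / 2)
      with ((c + c') / 2 + INR (m + k) / 2 * x)
      by (rewrite !plus_INR, mult_INR; simpl (INR 2); field).
    replace (cos ((c + c') / 2 + INR (m + k) / 2 * x)) with 0 by lra. ring.
  - destruct (perturbed_cos_zeros X Y c (fun x => Y * cos (c' + INR (m + 2 * k) / 2 * x)) m)
      as [x0 [l [Hl [Hn Hz]]]]; [exact h|lia|apply continuity_cos_affine|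
        intros x; apply Rabs_cos_le, hY|].
    exists x0, l. split; [exact Hl|]. split; [lia|]. exact Hz.
Qed.

(** * Counting the solutions of the cusp equations *)

Lemma relation_count {A B : Type} (Rl : A -> B -> Prop) (lo hi : nat) (lA : list A) :
  NoDup lA ->
  (forall x, In x lA -> exists l, NoDup l /\ (lo <= length l <= hi)%nat /\
     forall y, In y l <-> Rl x y) ->
  exists L : list (A * B), NoDup L /\
    (length lA * lo <= length L <= length lA * hi)%nat /\
    forall x y, In (x, y) L <-> In x lA /\ Rl x y.
Proof.
  intros Hnd. induction Hnd as [|x0 lA hx0 Hnd IH]; intros H.
  - exists nil. split; [constructor|]. split; [simpl; lia|]. intros x y. simpl. tauto.
  - destruct IH as [L [HL [Hn HL']]]; [intros x hx; apply H; right; exact hx|].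
    destruct (H x0) as [l [Hl [Hm Hl']]]; [left; reflexivity|].
    exists (map (pair x0) l ++ L). split; [|split].
    + apply NoDup_app; [|exact HL|].
      * apply NoDup_map_in; [exact Hl|]. intros y y' _ _ E. congruence.
      * intros [x y] h h'. apply in_map_iff in h. destruct h as [y' [E _]].
        apply HL' in h'. destruct h' as [h' _]. congruence.
    + rewrite length_app, length_map. simpl. lia.
    + intros x y. rewrite in_app_iff, in_map_iff, HL'. simpl. split.
      * intros [[y' [E hy]]|[h1 h2]]; [|auto].
        injection E as <- <-. split; [auto|apply Hl', hy].
      * intros [[<-|h1] h2]; [|auto]. left. exists y. split; [reflexivity|apply Hl', h2].
Qed.

(** Double counting: the pairs [(f x, x)] are counted fibre by fibre over [S], and project
    bijectively onto [lT]. *)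
Lemma covering_count {A B : Type} (decB : forall x y : B, {x = y} + {x <> y})
  (f : A -> B) (lT : list A) (S : B -> Prop) (n : nat) :
  (0 < n)%nat -> NoDup lT -> (forall x, In x lT -> S (f x)) ->
  (forall y, S y -> exists l, NoDup l /\ length l = n /\
     forall x, In x l <-> In x lT /\ f x = y) ->
  exists lS, NoDup lS /\ (forall y, In y lS <-> S y) /\ (length lS * n)%nat = length lT.
Proof.
  intros hn HT HS Hf. set (lS := nodup decB (map f lT)).
  assert (Hin : forall y, In y lS <-> S y).
  { intros y. unfold lS. rewrite nodup_In, in_map_iff. split.
    - intros [x [<- hx]]. apply HS, hx.
    - intros hy. destruct (Hf y hy) as [l [_ [Hl H]]].
      destruct l as [|x l]; [simpl in Hl; lia|].
      destruct (proj1 (H x) (or_introl eq_refl)) as [h1 h2]. exists x. auto. }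
  exists lS. split; [apply NoDup_nodup|]. split; [exact Hin|].
  destruct (relation_count (fun y x => In x lT /\ f x = y) n n lS) as [L [HL [Hlen HL']]].
  { apply NoDup_nodup. }
  { intros y hy. apply Hin in hy. destruct (Hf y hy) as [l [h1 [h2 h3]]].
    exists l. split; [exact h1|]. split; [lia|exact h3]. }
  assert (Hmap : NoDup (map snd L)).
  { apply NoDup_map_in; [exact HL|]. intros [y x] [y' x'] h h' E. simpl in E. subst x'.
    apply HL' in h, h'. f_equal. destruct h as [_ [_ <-]], h' as [_ [_ <-]]. reflexivity. }
  assert (L1 : (length (map snd L) <= length lT)%nat).
  { apply NoDup_incl_length; [exact Hmap|]. intros x hx. apply in_map_iff in hx.
    destruct hx as [[y x'] [E h]]. simpl in E. subst x'. apply HL' in h. tauto. }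
  assert (L2 : (length lT <= length (map snd L))%nat).
  { apply NoDup_incl_length; [exact HT|]. intros x hx. apply in_map_iff.
    exists (f x, x). split; [reflexivity|]. apply HL'. split; [|auto].
    apply Hin, HS, hx. }
  rewrite length_map in L1, L2. lia.
Qed.

Lemma dpow_mult (p : nat) (z t : C) : dpow p (z * t) = (dpow p z * t ^ (p - 1))%C.
Proof. unfold dpow. rewrite Cpow_mult_l. ring. Qed.

Lemma Cmod_dpow (p : nat) (z : C) : Cmod (dpow p z) = INR p * Cmod z ^ (p - 1).
Proof.
  unfold dpow. rewrite Cmod_mult, Cmod_pow, Cmod_R, Rabs_pos_eq by apply pos_INR. reflexivity.
Qed.

Lemma dpow_Cmod_inj (p : nat) (z z' : C) : (2 <= p)%nat ->
  Cmod (dpow p z) = Cmod (dpow p z') -> Cmod z = Cmod z'.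
Proof.
  intros hp E. rewrite !Cmod_dpow in E. apply (pow_inj_pos (p - 1)); try apply Cmod_ge_0; [lia|].
  apply Rmult_eq_reg_l with (INR p); [exact E|]. apply not_0_INR; lia.
Qed.

Lemma Cmod_unit_pow (y : C) (n : nat) : Cmod y = 1 -> Cmod (y ^ n) = 1.
Proof. intros h. rewrite Cmod_pow, h. apply pow1. Qed.

Lemma unit_neq0 (y : C) : Cmod y = 1 -> y <> 0.
Proof. intros h e. rewrite e, Cmod_0 in h. lra. Qed.

Lemma Cmod_singular (u c : C) : Cmod u = 1 -> Cmod (- (u * Cconj c)) = Cmod c.
Proof. intros h. rewrite Cmod_opp, Cmod_mult, Cmod_conj, h. ring. Qed.

(** The case of one vanishing coefficient. From a fixed root [zt] the first equation is solved by
    [z = zt y], [u = y^(p-1)], [|y| = 1], and the second becomes the binomial equation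
    [y^(p+1) = k]. As [|k| = 1], all its [p + 1] roots lie on the circle. *)
Lemma single_count (p : nat) (a : C) : (2 <= p)%nat -> a <> 0 ->
  exists l, NoDup l /\ length l = (p + 1)%nat /\ forall z, In z l <->
    exists u : C, Cmod u = 1 /\ dpow p z = (- (u * Cconj a))%C /\ (z ^ p + u * Cconj (z ^ p))%C = 0.
Proof.
  intros hp ha.
  destruct (dpow_roots p (- Cconj a)%C hp) as [lr [_ [Hr Hroot]]]; [apply Copp_neq0, Cconj_neq0, ha|].
  destruct lr as [|zt lr]; [simpl in Hr; lia|].
  assert (Hzt : dpow p zt = (- Cconj a)%C) by (apply Hroot; left; reflexivity). clear lr Hr Hroot.
  assert (hzt : zt <> 0).
  { apply (dpow_neq0_arg p zt hp). rewrite Hzt. apply Copp_neq0, Cconj_neq0, ha. }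
  assert (hztp : (zt ^ p)%C <> 0) by apply Cpow_nz, hzt.
  set (k := (- Cconj (zt ^ p) / zt ^ p)%C).
  assert (hk : k <> 0).
  { intros h. apply (Copp_neq0 _ (Cconj_neq0 _ hztp)).
    replace (- Cconj (zt ^ p))%C with (k * zt ^ p)%C by (unfold k; field; exact hztp).
    rewrite h. ring. }
  assert (mk : Cmod k = 1).
  { unfold k. rewrite Cmod_div by exact hztp. rewrite Cmod_opp, Cmod_conj. field.
    apply Rgt_not_eq, Cmod_gt_0, hztp. }
  destruct (pow_roots (p + 1) k) as [l [Hl [Hn H]]]; [lia|exact hk|].
  (* Multiplying by [y] removes the conjugate of [y], since [y^p conj(y)^p = 1]. *)
  assert (key : forall y, Cmod y = 1 ->
    (y * ((zt * y) ^ p + y ^ (p - 1) * Cconj ((zt * y) ^ p)))%C = (zt ^ p * (y ^ (p + 1) - k))%C).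
  { intros y hy. pose proof (Cmod1_conj y hy) as E.
    assert (Ep : (y ^ p * Cconj y ^ p)%C = 1) by (rewrite <- Cpow_mult_l, E; apply Cpow_1_l).
    rewrite Cpow_mult_l, Cmult_conj, (Cpow_conj y).
    replace (zt ^ p * (y ^ (p + 1) - k))%C with (zt ^ p * y ^ (p + 1) + Cconj (zt ^ p))%C
      by (unfold k; field; exact hztp).
    replace (y * (zt ^ p * y ^ p + y ^ (p - 1) * (Cconj (zt ^ p) * Cconj y ^ p)))%C
      with (zt ^ p * (y ^ p * y ^ 1) + Cconj (zt ^ p) * ((y ^ (p - 1) * y ^ 1) * Cconj y ^ p))%C
      by (rewrite Cpow_1_r; ring).
    rewrite <- !Cpow_add_r. replace (p - 1 + 1)%nat with p by lia. rewrite Ep. ring. }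
  exists (map (fun y => zt * y)%C l). split; [|split].
  - apply NoDup_map_in; [exact Hl|]. intros y y' _ _ E.
    replace y with (zt * y / zt)%C by (field; exact hzt). rewrite E. field. exact hzt.
  - rewrite length_map. exact Hn.
  - intros z. rewrite in_map_iff. split.
    + intros [y [<- hy]]. apply H in hy.
      assert (my : Cmod y = 1).
      { apply (pow_inj_pos (p + 1)); [lia|apply Cmod_ge_0|lra|].
        rewrite <- Cmod_pow, hy, mk, pow1. reflexivity. }
      exists (y ^ (p - 1))%C. split; [apply Cmod_unit_pow, my|]. split.
      * rewrite dpow_mult, Hzt. ring.
      * specialize (key y my). rewrite hy in key.
        replace (zt ^ p * (k - k))%C with (RtoC 0) in key by ring.
        apply Cmult_integral in key. destruct key as [key|key]; [|exact key].
        exfalso. exact (unit_neq0 y my key).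
    + intros [u [hu [Hz Hu]]]. exists (z / zt)%C. set (y := (z / zt)%C).
      assert (Ez : (zt * y)%C = z) by (unfold y; field; exact hzt).
      split; [exact Ez|]. apply H.
      assert (my : Cmod y = 1).
      { unfold y. rewrite Cmod_div by exact hzt.
        rewrite (dpow_Cmod_inj p z zt hp).
        - field. apply Rgt_not_eq, Cmod_gt_0, hzt.
        - rewrite Hz, Hzt, Cmod_singular, Cmod_opp, Cmod_conj by exact hu. reflexivity. }
      assert (Eu : u = (y ^ (p - 1))%C).
      { rewrite <- Ez, dpow_mult, Hzt in Hz. pose proof (Cconj_neq0 a ha) as ha'.
        replace u with (- - (u * Cconj a) / Cconj a)%C by (field; exact ha').
        rewrite <- Hz. field. exact ha'. }
      specialize (key y my). rewrite Ez, <- Eu, Hu, Cmult_0_r in key.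
      symmetry in key. apply Cmult_integral in key. destruct key as [key|key]; [contradiction|].
      apply Ceq_minus, key.
Qed.

Section Covering.
Context (p q : nat) (a b w0 : C) (hq : (2 <= q)%nat) (hqp : (q <= p)%nat).
Context (ha : a <> 0) (hb : b <> 0) (Hw0 : dpow q w0 = (- Cconj b)%C).

(* The singular set is the image, [(p - 1)]-to-one, of the circles
   [{zt} x {|y| = 1}] with [dpow p zt = - conj a]. *)
Definition cover (x : C * C) : C * C :=
  (fst x * snd x ^ (q - 1), w0 * snd x ^ (p - 1))%C.

Definition on_cover (zt y : C) : Prop :=
  Cmod y = 1 /\
  (cuspG p q (zt * y ^ (q - 1)) (w0 * y ^ (p - 1))
   + y ^ ((p - 1) * (q - 1)) * Cconj (cuspG p q (zt * y ^ (q - 1)) (w0 * y ^ (p - 1))))%C = 0.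

Lemma cover_root_neq0 : w0 <> 0.
Proof. apply (dpow_neq0_arg q w0 hq). rewrite Hw0. apply Copp_neq0, Cconj_neq0, hb. Qed.

Lemma root_a_neq0 (zt : C) : dpow p zt = (- Cconj a)%C -> zt <> 0.
Proof.
  intros H. apply (dpow_neq0_arg p zt ltac:(lia)). rewrite H. apply Copp_neq0, Cconj_neq0, ha.
Qed.

Lemma cuspG_cover (zt y : C) :
  cuspG p q (zt * y ^ (q - 1)) (w0 * y ^ (p - 1))
  = (INR p * INR (q - 1) * zt ^ p * y ^ (p * (q - 1))
     + INR q * INR (p - 1) * w0 ^ q * y ^ (q * (p - 1)))%C.
Proof.
  unfold cuspG. rewrite !Cpow_mult_l, <- !Cpow_mult_r.
  rewrite (Nat.mul_comm (q - 1) p), (Nat.mul_comm (p - 1) q). ring.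
Qed.

(** On the circle [conj y = 1 / y]; multiplying by [y^(p-1)] clears the negative powers. At 0 the
    resulting polynomial takes the value [conj g2] if [p > q], and [conj (g1 + g2)] if [p = q],
    where it is nonzero by the hypothesis on [zt^p + w0^p]. *)
Lemma on_cover_upper (zt : C) (l : list C) :
  dpow p zt = (- Cconj a)%C -> (p = q -> (zt ^ p + w0 ^ p)%C <> 0) ->
  NoDup l -> (forall y, In y l -> on_cover zt y) -> (length l <= (p - 1) * (q + 1))%nat.
Proof.
  intros Hzt Hnd Hl H.
  set (g1 := (INR p * INR (q - 1) * zt ^ p)%C). set (g2 := (INR q * INR (p - 1) * w0 ^ q)%C).
  set (P := (q - 1)%nat). set (Q := (p - 1)%nat).
  assert (g20 : g2 <> 0).
  { unfold g2. repeat apply Cmult_neq_0; try (apply INR_C_neq0; lia).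
    apply Cpow_nz, cover_root_neq0. }
  apply (poly_fun_roots _ (fun y => g1 * y ^ (Q * P + P + Q) + g2 * y ^ (Q * P + Q + Q)
     + (Cconj g1 * y ^ (Q - P) + Cconj g2 * y ^ 0))%C l 0); [| |exact Hl|].
  - replace ((p - 1) * (q + 1))%nat with (Q * P + Q + Q)%nat by (unfold P, Q; nia).
    repeat apply poly_fun_plus; apply poly_fun_monomial; unfold P, Q; nia.
  - assert (Z : forall n, (0 < n)%nat -> (0 ^ n)%C = 0).
    { intros [|n] h; [lia|]. rewrite Cpow_S. ring. }
    rewrite (Z (Q * P + P + Q)%nat), (Z (Q * P + Q + Q)%nat) by (unfold P, Q; nia).
    simpl (_ ^ 0)%C. destruct (Nat.eq_dec p q) as [e|e].
    + replace (Q - P)%nat with 0%nat by (unfold P, Q; lia). simpl (_ ^ 0)%C.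
      intros K. apply (Hnd e).
      assert (K' : (g1 + g2)%C = 0).
      { rewrite <- (Cconj_conj (g1 + g2)), Cplus_conj.
        replace (Cconj g1 + Cconj g2)%C with (g1 * 0 + g2 * 0 + (Cconj g1 * 1 + Cconj g2 * 1))%C by ring.
        rewrite K. apply Cconj_0. }
      unfold g1, g2 in K'. rewrite <- e in K'.
      replace (INR p * INR (p - 1) * zt ^ p + INR p * INR (p - 1) * w0 ^ p)%C
        with ((INR p * INR (p - 1)) * (zt ^ p + w0 ^ p))%C in K' by ring.
      apply Cmult_integral in K'. destruct K' as [K'|K']; [|exact K'].
      exfalso. apply Cmult_integral in K'. destruct K' as [K'|K']; revert K'; apply INR_C_neq0; lia.
    + rewrite (Z (Q - P)%nat) by (unfold P, Q; lia). intros K.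
      apply (Cconj_neq0 g2 g20).
      replace (Cconj g2) with (g1 * 0 + g2 * 0 + (Cconj g1 * 0 + Cconj g2 * 1))%C by ring.
      exact K.
  - intros y hy. destruct (H y hy) as [my E]. rewrite cuspG_cover in E. fold g1 g2 P Q in E.
    pose proof (Cmod1_conj y my) as Ey.
    assert (En : forall n, (y ^ n * Cconj y ^ n)%C = 1)
      by (intros n; rewrite <- Cpow_mult_l, Ey; apply Cpow_1_l).
    replace (p * P)%nat with (Q * P + P)%nat in E by (unfold P, Q; nia).
    replace (q * Q)%nat with (Q * P + Q)%nat in E by (unfold P, Q; nia).
    rewrite Cplus_conj, !Cmult_conj, !(Cpow_conj y) in E.
    transitivity (y ^ Q * 0)%C; [|ring]. rewrite <- E.
    replace (Q * P + Q)%nat with ((Q * P + P) + (Q - P))%nat at 1 2 by (unfold P, Q; nia).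
    replace (Q * P + P + Q)%nat with (Q + (Q * P + P))%nat by lia.
    replace (Q * P + P + (Q - P) + Q)%nat with (Q + (Q * P + Q))%nat by (unfold P, Q; nia).
    replace (Q * P + P + (Q - P))%nat with (Q * P + Q)%nat by (unfold P, Q; nia).
    rewrite !(Cpow_add_r y Q).
    transitivity (y ^ Q * (g1 * y ^ (Q * P + P) + g2 * y ^ (Q * P + Q))
      + Cconj g1 * ((y ^ (Q * P + P) * Cconj y ^ (Q * P + P)) * y ^ (Q - P))
      + Cconj g2 * (y ^ (Q * P + Q) * Cconj y ^ (Q * P + Q)))%C.
    + rewrite !En. simpl (_ ^ 0)%C. ring.
    + assert (E1 : (y ^ (Q * P) * y ^ Q)%C = (y ^ (Q * P + P) * y ^ (Q - P))%C)
        by (rewrite <- !Cpow_add_r; f_equal; unfold P, Q; nia).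
      assert (E2 : (y ^ (Q * P) * y ^ Q)%C = (y ^ (Q * P + Q))%C)
        by (rewrite <- !Cpow_add_r; reflexivity).
      transitivity (y ^ Q * (g1 * y ^ (Q * P + P) + g2 * y ^ (Q * P + Q))
        + Cconj g1 * ((y ^ (Q * P + P) * y ^ (Q - P)) * Cconj y ^ (Q * P + P))
        + Cconj g2 * (y ^ (Q * P + Q) * Cconj y ^ (Q * P + Q)))%C; [ring|].
      rewrite <- E1. rewrite <- E2 at 2.
      unfold g1, g2. rewrite !Cmult_conj. ring.
Qed.

(** For [y = e^(ix)] and [N = (p-1)(q-1)], the number [e^(-iNx/2)] plays the role of [al].
    Multiplying by it lowers the frequencies [p(q-1)] and [q(p-1)] by [N/2], to half of [(p+1)(q-1)]
    and half of [(p-1)(q+1)]. *)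
Lemma on_cover_lower (zt : C) : dpow p zt = (- Cconj a)%C ->
  exists l, NoDup l /\ ((p + 1) * (q - 1) <= length l)%nat /\ forall y, In y l -> on_cover zt y.
Proof.
  intros Hzt.
  destruct (polar zt) as [th Eth]. destruct (polar w0) as [om Eom].
  assert (mz : 0 < Cmod zt) by apply Cmod_gt_0, (root_a_neq0 zt Hzt).
  assert (mw : 0 < Cmod w0) by apply Cmod_gt_0, cover_root_neq0.
  set (r := Cmod zt) in *. set (s := Cmod w0) in *.
  set (X := INR p * INR (q - 1) * r ^ p). set (Y := INR q * INR (p - 1) * s ^ q).
  assert (hX : 0 < X).
  { unfold X. repeat apply Rmult_lt_0_compat; try (apply lt_0_INR; lia). apply pow_lt, mz. }
  assert (hY : 0 < Y).
  { unfold Y. repeat apply Rmult_lt_0_compat; try (apply lt_0_INR; lia). apply pow_lt, mw. }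
  destruct (two_cos_zeros X Y (INR p * th) (INR q * om) ((p + 1) * (q - 1)) (p - q) hX hY)
    as [x0 [l [Hl [Hn Hz]]]]; [nia|].
  exists (map ei l). split; [|split].
  - apply NoDup_map_in; [exact Hl|]. intros x y hx hy. apply (ei_inj x0); apply Hz; assumption.
  - rewrite length_map. exact Hn.
  - intros y hy. apply in_map_iff in hy. destruct hy as [x [<- hx]].
    split; [apply Cmod_ei|]. apply Hz in hx. destruct hx as [_ hx].
    rewrite cuspG_cover, !ei_pow.
    set (N := INR ((p - 1) * (q - 1))).
    assert (h0 : ei (- (N / 2 * x)) <> 0) by (apply unit_neq0, Cmod_ei).
    apply (Re_mult_eq0 (ei (- (N / 2 * x)))); [exact h0| |].
    { rewrite Cconj_ei, <- ei_plus. f_equal. field. }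
    rewrite Eth, Eom, !Cpow_mult_l, !ei_pow, <- !RtoC_pow.
    replace (ei (- (N / 2 * x)) * _)%C with
      (X * ei (INR p * th + INR ((p + 1) * (q - 1)) / 2 * x)
       + Y * ei (INR q * om + INR ((p + 1) * (q - 1) + 2 * (p - q)) / 2 * x))%C.
    { rewrite re_plus, !re_scal_l. exact hx. }
    replace (INR p * th + INR ((p + 1) * (q - 1)) / 2 * x)
      with (- (N / 2 * x) + (INR p * th + INR (p * (q - 1)) * x)).
    2: { assert (E : INR ((p + 1) * (q - 1)) = 2 * INR (p * (q - 1)) - N).
         { unfold N. rewrite <- (mult_INR 2). rewrite <- minus_INR by nia. f_equal. nia. }
         rewrite E. field. }
    replace (INR q * om + INR ((p + 1) * (q - 1) + 2 * (p - q)) / 2 * x)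
      with (- (N / 2 * x) + (INR q * om + INR (q * (p - 1)) * x)).
    2: { assert (E : INR ((p + 1) * (q - 1) + 2 * (p - q)) = 2 * INR (q * (p - 1)) - N).
         { unfold N. rewrite <- (mult_INR 2). rewrite <- minus_INR by nia. f_equal. nia. }
         rewrite E. field. }
    rewrite !ei_plus. unfold X, Y. rewrite !RtoC_mult. ring.
Qed.

Lemma on_cover_count (zt : C) :
  dpow p zt = (- Cconj a)%C -> (p = q -> (zt ^ p + w0 ^ p)%C <> 0) ->
  exists l, NoDup l /\ ((p + 1) * (q - 1) <= length l <= (p - 1) * (q + 1))%nat /\
    forall y, In y l <-> on_cover zt y.
Proof.
  intros Hzt Hnd.
  destruct (finite_complete (on_cover zt) ((p - 1) * (q + 1))) as [l [Hl H]].
  { intros l Hl H. apply (on_cover_upper zt l); assumption. }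
  exists l. split; [exact Hl|]. split; [|exact H]. split.
  - destruct (on_cover_lower zt Hzt) as [l' [Hl' [Hn H']]].
    eapply Nat.le_trans; [exact Hn|]. apply NoDup_incl_length; [exact Hl'|].
    intros y hy. apply H, H', hy.
  - apply (on_cover_upper zt l); auto. intros y hy. apply H, hy.
Qed.

Lemma cover_singular (zt y : C) : dpow p zt = (- Cconj a)%C -> Cmod y = 1 ->
  singular_at p q a b (zt * y ^ (q - 1)) (w0 * y ^ (p - 1)) (y ^ ((p - 1) * (q - 1))).
Proof.
  intros Hzt my. split; [apply Cmod_unit_pow, my|].
  rewrite !dpow_mult, Hzt, Hw0, <- !Cpow_mult_r, (Nat.mul_comm (q - 1)). split; ring.
Qed.

(** A cusp [(z, w)] lifts to the pairs [(z / y^(q-1), y)] with [y^(p-1) = w / w0], so the total over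
    all circles is [p - 1] times the number of cusps. *)
Lemma cusp_count :
  (forall z w, cusp_eqs p q a b z w -> p = q -> (z ^ p + w ^ p)%C <> 0) ->
  exists l, NoDup l /\ ((p + 1) * (q - 1) <= length l <= (p - 1) * (q + 1))%nat /\
    forall x, In x l <-> cusp_eqs p q a b (fst x) (snd x).
Proof.
  intros Hnd.
  assert (hp : (2 <= p)%nat) by lia.
  destruct (dpow_roots p (- Cconj a)%C hp) as [lr [Hlr [Hlen Hroot]]];
    [apply Copp_neq0, Cconj_neq0, ha|].
  destruct (relation_count on_cover ((p + 1) * (q - 1)) ((p - 1) * (q + 1)) lr Hlr)
    as [lT [HT [HTn HTin]]].
  { intros zt hzt. apply Hroot in hzt. apply (on_cover_count zt hzt).
    (* The lower bound puts a cusp on this circle; there [z^p + w^p] is [zt^p + w0^p] times a power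
       of [y], so the hypothesis at that cusp settles the whole circle. *)
    intros e. destruct (on_cover_lower zt hzt) as [l [_ [Hn Hl]]].
    destruct l as [|y l]; [simpl in Hn; nia|].
    destruct (Hl y (or_introl eq_refl)) as [my Ey].
    intros K. apply (Hnd _ _ (ex_intro _ _ (conj (cover_singular zt y hzt my) Ey)) e).
    rewrite !Cpow_mult_l, <- e.
    replace (zt ^ p * (y ^ (p - 1)) ^ p + w0 ^ p * (y ^ (p - 1)) ^ p)%C
      with ((zt ^ p + w0 ^ p) * (y ^ (p - 1)) ^ p)%C by ring.
    rewrite K. ring. }
  destruct (covering_count (fun x y : C * C => ltac:(decide equality; apply Ceq_dec))
    cover lT (fun x => cusp_eqs p q a b (fst x) (snd x)) (p - 1)) as [lS [HS [HSin HSn]]].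
  - lia.
  - exact HT.
  - intros [zt y] h. apply HTin in h. destruct h as [h [my Ey]]. apply Hroot in h.
    exists (y ^ ((p - 1) * (q - 1)))%C. split; [apply cover_singular; assumption|exact Ey].
  - intros [z w] [u [[hu [Hz Hw]] HG]]. simpl fst in *. simpl snd in *.
    pose proof cover_root_neq0 as hw0.
    assert (Ew : Cmod w = Cmod w0).
    { apply (dpow_Cmod_inj q); [exact hq|].
      rewrite Hw, Hw0, Cmod_singular, Cmod_opp, Cmod_conj by exact hu. reflexivity. }
    assert (mw : Cmod (w / w0) = 1).
    { rewrite Cmod_div, Ew by exact hw0. field. apply Rgt_not_eq, Cmod_gt_0, hw0. }
    destruct (pow_roots (p - 1) (w / w0)%C) as [ly [Hly [Hlyn Hy]]]; [lia|apply unit_neq0, mw|].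
    exists (map (fun y => (z / y ^ (q - 1), y)%C) ly). split; [|split].
    + apply NoDup_map_in; [exact Hly|]. intros y y' _ _ E. congruence.
    + rewrite length_map. exact Hlyn.
    + intros [zt y]. rewrite in_map_iff, HTin, Hroot. unfold cover; simpl fst; simpl snd. split.
      * intros [y' [E hy]]. injection E as E1 E2. subst y' zt. apply Hy in hy.
        assert (my : Cmod y = 1).
        { apply (pow_inj_pos (p - 1)); [lia|apply Cmod_ge_0|lra|].
          rewrite <- Cmod_pow, hy, mw, pow1. reflexivity. }
        assert (hyq : (y ^ (q - 1))%C <> 0) by (apply Cpow_nz, unit_neq0, my).
        assert (Ez : (z / y ^ (q - 1) * y ^ (q - 1))%C = z) by (field; exact hyq).
        assert (Ew' : (w0 * y ^ (p - 1))%C = w) by (rewrite hy; field; exact hw0).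
        assert (Eu : u = (y ^ ((p - 1) * (q - 1)))%C).
        { rewrite <- Ew', dpow_mult, Hw0, <- Cpow_mult_r in Hw.
          pose proof (Cconj_neq0 b hb) as hb'.
          replace u with (- - (u * Cconj b) / Cconj b)%C by (field; exact hb').
          rewrite <- Hw. field. exact hb'. }
        assert (hyN : (y ^ ((p - 1) * (q - 1)))%C <> 0) by (apply Cpow_nz, unit_neq0, my).
        split; [split|].
        -- rewrite <- Ez, dpow_mult, <- Cpow_mult_r, (Nat.mul_comm (q - 1)), Eu in Hz.
           replace (dpow p (z / y ^ (q - 1))) with
             (dpow p (z / y ^ (q - 1)) * y ^ ((p - 1) * (q - 1)) / y ^ ((p - 1) * (q - 1)))%C
             by (field; auto).
           rewrite Hz. field. exact hyN.
        -- split; [exact my|]. rewrite Ez, Ew', <- Eu. exact HG.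
        -- rewrite Ez, Ew'. reflexivity.
      * intros [[hzt [my _]] E]. injection E as E1 E2. exists y.
        assert (hyq : (y ^ (q - 1))%C <> 0) by (apply Cpow_nz, unit_neq0, my).
        split.
        -- rewrite <- E1. f_equal. field. exact hyq.
        -- apply Hy. rewrite <- E2. field. exact hw0.
  - exists lS. split; [exact HS|]. split; [|exact HSin].
    rewrite <- HSn, Hlen in HTn. rewrite (Nat.mul_comm (length lS)) in HTn.
    destruct HTn as [h1 h2]. split.
    + apply (Nat.mul_le_mono_pos_l _ _ (p - 1)); [lia|exact h1].
    + apply (Nat.mul_le_mono_pos_l _ _ (p - 1)); [lia|exact h2].
Qed.

End Covering.

(** * Vanishing coefficients and the final count *)

(** The second singularity equation reads [2 w = 0] whatever [u] is, and at [w = 0] [cuspG] reduces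
    to [p z^p]. *)
Lemma cusp_eqs_b0 (p : nat) (a z w : C) : (2 <= p)%nat ->
  cusp_eqs p 2 a 0 z w <-> w = 0 /\
    exists u : C, Cmod u = 1 /\ dpow p z = (- (u * Cconj a))%C /\ (z ^ p + u * Cconj (z ^ p))%C = 0.
Proof.
  intros hp.
  assert (D : forall u : C, dpow 2 w = (- (u * Cconj 0))%C <-> w = 0).
  { intros u. rewrite Cconj_0. unfold dpow. simpl Nat.sub. rewrite Cpow_1_r.
    replace (- (u * 0))%C with (RtoC 0) by ring. split; intros H.
    - apply Cmult_integral in H. destruct H as [H|H]; [|exact H].
      exfalso. revert H. apply INR_C_neq0. lia.
    - rewrite H. ring. }
  assert (E : forall u : C, (cuspG p 2 z 0 + u * Cconj (cuspG p 2 z 0))%C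
                = (INR p * (z ^ p + u * Cconj (z ^ p)))%C).
  { intros u. assert (G : cuspG p 2 z 0 = (INR p * z ^ p)%C).
    { unfold cuspG. simpl Nat.sub. simpl (INR 1). rewrite (Cpow_S 0). ring. }
    rewrite G, Cmult_conj.
    replace (Cconj (INR p)) with (RtoC (INR p)) by (unfold Cconj, RtoC; simpl; f_equal; ring).
    ring. }
  split.
  - intros [u [[hu [Hz Hw]] HG]]. apply D in Hw. split; [exact Hw|]. rewrite Hw, E in HG.
    apply Cmult_integral in HG. destruct HG as [HG|HG].
    + exfalso. revert HG. apply INR_C_neq0. lia.
    + exists u. auto.
  - intros [Hw [u [hu [Hz HG]]]]. exists u. split.
    + split; [exact hu|]. split; [exact Hz|]. apply D, Hw.
    + rewrite Hw, E, HG. ring.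
Qed.

Lemma cusp_eqs_swap (p q : nat) (a b z w : C) :
  cusp_eqs p q a b z w -> cusp_eqs q p b a w z.
Proof.
  assert (E : cuspG p q z w = cuspG q p w z) by (unfold cuspG; ring).
  intros [u [[hu [Hz Hw]] HG]]. exists u. split; [repeat split; assumption|].
  rewrite <- E. exact HG.
Qed.

(** [b = 0] forces [q = 2]; [a = 0] forces [p = 2], hence [q = 2], and is the former case with the
    variables exchanged. Otherwise the covering applies, and isolation of cusps supplies its
    hypothesis for [p = q]. *)
Lemma cusp_list (p q : nat) (a b : C) :
  (2 <= q)%nat -> (q <= p)%nat -> excellent (Fmap p q a b) ->
  exists l, NoDup l /\ ((p + 1) * (q - 1) <= length l <= (p - 1) * (q + 1))%nat /\
    forall x, In x l <-> cusp_eqs p q a b (fst x) (snd x).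
Proof.
  intros hq hqp exc. assert (hp : (2 <= p)%nat) by lia.
  destruct (Ceq_dec b 0) as [hb|hb]; [|destruct (Ceq_dec a 0) as [ha|ha]].
  - assert (ha : a <> 0) by (destruct (excellent_coeffs p q a b hp hq exc); [assumption|contradiction]).
    pose proof (excellent_b0 p q a b hp hq exc hb). subst q b.
    destruct (single_count p a hp ha) as [l [Hl [Hn H]]].
    exists (map (fun z => (z, RtoC 0)) l). split; [|split].
    + apply NoDup_map_in; [exact Hl|]. intros z z' _ _ e. congruence.
    (* The count [p + 1] is the lower bound for [q = 2], and is at most [3 (p - 1)] because
       [p >= 2]. *)
    + rewrite length_map, Hn. nia.
    + intros [z w]. rewrite cusp_eqs_b0 by exact hp. rewrite in_map_iff. simpl fst; simpl snd.
      split.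
      * intros [z' [e h]]. injection e as -> <-. split; [reflexivity|apply H, h].
      * intros [-> h]. exists z. split; [reflexivity|apply H, h].
  - pose proof (excellent_a0 p q a b hp hq exc ha) as e2.
    assert (q = 2%nat) by lia. subst p q a.
    destruct (single_count 2 b hq hb) as [l [Hl [Hn H]]].
    exists (map (fun w => (RtoC 0, w)) l). split; [|split].
    + apply NoDup_map_in; [exact Hl|]. intros z z' _ _ e. congruence.
    + rewrite length_map, Hn. simpl. lia.
    + intros [z w]. simpl fst; simpl snd.
      assert (Hs : cusp_eqs 2 2 0 b z w <-> cusp_eqs 2 2 b 0 w z)
        by (split; apply cusp_eqs_swap).
      rewrite Hs, cusp_eqs_b0, in_map_iff by exact hq. split.
      * intros [w' [e h]]. injection e as <- ->. split; [reflexivity|apply H, h].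
      * intros [-> h]. exists w. split; [reflexivity|apply H, h].
  - destruct (dpow_roots q (- Cconj b)%C hq) as [lr [_ [Hr Hroot]]];
      [apply Copp_neq0, Cconj_neq0, hb|].
    destruct lr as [|w0 lr]; [simpl in Hr; lia|].
    apply (cusp_count p q a b w0 hq hqp ha hb (proj1 (Hroot w0) (or_introl eq_refl))).
    intros z w Hc e. pose proof (excellent_eq_exponents p q a b hp hq exc (mkpt z w) e ha hb) as K.
    rewrite zof_mkpt, wof_mkpt in K. apply K.
    apply (is_cusp_iff p q a b hp hq exc). rewrite zof_mkpt, wof_mkpt. exact Hc.
Qed.

Theorem theorem1p2 (p q : nat) (a b : Cx) :
  (2 <= q)%nat -> (q <= p)%nat -> excellent (Fmap p q a b) ->
  exists l : list (Rn 4),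
    NoDup l /\
    (forall x, is_cusp (Fmap p q a b) x <-> In x l) /\
    ((p + 1) * (q - 1) <= length l <= (p - 1) * (q + 1))%nat /\
    (p = q -> length l = (p * p - 1)%nat).
Proof.
  intros hq hqp exc. assert (hp : (2 <= p)%nat) by lia.
  destruct (cusp_list p q a b hq hqp exc) as [l [Hl [Hn H]]].
  exists (map (fun x => mkpt (fst x) (snd x)) l). rewrite length_map.
  split; [|split; [|split; [exact Hn|]]].
  - apply NoDup_map_in; [exact Hl|]. intros [z w] [z' w'] _ _ e. simpl in e. f_equal.
    + rewrite <- (zof_mkpt z w), e. apply zof_mkpt.
    + rewrite <- (wof_mkpt z w), e. apply wof_mkpt.
  - intros x. rewrite (is_cusp_iff p q a b hp hq exc), in_map_iff. split.
    + intros h. exists (zof x, wof x). split; [apply mkpt_zof_wof|]. apply H, h.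
    + intros [[z w] [<- h]]. simpl fst; simpl snd. rewrite zof_mkpt, wof_mkpt. apply H in h. exact h.
  (* For [p = q] both bounds equal [p^2 - 1]. *)
  - intros <-. nia.
Qed.
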